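(* Let $\alpha\in(1,4/3)$ and $C>0$. Suppose that $\mathbb{P}(W\ge 1)=1$ and $\mathbb{P}(W>x)\sim Cx^{-\alpha}$ as $x\to\infty$. For any fixed $a>0$, $$\lim_{n\to\infty}\frac{\log\mathbb{P}\big(\triangle_n>n^{3-\frac32\alpha}(C^3H+a)\big)}{n^{1-\frac34\alpha}\log n}=-\sqrt{2a}\,\frac{\alpha}{4}.$$
   Context: Model: let $W,W_1,W_2,\dots$ be i.i.d. random variables with continuous distribution function $F$ and $\mu=\mathbb{E}[W]$. The random graph has vertex set $\{1,\dots,n\}$; conditionally on the weights, each pair $i\ne j$ is connected by an edge independently with probability $\min(W_iW_j/(\mu n),1)$. $\triangle_n$ is the number of triangles in the graph. Let $$f_1(u,v,w)=\min\{uv/\mu,1\}\,\min\{vw/\mu,1\}\,\min\{uw/\mu,1\},$$ $$H=\frac{\alpha^3}{6}\int_0^\infty\int_0^\infty\int_0^\infty f_1(u,v,w)\,u^{-\alpha-1}v^{-\alpha-1}w^{-\alpha-1}\,du\,dv\,dw.$$ Here $f(x)\sim g(x)$ means $f(x)/g(x)\to1$. *)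

(* Defs.v *)
From HB Require Import structures.
From mathcomp Require Export all_boot all_order all_algebra finmap.
From mathcomp Require Export all_classical all_reals all_analysis.

Set Implicit Arguments.
Unset Strict Implicit.
Unset Printing Implicit Defensive.

Import Order.TTheory GRing.Theory Num.Theory.
Import numFieldTopology.Exports numFieldNormedType.Exports.

Local Open Scope classical_set_scope.
Local Open Scope ring_scope.

Section Probability.
Context (d : measure_display) (T : measurableType d) (R : realType).
Variable P : probability T R.

Definition mutually_independent (X : nat -> {RV P >-> R}) : Prop :=
  forall (J : {fset nat}) (B : nat -> set R), (forall i, measurable (B i)) ->
    P (\bigcap_(i in [set` J]) (X i @^-1` B i))
      = (\prod_(i <- J) P (X i @^-1` B i))%E.

Definition identically_distributed (X : nat -> {RV P >-> R}) : Prop :=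
  forall (i j : nat) (B : set R), measurable B ->
    distribution P (X i) B = distribution P (X j) B.

Definition iid (X : nat -> {RV P >-> R}) : Prop :=
  mutually_independent X /\ identically_distributed X.

Definition sigma_of_first (X : nat -> {RV P >-> R}) (n : nat) : set (set T) :=
  <<s \bigcup_(i in `I_n) preimage_set_system setT (X i) measurable >>.

(* q is a version of the conditional probability P(A | F). *)
Definition is_cond_prob (F : set (set T)) (A : set T) (q : T -> R) : Prop :=
  [/\ forall B : set R, measurable B -> F (q @^-1` B),
      P.-integrable setT (EFin \o q) &
      forall E, F E -> (\int[P]_(x in E) (q x)%:E = P (A `&` E))%E].

(* Conditionally on F, the events A i (i in D) are independent and A i has
   probability q i: singletons J give the conditional probabilities, general J
   the product rule. *)
Definition cond_indep_events (I : choiceType) (F : set (set T)) (D : set I)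
    (A : I -> set T) (q : I -> T -> R) : Prop :=
  forall J : {fset I}, [set` J] `<=` D ->
    is_cond_prob F (\bigcap_(i in [set` J]) A i)
      (fun x => \prod_(i <- J) q i x).

Definition weight_mean (X : nat -> {RV P >-> R}) : R := fine 'E_P[X 0%N].

Definition edge_prob (X : nat -> {RV P >-> R}) (n : nat) (i j : nat) (x : T)
    : R :=
  Num.min (X i x * X j x / (weight_mean X * n%:R)) 1.

(* Vertices are numbered from 0; vertex i has weight X i. *)
Definition random_graph (X : nat -> {RV P >-> R}) (n : nat)
    (G : T -> rel 'I_n) : Prop :=
  [/\ forall x, symmetric (G x),
      forall x, irreflexive (G x),
      forall i j, measurable [set x | G x i j] &
      cond_indep_events (sigma_of_first X n)
        [set e : 'I_n * 'I_n | (e.1 < e.2)%N]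
        (fun e => [set x | G x e.1 e.2])
        (fun e => edge_prob X n e.1 e.2)].

End Probability.

Definition triangles (n : nat) (e : rel 'I_n) : nat :=
  #|[pred S : {set 'I_n} | (#|S| == 3%N) &&
      [forall i in S, forall j in S, (i != j) ==> e i j]]|.

Section Constant.
Context (R : realType).
Implicit Types mu alpha u v w : R.

Definition f1 mu u v w : R :=
  Num.min (u * v / mu) 1 * Num.min (v * w / mu) 1 * Num.min (u * w / mu) 1.

Definition Hconst mu alpha : R :=
  alpha ^+ 3 / 6 *
  fine (\int[lebesgue_measure]_(w in `]0%R, +oo[)
        \int[lebesgue_measure]_(v in `]0%R, +oo[)
        \int[lebesgue_measure]_(u in `]0%R, +oo[)
          (f1 mu u v w * u `^ (- alpha - 1) * v `^ (- alpha - 1)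
            * w `^ (- alpha - 1))%:E)%E.

Definition asymp_equiv (f g : R -> R) : Prop :=
  (f x / g x) @[x --> +oo] --> (1 : R).

End Constant.

(* Main.v *)
(** Write [lambda = 1 - 3 alpha / 4].  The excess [a n^(3 - 3 alpha / 2)] is
    created by about [sqrt (2 a) n^lambda] hubs of weight of order [n]: two hubs
    close a triangle with every other vertex.  As [n P(W > n)] is
    of order [n^(1 - alpha)], the probability of [h = kappa n^lambda] hubs is about
    [(n^(1 - alpha) / h)^h], that is [n^(- h alpha / 4)].

    Upper bound: deletion method of Janson and Rucinski, deleting vertices.  If a
    random family of [s]-sets keeps at least [m] members whenever at most [s z]
    vertices are removed, then it contains [m^z] sequences of [z] pairwise disjoint
    members; disjoint sets are independent, so Markov's inequality makes this
    unlikely.  Applied to the triangles, the edges, the neighbourhoods of vertices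
    of weight at most [n^(1 - delta)], and the hubs (vertices of larger weight), it
    leaves [C^3 H n^(3 - 3 alpha / 2)] triangles, a smaller error, and one triangle
    for each pair of hubs and each vertex.

    Lower bound: a vertex of weight at least [mu n] is adjacent to all others,
    since [W >= 1].  Reserve [k] blocks of vertices and ask for such a vertex in
    each.  Independently, the other vertices span at least
    [(1 - o(1)) C^3 H n^(3 - 3 alpha / 2)] triangles with probability at least
    [n^-3]; the first moment suffices, as there are at most [n^3] triangles.

    To have finitely many configurations, weights are rounded up to a geometric
    grid of ratio [c], which changes [H] by a factor between [1] and [c^6]. *)

Require Import Defs.
From mathcomp Require Import measurable_realfun zify ring lra.

Set Implicit Arguments.
Unset Strict Implicit.
Unset Printing Implicit Defensive.

Import Order.TTheory GRing.Theory Num.Theory.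
Import numFieldTopology.Exports numFieldNormedType.Exports.

(** * Counting triangles after deleting vertices *)

(** Ordinary triangles join weights of order [sqrt n]; their number is of order [n ^ 3 (sqrt n) ^ (-
    3 alpha) = n ^ (1 + 2 lambda)], which is also the order of [h ^ 2 n] for [h] hubs. Equating
    [h ^ 2 n / 2] with the excess gives [sqrt (2 a)]. The condition [alpha < 4/3] means
    [lambda > 0]; [alpha > 1] gives a finite mean and [lambda < 1/4].

    The sharp exponent must come from the hubs alone, so deletion runs with two lengths: [z] of
    order [n ^ (lambda + eta)] for triangles, edges and neighbourhoods, where a constant ratio
    [r < 1] already makes [n r ^ z] negligible, and [z4] close to [sqrt (2 a) n ^ lambda] for the
    hubs. The longer [z] means deleting [5 z] vertices, whose triangles cost about
    [z n + z ^ 2 (n ^ (1 - delta) + z)], still below [n ^ (1 + 2 lambda)].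

    A level does not determine the weight, so given the levels, edges at a common vertex need not be
    independent. The finite model therefore assumes only product bounds, above and below, for the
    probability that given edges are all present. *)

Lemma leq_imset2_card (A B C : finType) (f : A -> B -> C) (X : {set A}) (Y : {set B}) :
  (#|f @2: (X, Y)| <= #|X| * #|Y|)%N.
Proof. by rewrite curry_imset2X -cardsX; exact: leq_imset_card. Qed.

Section Cliques.
Context (V : finType) (e : rel V).
Implicit Types (S D U : {set V}).

Definition cliques (s : nat) : {set {set V}} :=
  [set S : {set V} | (#|S| == s) &&
     [forall i in S, forall j in S, (i != j) ==> e i j]].

Lemma cliquesP s S : reflect (#|S| = s /\ forall i j, i \in S -> j \in S -> i != j -> e i j)
  (S \in cliques s).
Proof.
rewrite inE; apply: (iffP andP) => -[/eqP Ss H]; split=> //; rewrite ?Ss //.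
  move=> i j iS jS ij.
  by have /forallP/(_ i)/implyP/(_ iS)/forallP/(_ j)/implyP/(_ jS)/implyP := H; apply.
apply/forallP => i; apply/implyP => iS; apply/forallP => j; apply/implyP => jS.
by apply/implyP; exact: H.
Qed.

Lemma card3_split S d d' : #|S| = 3 -> d \in S -> d' \in S -> d != d' ->
  exists w, [/\ w != d, w != d' & S = w |: [set d; d']].
Proof.
move=> S3 dS d'S dd'.
have : #|S :\ d :\ d'| == 1%N.
  move: S3; rewrite (cardsD1 d) dS (cardsD1 d') !inE d'S (eq_sym d') dd' /=; lia.
move=> /cards1P[w Sw]; exists w.
have : w \in S :\ d :\ d' by rewrite Sw !inE.
rewrite !inE => /and3P[-> -> wS]; split => //.
apply/finset.setP => x; have /finset.setP/(_ x) := Sw; rewrite !inE => <-.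
case: (eqVneq x d) => [->|_] /=; first by rewrite dS orbT.
by case: (eqVneq x d') => [->|_] /=; rewrite ?d'S ?orbF.
Qed.

Context (esym : symmetric e).

(** Four classes cover all triangles: those avoiding [D]; those with one vertex in [D], whose
    opposite edge avoids [D] ([A1]); those with two vertices in [D], one of them not a hub, whose
    third vertex is a neighbour of that one ([A2]); and those made of two hubs and any vertex
    ([A4]). *)
Lemma card_cliques3_le (D hub : {set V}) (m2 m3 dm : nat) :
  (#|[set S in cliques 3 | [disjoint S & D]]| <= m3)%N ->
  (#|[set S in cliques 2 | [disjoint S & D]]| <= m2)%N ->
  (forall i, i \notin hub -> #|[set j | e i j]| <= dm)%N ->
  (#|cliques 3| <= m3 + #|D| * m2 + #|D| * (#|D| * dm) + 'C(#|hub|, 2) * #|V|)%N.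
Proof.
move=> Hm3 Hm2 Hdm.
pose A1 := [set d |: E | d in D, E in [set S in cliques 2 | [disjoint S & D]]].
pose A2 := \bigcup_(d in D :\: hub) \bigcup_(d' in D)
             [set w |: [set d; d'] | w in [set j | e d j]].
pose A4 := [set w |: B | B in [set B : {set V} | (B \subset hub) && (#|B| == 2%N)],
              w in [set: V]].
have cover : cliques 3 \subset
    [set S in cliques 3 | [disjoint S & D]] :|: A1 :|: A2 :|: A4.
  apply/fintype.subsetP => S SC; have /cliquesP[S3 Se] := SC.
  rewrite !inE -/(cliques 3).
  case: (boolP [disjoint S & D]) => [SD|].
    by move: SC; rewrite !inE => ->.
  rewrite -finset.setI_eq0 => /finset.set0Pn[d]; rewrite inE => /andP[dS dD].
  case: (boolP [exists d', [&& d' \in S, d' \in D & d' != d]]); last first.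
    rewrite negb_exists => /forallP H.
    suff -> : S \in A1 by rewrite orbT.
    apply/imset2P; exists d (S :\ d) => //; last by rewrite finset.setD1K.
    rewrite inE; apply/andP; split; last first.
      rewrite -finset.setI_eq0; apply/eqP/finset.setP => x; rewrite !inE.
      by have := H x; case: eqP => //= _; case: (x \in S) => //=; case: (x \in D).
    apply/cliquesP; split; first by move: S3; rewrite (cardsD1 d) dS; lia.
    by move=> i j; rewrite !inE => /andP[_ iS] /andP[_ jS]; exact: Se.
  move=> /existsP[d' /and3P[d'S d'D d'd]].
  have A2P x x' : x \in S -> x' \in S -> x \in D -> x' \in D -> x != x' ->
      x \notin hub -> S \in A2.
    move=> xS x'S xD x'D xx' xh; apply/finset.bigcupP; exists x; rewrite ?inE ?xD ?xh //.
    apply/finset.bigcupP; exists x' => //.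
    have [w [wx wx' Sw]] := card3_split S3 xS x'S xx'.
    apply/imsetP; exists w => //; rewrite inE; apply: Se => //; last by rewrite eq_sym.
    by rewrite Sw !inE eqxx.
  case: (boolP (d \in hub)) => dh; last by rewrite (A2P d d') ?orbT // eq_sym.
  case: (boolP (d' \in hub)) => d'h; last by rewrite (A2P d' d) ?orbT.
  suff -> : S \in A4 by rewrite !orbT.
  have dd' : d != d' by rewrite eq_sym.
  have [w [wx wx' Sw]] := card3_split S3 dS d'S dd'.
  apply/imset2P; exists [set d; d'] w => //; rewrite inE cards2 (eq_sym d) d'd andbT.
  by apply/fintype.subsetP => x; rewrite !inE => /orP[] /eqP ->.
apply: leq_trans (subset_leq_card cover) _.
have cU (A B : {set {set V}}) : (#|A :|: B| <= #|A| + #|B|)%N.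
  by rewrite cardsU leq_subr.
apply: (leq_trans (cU _ _)); apply: leq_add; last first.
  apply: (leq_trans (leq_imset2_card _ _ _)).
  by rewrite cardsT leq_mul2r -cards_draws leqnn orbT.
apply: (leq_trans (cU _ _)); apply: leq_add; last first.
  have bU (J : {set V}) (F : V -> {set {set V}}) (b : nat) :
      (forall x, x \in J -> #|F x| <= b)%N -> (#|\bigcup_(x in J) F x| <= #|J| * b)%N.
    move=> HF; rewrite -sum_nat_const; elim/big_rec2: _ => [|x u v xJ uv].
      by rewrite finset.cards0.
    by apply: (leq_trans (cU _ _)); apply: leq_add => //; exact: HF.
  have DH : (#|D :\: hub| <= #|D|)%N by apply: subset_leq_card; exact: finset.subsetDl.
  apply: (@leq_trans (#|D :\: hub| * (#|D| * dm))%N); last by rewrite leq_mul2r DH orbT.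
  apply: (bU _ _ (#|D| * dm)%N) => x; rewrite inE => /andP[xh _].
  apply: bU => y _; apply: (leq_trans (leq_imset_card _ _)); exact: Hdm.
apply: (leq_trans (cU _ _)); apply: leq_add => //.
apply: (leq_trans (leq_imset2_card _ _ _)).
by rewrite leq_mul2l Hm2 orbT.
Qed.

(** Adding [w] in [U] to a pair [B] of hubs gives a triangle from which [B] is recovered by
    intersecting with [hub] and [w] by removing [hub]. Distinct choices thus give distinct
    triangles, none of them inside [U]. *)
Lemma card_cliques3_ge (U hub : {set V}) : [disjoint U & hub] ->
  (forall i j, i \in hub -> i != j -> e i j) ->
  ('C(#|hub|, 2) * #|U| + #|[set S in cliques 3 | S \subset U]| <= #|cliques 3|)%N.
Proof.
move=> dUH He.
pose P := [set B : {set V} | (B \subset hub) && (#|B| == 2%N)].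
pose f (u : {set V} * V) := u.2 |: u.1.
have UH x : x \in U -> x \in hub = false by move=> xU; rewrite (disjointFr dUH).
have fE u : u \in finset.setX P U -> f u :&: hub = u.1 /\ f u :\: hub = [set u.2].
  case: u => B w; rewrite !inE /= => /andP[/andP[/fintype.subsetP BH _] wU].
  split; apply/finset.setP => x; rewrite !inE /=.
    case: (boolP (x \in B)) => [/BH ->|xB]; first by rewrite orbT.
    by rewrite orbF; case: eqP => // ->; rewrite UH.
  case: eqP => [->|_] /=; first by rewrite UH.
  by case: (boolP (x \in B)) => [/BH ->|]; rewrite ?andbF.
have finj : {in finset.setX P U &, injective f}.
  move=> [B w] [B' w'] /fE[/= E1 E2] /fE[/= E3 E4] E.
  by rewrite -E1 E E3; congr pair; apply: finset.set1_inj; rewrite -E2 E E4.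
rewrite -(_ : #|f @: finset.setX P U| = ('C(#|hub|, 2) * #|U|)%N); last first.
  by rewrite card_in_imset // cardsX -cards_draws.
rewrite -cardsUI [X in (_ + X)%N](_ : _ = 0%N) ?addn0.
  apply: subset_leq_card; apply/fintype.subsetP => S.
  rewrite inE => /orP[/imsetP[[B w] /[dup] BwPU]|]; last by rewrite inE => /andP[].
  rewrite !inE /= => /andP[/andP[/fintype.subsetP BH /eqP B2] wU] -> {S}.
  have wB : w \notin B by apply/negP => /BH; rewrite UH.
  rewrite -/(cliques 3) /f /=; apply/andP; split.
    by rewrite cardsU1 wB B2.
  apply/forallP => i; apply/implyP => iS; apply/forallP => j; apply/implyP => jS.
  apply/implyP => ij; move: iS; rewrite !inE => /orP[/eqP iw|/BH iH]; last exact: He.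
  move: jS; rewrite !inE => /orP[/eqP jw|/BH jH]; first by move: ij; rewrite iw jw eqxx.
  by rewrite esym He // eq_sym.
apply/eqP; rewrite finset.cards_eq0; apply/eqP/finset.setP => S; rewrite !inE.
apply/negP => /andP[/imsetP[[B w] BwPU ->] /andP[_ /fintype.subsetP SU]].
move: BwPU; rewrite !inE /= => /andP[/andP[/fintype.subsetP BH /eqP B2] wU].
have : B != finset.set0 by rewrite -finset.cards_eq0 B2.
move=> /finset.set0Pn[x xB]; have := SU x; rewrite !inE xB orbT => /(_ isT) xU.
by have := BH x xB; rewrite UH.
Qed.

End Cliques.

Local Open Scope ring_scope.

(** * Product weights *)

Section ProductExpectation.
Context (R : realFieldType) (I K : finType) (p : K -> R).
Implicit Types (g : {ffun I -> K} -> R) (A B : {set I}).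

Definition prod_weight (phi : {ffun I -> K}) : R := \prod_i p (phi i).

Definition prod_expect g : R := \sum_phi prod_weight phi * g phi.

Definition depends_on A g :=
  forall phi psi : {ffun I -> K},
    (forall i, i \in A -> phi i = psi i) -> g phi = g psi.

Lemma eq_prod_expect g1 g2 : g1 =1 g2 -> prod_expect g1 = prod_expect g2.
Proof. by move=> e; apply: eq_bigr => phi _; rewrite e. Qed.

Lemma prod_expect_prod (h : I -> K -> R) :
  prod_expect (fun phi => \prod_i h i (phi i)) = \prod_i \sum_a p a * h i a.
Proof.
rewrite /prod_expect /prod_weight bigA_distr_bigA /=.
by apply: eq_bigr => phi _; rewrite -big_split.
Qed.

Lemma prod_expectB g1 g2 :
  prod_expect (fun phi => g1 phi - g2 phi) = prod_expect g1 - prod_expect g2.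
Proof. by rewrite -sumrB; apply: eq_bigr => phi _; rewrite mulrBr. Qed.

Lemma prod_expect_sum (J : Type) (r : seq J) (Q : pred J)
    (g : J -> {ffun I -> K} -> R) :
  prod_expect (fun phi => \sum_(j <- r | Q j) g j phi)
  = \sum_(j <- r | Q j) prod_expect (g j).
Proof.
rewrite /prod_expect exchange_big /=; apply: eq_bigr => phi _.
by rewrite mulr_sumr.
Qed.

Lemma prod_expectZ (c : R) g : prod_expect (fun phi => c * g phi) = c * prod_expect g.
Proof. by rewrite /prod_expect mulr_sumr; apply: eq_bigr => phi _; rewrite mulrCA. Qed.

Hypothesis p_sum1 : \sum_a p a = 1.

Lemma prod_expect1 : prod_expect (fun=> 1) = 1.
Proof.
have := prod_expect_prod (fun _ _ => 1).
under eq_prod_expect do rewrite big1 //.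
move=> ->; rewrite big1 // => i _.
by under eq_bigr do rewrite mulr1.
Qed.

Lemma prod_expect_coord (i : I) (h : K -> R) :
  prod_expect (fun phi => h (phi i)) = \sum_a p a * h a.
Proof.
pose f (j : I) (a : K) := if j == i then h a else 1.
rewrite (@eq_prod_expect _ (fun phi => \prod_j f j (phi j))); last first.
  move=> phi; rewrite (bigD1 i) //= /f eqxx big1 ?mulr1 // => j /negPf -> //.
rewrite prod_expect_prod (bigD1 i) //= [X in _ * X]big1 ?mulr1.
  by apply: eq_bigr => a _; rewrite /f eqxx.
by move=> j /negPf ji; under eq_bigr do rewrite /f ji mulr1.
Qed.

Lemma depends_on_coord A i (h : K -> R) :
  i \in A -> depends_on A (fun phi => h (phi i)).
Proof. by move=> iA phi psi e; rewrite e. Qed.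

Lemma depends_onM A g1 g2 : depends_on A g1 -> depends_on A g2 ->
  depends_on A (fun phi => g1 phi * g2 phi).
Proof. by move=> h1 h2 phi psi e; rewrite (h1 _ _ e) (h2 _ _ e). Qed.

Lemma sub_depends_on A B g : A \subset B -> depends_on A g -> depends_on B g.
Proof. by move=> /fintype.subsetP AB h phi psi e; apply: h => i /AB; apply: e. Qed.

(* Exchanging the coordinates in A of two independent copies preserves the
   product weight. *)
Lemma prod_expectM A B g1 g2 : [disjoint A & B] ->
  depends_on A g1 -> depends_on B g2 ->
  prod_expect (fun phi => g1 phi * g2 phi) = prod_expect g1 * prod_expect g2.
Proof.
move=> dAB d1 d2.
pose mix (phi psi : {ffun I -> K}) : {ffun I -> K} := [ffun i => if i \in A then phi i else psi i].
have mixl phi psi : g1 (mix phi psi) = g1 phi by apply: d1 => i iA; rewrite ffunE iA.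
have mixr phi psi : g2 (mix phi psi) = g2 psi.
  apply: d2 => i iB; rewrite ffunE; case: ifP => // iA.
  by have := disjointFr dAB iA; rewrite iB.
pose s (u : {ffun I -> K} * {ffun I -> K}) := (mix u.1 u.2, mix u.2 u.1).
have sK : involutive s.
  move=> [phi psi]; rewrite /s /=;
  by apply: (f_equal2 pair); apply/ffunP => i; rewrite !ffunE; case: ifP => [->|->].
rewrite /prod_expect big_distrl /=.
transitivity (\sum_phi \sum_psi prod_weight phi * prod_weight psi * (g1 phi * g2 phi)).
  rewrite -[LHS]mulr1 -prod_expect1 /prod_expect big_distrl /=.
  apply: eq_bigr => phi _; rewrite mulr_sumr; apply: eq_bigr => psi _; ring.
transitivity (\sum_phi \sum_psi prod_weight phi * prod_weight psi * (g1 phi * g2 psi)).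
  rewrite pair_big [RHS]pair_big /= (reindex_inj (inv_inj sK)) /=.
  apply: eq_bigr => -[phi psi] _ /=; rewrite mixl mixr; congr (_ * _).
  rewrite /prod_weight -!big_split /=; apply: eq_bigr => i _; rewrite !ffunE.
  by case: ifP => // _; rewrite mulrC.
apply: eq_bigr => phi _; rewrite mulr_sumr; apply: eq_bigr => psi _; ring.
Qed.

Lemma depends_on_prod (J : eqType) (r : seq J) (A : J -> {set I})
    (g : J -> {ffun I -> K} -> R) :
  (forall j, j \in r -> depends_on (A j) (g j)) ->
  depends_on (\bigcup_(j <- r) A j) (fun phi => \prod_(j <- r) g j phi).
Proof.
move=> dg phi psi e; rewrite !big_seq; apply: eq_bigr => j jr.
by apply: dg => // i ij; apply: e; rewrite (big_rem j) //= inE ij.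
Qed.

Lemma prod_expect_big (J : eqType) (r : seq J) (A : J -> {set I})
    (g : J -> {ffun I -> K} -> R) :
  pairwise (fun i j => [disjoint A i & A j]) r ->
  (forall j, j \in r -> depends_on (A j) (g j)) ->
  prod_expect (fun phi => \prod_(j <- r) g j phi)
  = \prod_(j <- r) prod_expect (g j).
Proof.
elim: r => [_ _|j r ih /=/andP[/allP jr pr] dg].
  rewrite big_nil -[RHS]prod_expect1; apply: eq_prod_expect => phi.
  by rewrite big_nil.
rewrite big_cons -ih //; last by move=> i ir; apply: dg; rewrite inE ir orbT.
under eq_prod_expect do rewrite big_cons.
apply: (@prod_expectM (A j) (\bigcup_(i <- r) A i)).
- rewrite big_seq; elim/big_ind: _ => [|U V dU dV|i /jr //].
    by rewrite -finset.setI_eq0 finset.setI0.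
  by rewrite -finset.setI_eq0 finset.setIUr finset.setU_eq0 !finset.setI_eq0 dU.
- by apply: dg; rewrite inE eqxx.
- by apply: depends_on_prod => i ir; apply: dg; rewrite inE ir orbT.
Qed.

Lemma prod_expect_indic3 (i j k : I) (a b c : K) : i != j -> i != k -> j != k ->
  prod_expect (fun phi =>
    (phi i == a)%:R * ((phi j == b)%:R * (phi k == c)%:R)) = p a * (p b * p c).
Proof.
move=> ij ik jk.
have coordE l d : prod_expect (fun phi => (phi l == d)%:R) = p d.
  rewrite (prod_expect_coord l (fun e => (e == d)%:R)) (bigD1 d) //= eqxx mulr1.
  by rewrite big1 ?addr0 // => e /negPf ->; rewrite mulr0.
have dep l d : depends_on [set l] (fun phi => (phi l == d)%:R).
  by apply: (@depends_on_coord _ l (fun e => (e == d)%:R)); rewrite inE.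
rewrite (@prod_expectM [set i] [set j; k]) ?coordE //.
- by rewrite (@prod_expectM [set j] [set k]) ?coordE // disjoints1 inE.
- by rewrite disjoints1 !inE negb_or ij.
- apply: depends_onM; apply: sub_depends_on (dep _ _); rewrite finset.sub1set !inE eqxx ?orbT //.
Qed.

Lemma prod_expect_coord3 (i j k : I) (h : K -> K -> K -> R) :
  i != j -> i != k -> j != k ->
  prod_expect (fun phi => h (phi i) (phi j) (phi k))
  = \sum_a \sum_b \sum_c p a * (p b * p c) * h a b c.
Proof.
move=> ij ik jk.
under [RHS]eq_bigr do rewrite pair_big /=.
rewrite pair_big /=.
transitivity (prod_expect (fun phi => \sum_u
   h u.1 u.2.1 u.2.2 * ((phi i == u.1)%:R * ((phi j == u.2.1)%:R * (phi k == u.2.2)%:R)))).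
  apply: eq_prod_expect => phi.
  rewrite (bigD1 (phi i, (phi j, phi k))) //= !eqxx !mulr1 big1 ?addr0 //.
  move=> [a [b c]] /=; rewrite !xpair_eqE.
  rewrite ![_ == phi _]eq_sym.
  by case: eqP => //=; case: eqP => //=; case: eqP => //= _ _ _; rewrite ?(mulr0, mul0r).
rewrite prod_expect_sum; apply: eq_bigr => -[a [b c]] _ /=.
by rewrite prod_expectZ prod_expect_indic3 // mulrC.
Qed.

End ProductExpectation.

(** * The deletion method *)

Section Deletion.
Context (R : realFieldType) (V : finType).
Implicit Types (F : {set {set V}}) (U S : {set V}) (z : nat) (m : R).

(* Number of sequences of [z] pairwise disjoint members of [F] avoiding [U]. *)
Fixpoint disjoint_seqs F z U : nat :=
  if z is z'.+1 then
    (\sum_(S in F | [disjoint S & U]) disjoint_seqs F z' (S :|: U))%N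
  else 1%N.

(** Used through its negation: some set of at most [b] vertices can be removed so that fewer than
    [m] members survive. Such sets make up the [D] of the triangle count. *)
Definition robust F (b : nat) m :=
  [forall U : {set V}, (#|U| <= b)%N ==>
     (m <= #|[set S in F | [disjoint S & U]]|%:R)].

(** Greedy choice: each chosen member forbids at most [s] further vertices, so as long as at most
    [b] are forbidden, every step offers at least [m] members. *)
Lemma robust_disjoint_seqs F (s b : nat) m z U :
  (forall S, S \in F -> (#|S| <= s)%N) -> 0 <= m -> robust F b m ->
  (#|U| + s * z <= b)%N -> m ^+ z <= (disjoint_seqs F z U)%:R.
Proof.
move=> sF m0 /forallP rF; elim: z U => [|z ih] U Ub //=.
rewrite natr_sum exprS.
apply: (@le_trans _ _ (\sum_(S in F | [disjoint S & U]) m ^+ z)); last first.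
  apply: ler_sum => S /andP[SF _]; apply: ih.
  have := cardsUI S U; have := sF _ SF; lia.
rewrite sumr_const -mulr_natl; apply: ler_wpM2r; first exact: exprn_ge0.
have /implyP := rF U; rewrite cardsE; apply; lia.
Qed.

Context (Omega : finType) (pi : Omega -> R).
Hypothesis pi_ge0 : forall w, 0 <= pi w.

(** Here [l] is the part of the sequence already chosen. Each induction step moves one member from
    the count [disjoint_seqs] into the condition on [w]; the product bound for disjoint lists is
    used only at [z = 0], on the complete list. *)
Lemma sum_disjoint_seqs_le (Cand : {set {set V}}) (F : Omega -> {set {set V}}) (q : R)
    z (l : seq {set V}) : 0 <= q -> (forall w, F w \subset Cand) ->
  (forall l : seq {set V}, {subset l <= Cand} ->
     pairwise (fun A B : {set V} => [disjoint A & B]) l ->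
     \sum_(w | all (mem (F w)) l) pi w <= q ^+ size l) ->
  {subset l <= Cand} -> pairwise (fun A B : {set V} => [disjoint A & B]) l ->
  \sum_(w | all (mem (F w)) l) pi w * (disjoint_seqs (F w) z (\bigcup_(S <- l) S))%:R
    <= (#|Cand|%:R * q) ^+ z * q ^+ size l.
Proof.
move=> q0 FC Hq; elim: z l => [|z ih] l lC pl.
  rewrite expr0 mul1r; apply: le_trans (Hq _ lC pl); apply: ler_sum => w _.
  by rewrite /= mulr1.
rewrite [leLHS](_ : _ = \sum_(S in Cand | [disjoint S & \bigcup_(S' <- l) S'])
    \sum_(w | all (mem (F w)) (S :: l))
       pi w * (disjoint_seqs (F w) z (\bigcup_(S' <- S :: l) S'))%:R); last first.
  rewrite [RHS](exchange_big_dep (fun w => all (mem (F w)) l)) /=; last by move=> ? ? _ /andP[].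
  apply: eq_bigr => w lw; rewrite natr_sum mulr_sumr.
  apply: eq_big => [S|S _]; last by rewrite big_cons.
  rewrite lw andbT; case: (boolP (S \in F w)) => SF; rewrite ?andbF ?andbT //=.
  by rewrite (fintype.subsetP (FC w) _ SF).
apply: (@le_trans _ _ (\sum_(S in Cand) (#|Cand|%:R * q) ^+ z * q ^+ (size l).+1)).
  rewrite [leLHS]big_mkcondr /=; apply: ler_sum => S SC.
  case: ifPn => [dS|_]; last by rewrite !(mulr_ge0, exprn_ge0).
  have := ih (S :: l); rewrite /=; apply => [S'|/=]; first by rewrite inE => /orP[/eqP->//|/lC].
  rewrite pl andbT; apply/allP => S' S'l; apply: disjointWr dS.
  by rewrite (big_rem S') //= finset.subsetUl.
by rewrite le_eqVlt; apply/orP; left; apply/eqP; rewrite sumr_const !exprS -mulr_natl; ring.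
Qed.

(** The resulting bound decays geometrically in [z] as soon as [m] exceeds [#|Cand|%:R * q], the
    bound on the mean, by a constant factor. *)
Lemma deletion_bound (Cand : {set {set V}}) (F : Omega -> {set {set V}}) (q : R)
    (s z : nat) m : 0 <= q -> 0 <= m -> (forall w, F w \subset Cand) ->
  (forall S, S \in Cand -> (#|S| <= s)%N) ->
  (forall l : seq {set V}, {subset l <= Cand} ->
     pairwise (fun A B : {set V} => [disjoint A & B]) l ->
     \sum_(w | all (mem (F w)) l) pi w <= q ^+ size l) ->
  (\sum_(w | robust (F w) (s * z) m) pi w) * m ^+ z <= (#|Cand|%:R * q) ^+ z.
Proof.
move=> q0 m0 FC sC Hq.
have := @sum_disjoint_seqs_le Cand F q z [::] q0 FC Hq; rewrite /= mulr1 big_nil.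
move=> /(_ _ isT) H; apply: (le_trans _ (H _)) => //.
rewrite mulr_suml [leRHS](bigID (fun w => robust (F w) (s * z) m)) /=.
rewrite -[leLHS]addr0; apply: lerD; last by apply: sumr_ge0 => w _; apply: mulr_ge0; rewrite ?ler0n.
apply: ler_sum => w rw; apply: ler_wpM2l => //.
apply: (@robust_disjoint_seqs _ s _ _ _ _ _ m0 rw); last by rewrite finset.cards0.
by move=> S /(fintype.subsetP (FC w)); exact: sC.
Qed.

End Deletion.

(** * Cliques in a finite model *)

Section OrderedPairs.
Context (n : nat).
Implicit Types (S : {set 'I_n}).

(** The edges of the complete graph on [S], each with its smaller endpoint first, as configurations
    store them. *)
Definition ordered_pairs S : {set 'I_n * 'I_n} :=
  [set u | [&& u.1 \in S, u.2 \in S & (u.1 < u.2)%N]].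

Lemma card2_sorted S : #|S| = 2%N ->
  exists i j : 'I_n, (i < j)%N /\ S = [set i; j].
Proof.
move=> /eqP /cards2P[i [j [ij ->]]]; case: (ssrnat.ltngtP i j) => [h|h|/ord_inj h].
- by exists i, j.
- by exists j, i; rewrite finset.setUC.
- by rewrite h eqxx in ij.
Qed.

Lemma card3_sorted S : #|S| = 3%N ->
  exists i j k : 'I_n, [/\ (i < j)%N, (j < k)%N & S = [set i; j; k]].
Proof.
move=> S3; have : (1 < #|S|)%N by rewrite S3.
move=> /card_gt1P[a [b [aS bS ab]]].
have [c [ca cb ->]] := card3_split S3 aS bS ab.
move: ab ca cb; rewrite -!val_eqE /= => ab ca cb.
have [h|h|h] := ssrnat.ltngtP a b; last by rewrite h eqxx in ab.
- have [h1|h1|h1] := ssrnat.ltngtP c a; last by rewrite h1 eqxx in ca.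
    by exists c, a, b; split=> //; apply/finset.setP => x; rewrite !inE orbA.
  have [h2|h2|h2] := ssrnat.ltngtP c b; last by rewrite h2 eqxx in cb.
    exists a, c, b; split=> //; apply/finset.setP => x; rewrite !inE.
    by case: (x == a); case: (x == b); case: (x == c).
  exists a, b, c; split=> //; apply/finset.setP => x; rewrite !inE.
  by case: (x == a); case: (x == b); case: (x == c).
- have [h1|h1|h1] := ssrnat.ltngtP c b; last by rewrite h1 eqxx in cb.
    exists c, b, a; split=> //; apply/finset.setP => x; rewrite !inE.
    by case: (x == a); case: (x == b); case: (x == c).
  have [h2|h2|h2] := ssrnat.ltngtP c a; last by rewrite h2 eqxx in ca.
    exists b, c, a; split=> //; apply/finset.setP => x; rewrite !inE.
    by case: (x == a); case: (x == b); case: (x == c).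
  exists b, a, c; split=> //; apply/finset.setP => x; rewrite !inE.
  by case: (x == a); case: (x == b); case: (x == c).
Qed.

Lemma ordered_pairs2 (R : comPzSemiRingType) (f : 'I_n -> 'I_n -> R) (i j : 'I_n) :
  (i < j)%N -> \prod_(u in ordered_pairs [set i; j]) f u.1 u.2 = f i j.
Proof.
move=> ij; rewrite (_ : ordered_pairs _ = [set (i, j)]) ?big_set1 //.
apply/finset.setP => -[a b]; rewrite !inE /= xpair_eqE -!val_eqE /=.
lia.
Qed.

Lemma ordered_pairs3 (R : comPzSemiRingType) (f : 'I_n -> 'I_n -> R) (i j k : 'I_n) :
  (i < j)%N -> (j < k)%N ->
  \prod_(u in ordered_pairs [set i; j; k]) f u.1 u.2 = f i j * (f i k * f j k).
Proof.
move=> ij jk; rewrite (_ : ordered_pairs _ = (i, j) |: ((i, k) |: [set (j, k)])).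
  have ne (a b : 'I_n) : (a < b)%N -> (a == b) = false.
    by move=> ab; apply/negP => /eqP ab'; move: ab; rewrite ab' ltnn.
  rewrite big_setU1 /=; last by rewrite !inE !xpair_eqE eqxx (ne i j) // (ne j k).
  by rewrite big_setU1 ?big_set1 //= inE xpair_eqE (ne i j).
apply/finset.setP => -[a b]; rewrite !inE /= !xpair_eqE -!val_eqE /=.
lia.
Qed.

Lemma prod_bigcup_pairs (R : comPzSemiRingType) (f : 'I_n * 'I_n -> R)
    (l : seq {set 'I_n}) :
  pairwise (fun A B : {set 'I_n} => [disjoint A & B]) l ->
  \prod_(u in \bigcup_(S <- l) ordered_pairs S) f u
  = \prod_(S <- l) \prod_(u in ordered_pairs S) f u.
Proof.
elim: l => [_|S l ih /= /andP[/allP Sl pl]]; first by rewrite !big_nil big_set0.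
rewrite big_cons [RHS]big_cons -ih // -bigU /=.
  by apply: eq_bigl => u; rewrite inE.
rewrite big_seq; elim/big_ind: _ => [|U U' dU dU'|S' /Sl dS].
- by rewrite -finset.setI_eq0 finset.setI0.
- by rewrite -finset.setI_eq0 finset.setIUr finset.setU_eq0 !finset.setI_eq0 dU.
- rewrite -finset.setI_eq0; apply/eqP/finset.setP => -[a b]; rewrite !inE /=.
  apply/negP => /andP[/and3P[aS _ _] /and3P[aS' _ _]].
  by have := disjointFr dS aS; rewrite aS'.
Qed.

Lemma ordered_bigcup_pairs (l : seq {set 'I_n}) u :
  u \in \bigcup_(S <- l) ordered_pairs S -> (u.1 < u.2)%N.
Proof.
elim: l => [|S l ih]; first by rewrite big_nil inE.
by rewrite big_cons inE => /orP[|/ih//]; rewrite inE => /and3P[].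
Qed.

End OrderedPairs.

Lemma card_ord_range n a b : (b <= n)%N -> #|[set i : 'I_n | (a <= i < b)%N]| = (b - a)%N.
Proof.
move=> bn; rewrite -sum1dep_card -(big_ord_widen_cond _ (fun i => a <= i)%N (fun=> 1%N) bn).
by rewrite -(big_geq_mkord _ _ xpredT (fun=> 1%N)) sum_nat_const_nat muln1.
Qed.

Lemma bin3_le m : ('C(m, 3) * 6 <= m ^ 3)%N.
Proof.
have -> : 6%N = 3`! by [].
rewrite bin_ffact !ffactnS ffactn0 muln1 !expnS expn0 muln1.
by rewrite leq_mul // leq_mul // ?leq_pred // (leq_trans (leq_pred _)) ?leq_pred.
Qed.

Section FiniteModel.
Context (R : realFieldType) (n : nat) (K : finType).
(* The level of each vertex, and the edges as pairs [(i, j)] with [i < j];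
   [qbar] and [qlow] enclose the edge probabilities given the levels. *)
Local Notation config := ({ffun 'I_n -> K} * {set 'I_n * 'I_n})%type.
Context (p : K -> R) (pi : config -> R) (qbar qlow : K -> K -> R).
Hypotheses (p_ge0 : forall a, 0 <= p a) (p_sum1 : \sum_a p a = 1)
  (pi_ge0 : forall w, 0 <= pi w)
  (qbar_ge0 : forall a b, 0 <= qbar a b) (qlow_ge0 : forall a b, 0 <= qlow a b)
  (qbarC : forall a b, qbar a b = qbar b a) (qlowC : forall a b, qlow a b = qlow b a).
Hypothesis pi_le : forall (phi : {ffun 'I_n -> K}) (J : {set 'I_n * 'I_n}),
  (forall u, u \in J -> (u.1 < u.2)%N) ->
  \sum_(w : config | (w.1 == phi) && (J \subset w.2)) pi w
    <= prod_weight p phi * \prod_(u in J) qbar (phi u.1) (phi u.2).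
Hypothesis pi_ge : forall (phi : {ffun 'I_n -> K}) (J : {set 'I_n * 'I_n}),
  (forall u, u \in J -> (u.1 < u.2)%N) ->
  prod_weight p phi * \prod_(u in J) qlow (phi u.1) (phi u.2)
    <= \sum_(w : config | (w.1 == phi) && (J \subset w.2)) pi w.

Definition config_edge (w : config) : rel 'I_n := fun i j =>
  if (i < j)%N then (i, j) \in w.2 else (j < i)%N && ((j, i) \in w.2).

Lemma config_edge_sym w : symmetric (config_edge w).
Proof. by move=> i j; rewrite /config_edge; case: ssrnat.ltngtP => //= _; rewrite ?ltnn. Qed.

Lemma pairs_sub_cliques (w : config) s (S : {set 'I_n}) :
  S \in cliques (config_edge w) s -> ordered_pairs S \subset w.2.
Proof.
move=> /cliquesP[_ Se]; apply/fintype.subsetP => -[i j]; rewrite inE /=.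
move=> /and3P[iS jS ij]; have := Se i j iS jS.
by rewrite /config_edge ij => -> //; rewrite -val_eqE /= neq_ltn ij.
Qed.

Lemma cliques_pairs_sub (w : config) (S : {set 'I_n}) : ordered_pairs S \subset w.2 ->
  S \in cliques (config_edge w) #|S|.
Proof.
move=> /fintype.subsetP Sw; apply/cliquesP; split=> // i j iS jS ij.
rewrite /config_edge; case: ssrnat.ltngtP => [h|h|h] /=.
- by apply: Sw; rewrite inE iS jS.
- by apply: Sw; rewrite inE iS jS.
- by move: ij; rewrite -val_eqE /= h eqxx.
Qed.

Lemma sum_config_split (Q : pred config) (g : {ffun 'I_n -> K} -> R) :
  \sum_(w : config | Q w) pi w * g w.1
  = \sum_phi (\sum_(w : config | (w.1 == phi) && Q w) pi w) * g phi.
Proof.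
rewrite (partition_big (fun w : config => w.1) predT) //=.
apply: eq_bigr => phi _; rewrite mulr_suml.
by apply: eq_big => [w|w /andP[_ /eqP ->]//]; rewrite andbC.
Qed.

Lemma config_expect_le (J : {set 'I_n * 'I_n}) (g : {ffun 'I_n -> K} -> R) :
  (forall u, u \in J -> (u.1 < u.2)%N) -> (forall phi, 0 <= g phi) ->
  \sum_(w : config | J \subset w.2) pi w * g w.1
  <= prod_expect p (fun phi => g phi * \prod_(u in J) qbar (phi u.1) (phi u.2)).
Proof.
move=> HJ g0; rewrite sum_config_split; apply: ler_sum => phi _.
rewrite [g phi * _]mulrC mulrA; apply: ler_wpM2r => //; exact: pi_le.
Qed.

Lemma config_expect_ge (J : {set 'I_n * 'I_n}) (g : {ffun 'I_n -> K} -> R) :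
  (forall u, u \in J -> (u.1 < u.2)%N) -> (forall phi, 0 <= g phi) ->
  prod_expect p (fun phi => g phi * \prod_(u in J) qlow (phi u.1) (phi u.2))
  <= \sum_(w : config | J \subset w.2) pi w * g w.1.
Proof.
move=> HJ g0; rewrite sum_config_split; apply: ler_sum => phi _.
rewrite [g phi * _]mulrC mulrA; apply: ler_wpM2r => //; exact: pi_ge.
Qed.

(** For empty [J] the bounds [pi_le] and [pi_ge] coincide, so the levels have exactly the product
    law although the edges are only enclosed. *)
Lemma config_marginal (g : {ffun 'I_n -> K} -> R) :
  \sum_(w : config) pi w * g w.1 = prod_expect p g.
Proof.
have E phi : \sum_(w : config | w.1 == phi) pi w = prod_weight p phi.
  have h0 u : u \in (finset.set0 : {set 'I_n * 'I_n}) -> (u.1 < u.2)%N by rewrite inE.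
  have h1 := pi_le phi h0; have h2 := pi_ge phi h0.
  rewrite big_set0 mulr1 in h1; rewrite big_set0 mulr1 in h2.
  have e : \sum_(w : config | (w.1 == phi) && (finset.set0 \subset w.2)) pi w
         = \sum_(w : config | w.1 == phi) pi w.
    by apply: eq_bigl => w; rewrite finset.sub0set andbT.
  by rewrite e in h1 h2; apply: le_anti; rewrite h1.
rewrite (sum_config_split predT); apply: eq_bigr => phi _.
by rewrite -E; congr (_ * _); apply: eq_bigl => w; rewrite andbT.
Qed.

Definition pairs_weight (q : K -> K -> R) S (phi : {ffun 'I_n -> K}) : R :=
  \prod_(u in ordered_pairs S) q (phi u.1) (phi u.2).

Lemma depends_on_pairs q S : depends_on S (pairs_weight q S).
Proof.
move=> phi psi e; apply: eq_bigr => -[i j]; rewrite inE /= => /and3P[iS jS _].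
by rewrite !e.
Qed.

Definition edge_mean (q : K -> K -> R) : R := \sum_a \sum_b p a * p b * q a b.

Definition triangle_mean (q : K -> K -> R) : R :=
  \sum_a \sum_b \sum_c p a * (p b * p c) * (q a b * (q a c * q b c)).

Lemma expect_pairs2 q (S : {set 'I_n}) : #|S| = 2%N -> prod_expect p (pairs_weight q S) = edge_mean q.
Proof.
move=> /card2_sorted[i [j [ij ->]]].
have E phi : pairs_weight q [set i; j] phi = q (phi i) (phi j).
  exact: (ordered_pairs2 (fun i j => q (phi i) (phi j)) ij).
rewrite (eq_prod_expect _ E) /edge_mean pair_big /=.
have ne : i != j by rewrite -val_eqE /= neq_ltn ij.
transitivity (prod_expect p (fun phi => \sum_u
   q u.1 u.2 * ((phi i == u.1)%:R * (phi j == u.2)%:R))).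
  apply: eq_prod_expect => phi.
  rewrite (bigD1 (phi i, phi j)) //= !eqxx !mulr1 big1 ?addr0 //.
  move=> [a b] /=; rewrite !xpair_eqE ![_ == phi _]eq_sym.
  by case: eqP => //=; case: eqP => //= _ _; rewrite ?(mulr0, mul0r).
rewrite prod_expect_sum; apply: eq_bigr => -[a b] _ /=.
have coordE l d : prod_expect p (fun phi => (phi l == d)%:R) = p d.
  rewrite (prod_expect_coord p_sum1 l (fun e => (e == d)%:R)) (bigD1 d) //= eqxx mulr1.
  by rewrite big1 ?addr0 // => e /negPf ->; rewrite mulr0.
have dep l d : depends_on [set l] (fun phi => (phi l == d)%:R : R).
  by apply: (@depends_on_coord _ _ _ _ l (fun e => (e == d)%:R)); rewrite inE.
rewrite prod_expectZ (@prod_expectM _ _ _ _ p_sum1 [set i] [set j]) ?coordE //.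
  by rewrite mulrC.
by rewrite disjoints1 inE.
Qed.

Lemma expect_pairs3 q (S : {set 'I_n}) : #|S| = 3%N -> prod_expect p (pairs_weight q S) = triangle_mean q.
Proof.
move=> /card3_sorted[i [j [k [ij jk ->]]]].
have ne (a b : 'I_n) : (a < b)%N -> a != b by rewrite -val_eqE /= neq_ltn => ->.
have := prod_expect_coord3 p_sum1 (i := i) (j := j) (k := k)
  (fun a b c => q a b * (q a c * q b c)).
rewrite /triangle_mean => <-; rewrite ?ne //; last exact: ltn_trans jk.
apply: eq_prod_expect => phi.
exact: (ordered_pairs3 (fun i j => q (phi i) (phi j)) ij jk).
Qed.

(** If all members of [l] are cliques, the edges of all of them are present; the corresponding
    weights depend on disjoint sets of coordinates, so their expectation factorises. *)
Lemma cliques_moment (s : nat) (D : R) (l : seq {set 'I_n}) :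
  (forall S : {set 'I_n}, #|S| = s -> prod_expect p (pairs_weight qbar S) = D) ->
  {subset l <= [set S : {set 'I_n} | #|S| == s]} ->
  pairwise (fun A B : {set 'I_n} => [disjoint A & B]) l ->
  \sum_(w | all (mem (cliques (config_edge w) s)) l) pi w <= D ^+ size l.
Proof.
move=> HD ls pl.
apply: (@le_trans _ _ (\sum_(w : config | \bigcup_(S <- l) ordered_pairs S \subset w.2)
   pi w * 1)).
  rewrite [leRHS]big_mkcond [leLHS]big_mkcond; apply: ler_sum => w _; rewrite mulr1.
  case: ifP => [/allP wl|_]; last by case: ifP.
  rewrite ifT //; rewrite big_seq; elim/big_ind: _ => [|U U' h h'|S Sl].
  - exact: finset.sub0set.
  - by rewrite finset.subUset h.
  - exact: (pairs_sub_cliques (wl S Sl)).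
apply: (le_trans (config_expect_le (g := fun=> 1) _ _)) => //.
  exact: ordered_bigcup_pairs.
under eq_prod_expect do rewrite mul1r prod_bigcup_pairs //.
rewrite (prod_expect_big p_sum1 (A := id) (g := pairs_weight qbar)) //; last first.
  by move=> S _; exact: depends_on_pairs.
rewrite big_seq (eq_bigr (fun=> D)); last by move=> S /ls; rewrite inE => /eqP; exact: HD.
by rewrite -big_seq big_const_seq count_predT iter_mulr_1.
Qed.

Lemma cliques_deletion (s z : nat) (D m : R) : 0 <= m -> 0 <= D ->
  (forall S : {set 'I_n}, #|S| = s -> prod_expect p (pairs_weight qbar S) = D) ->
  (\sum_(w | robust (cliques (config_edge w) s) (s * z) m) pi w) * m ^+ z
    <= ('C(n, s)%:R * D) ^+ z.
Proof.
move=> m0 D0 HD.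
have := @deletion_bound R _ _ pi pi_ge0 [set S : {set 'I_n} | #|S| == s]
  (fun w => cliques (config_edge w) s) D s z m D0 m0.
rewrite card_draws card_ord; apply.
- by move=> w; apply/fintype.subsetP => S /cliquesP[Ss _]; rewrite inE Ss.
- by move=> S; rewrite inE => /eqP ->.
- by move=> l ls pl; exact: cliques_moment.
Qed.

Lemma config_sum1 : \sum_(w : config) pi w = 1.
Proof.
rewrite -(prod_expect1 'I_n p_sum1) -config_marginal.
by apply: eq_bigr => w _; rewrite mulr1.
Qed.

(** This brings degrees and hub counts under the deletion bound: a large set, seen as a family of
    singletons, keeps [m] members after [z] removals. *)
Lemma robust_singletons (X : {set 'I_n}) (z : nat) (m : R) :
  m + z%:R <= #|X|%:R -> robust [set [set j] | j in X] (1 * z) m.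
Proof.
move=> Xm; apply/forallP => U; apply/implyP; rewrite mul1n => Uz.
rewrite -(lerD2r z%:R); apply: (le_trans Xm); rewrite -natrD ler_nat.
rewrite -(cardsID U X) addnC leq_add //; last first.
  by apply: leq_trans Uz; apply: subset_leq_card; exact: finset.subsetIr.
rewrite -(card_imset _ (@finset.set1_inj 'I_n)); apply: subset_leq_card.
apply/fintype.subsetP => S /imsetP[j]; rewrite !inE => /andP[jU jX] ->.
by rewrite disjoints1 jU andbT; apply: imset_f.
Qed.

Lemma card_singletons_le (X : {set 'I_n}) : (#|[set [set j] | j in X]| <= n)%N.
Proof.
by apply: (leq_trans (leq_imset_card _ _)); rewrite -[leqRHS]card_ord max_card.
Qed.

Lemma card_bigcup_singletons (X : {set 'I_n}) (l : seq {set 'I_n}) :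
  {subset l <= [set [set j] | j in X]} ->
  pairwise (fun A B : {set 'I_n} => [disjoint A & B]) l ->
  #|\bigcup_(S <- l) S| = size l.
Proof.
elim: l => [_ _|S l ih lX /= /andP[/allP Sl pl]]; first by rewrite big_nil finset.cards0.
have /imsetP[j _ SE] := lX S (mem_head _ _).
have jl : j \notin \bigcup_(S' <- l) S'.
  rewrite big_seq; elim/big_ind: _ => [|U U' h h'|S' /Sl]; first by rewrite inE.
  - by rewrite inE negb_or h.
  - by rewrite SE disjoints1.
rewrite big_cons SE cardsU1 jl ih // => S' S'l; apply: lX; rewrite inE S'l orbT //.
Qed.

Lemma prod_expect_prod_on (X : {set 'I_n}) (h : K -> R) :
  prod_expect p (fun phi => \prod_(j in X) h (phi j)) = (\sum_a p a * h a) ^+ #|X|.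
Proof.
pose f (j : 'I_n) a := if j \in X then h a else 1.
rewrite (@eq_prod_expect _ _ _ _ _ (fun phi => \prod_j f j (phi j))); last first.
  by move=> phi; rewrite big_mkcond; apply: eq_bigr => j _; rewrite /f; case: ifP.
rewrite prod_expect_prod -prodr_const [RHS]big_mkcond; apply: eq_bigr => j _.
rewrite /f; case: ifP => // _; rewrite -[RHS]p_sum1.
by apply: eq_bigr => a _; rewrite mulr1.
Qed.

Lemma prod_expect_le (f g : {ffun 'I_n -> K} -> R) : (forall phi, f phi <= g phi) ->
  prod_expect p f <= prod_expect p g.
Proof.
move=> fg; apply: ler_sum => phi _; apply: ler_wpM2l => //.
by apply: prodr_ge0.
Qed.

Lemma bigcup_cond_sub (l : seq {set 'I_n}) (X Y : {set 'I_n}) :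
  (forall S, S \in l -> S \in [set [set j] | j in X]) ->
  (forall j, j \in X -> j \in Y) -> \bigcup_(S <- l) S \subset Y.
Proof.
move=> lX XY; rewrite big_seq; elim/big_ind: _ => [|U U' h h'|S /lX /imsetP[j jX ->]].
- exact: finset.sub0set.
- by rewrite finset.subUset h.
- by rewrite finset.sub1set XY.
Qed.

Lemma hubs_deletion (hub : pred K) (z : nat) (m : R) : 0 <= m ->
  (\sum_(w : config | m + z%:R <= #|[set j | hub (w.1 j)]|%:R) pi w) * m ^+ z
    <= (n%:R * \sum_(a | hub a) p a) ^+ z.
Proof.
move=> m0; set ph := \sum_(a | hub a) p a.
have ph0 : 0 <= ph by apply: sumr_ge0.
pose F (w : config) := [set [set j] | j in [set j | hub (w.1 j)]].
have FC w : F w \subset [set [set j] | j in [set: 'I_n]].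
  by apply: imsetS; exact: finset.subsetT.
have sC (S : {set 'I_n}) : S \in [set [set j] | j in [set: 'I_n]] -> (#|S| <= 1)%N.
  by move=> /imsetP[j _ ->]; rewrite finset.cards1.
have H := @deletion_bound _ _ _ _ pi_ge0 _ F ph 1 z m ph0 m0 FC sC.
apply: (@le_trans _ _ ((\sum_(w | robust (F w) (1 * z) m) pi w) * m ^+ z)).
  apply: ler_wpM2r; first exact: exprn_ge0.
  rewrite [leRHS]big_mkcond [leLHS]big_mkcond; apply: ler_sum => w _.
  by case: ifP => [/robust_singletons ->//|_]; case: ifP.
apply: le_trans (H _) _; last first.
  apply: lerXn2r; rewrite ?nnegrE; [exact: mulr_ge0|exact: mulr_ge0|].
  by apply: ler_wpM2r => //; rewrite ler_nat card_singletons_le.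
move=> l lC pl; rewrite -(card_bigcup_singletons lC pl).
have -> : ph = \sum_a p a * (hub a)%:R.
  by rewrite /ph big_mkcond; apply: eq_bigr => a _; case: (hub a); rewrite ?mulr1 ?mulr0.
rewrite -(prod_expect_prod_on _ (fun a => (hub a)%:R)) -config_marginal big_mkcond.
apply: ler_sum => w _; case: ifP => [/allP wl|_]; last first.
  by apply: mulr_ge0 => //; apply: prodr_ge0.
rewrite big1 ?mulr1 // => j jl.
have /fintype.subsetP/(_ j jl) := bigcup_cond_sub wl (fun j => id).
by rewrite inE => ->.
Qed.

(** Once [i] is low, the bound [r * y b] for its edges no longer involves its level, so its
    neighbours can be treated as independent choices. Deletion is applied to their singletons, and
    to the empty family when [i] is not low. *)
Lemma neighbours_deletion (i : 'I_n) (low : pred K) (y : K -> R) (r m : R) (z : nat) :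
  0 <= m -> 0 <= r -> (forall a, 0 <= y a) ->
  (forall a b, low a -> qbar a b <= r * y b) ->
  (\sum_(w : config | low (w.1 i) && (m + z%:R <= #|[set j | config_edge w i j]|%:R)) pi w) * m ^+ z
    <= (n%:R * (r * \sum_a p a * y a)) ^+ z.
Proof.
move=> m0 r0 y0 qy; set q := r * _.
have q0 : 0 <= q by apply: mulr_ge0 => //; apply: sumr_ge0 => a _; apply: mulr_ge0.
pose N (w : config) := [set j | config_edge w i j].
pose F (w : config) := if low (w.1 i) then [set [set j] | j in N w] else finset.set0.
have Ni w : i \notin N w by rewrite inE /config_edge ltnn.
have FC w : F w \subset [set [set j] | j in [set~ i]].
  rewrite /F; case: ifP => _; last exact: finset.sub0set.
  apply: imsetS; apply/fintype.subsetP => j jN; rewrite !inE.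
  by apply/eqP => ji; move: (Ni w); rewrite -ji jN.
have sC (S : {set 'I_n}) : S \in [set [set j] | j in [set~ i]] -> (#|S| <= 1)%N.
  by move=> /imsetP[j _ ->]; rewrite finset.cards1.
have H := @deletion_bound _ _ _ _ pi_ge0 _ F q 1 z m q0 m0 FC sC.
apply: (@le_trans _ _ ((\sum_(w | robust (F w) (1 * z) m) pi w) * m ^+ z)).
  apply: ler_wpM2r; first exact: exprn_ge0.
  rewrite [leRHS]big_mkcond [leLHS]big_mkcond; apply: ler_sum => w _.
  case: ifP => [/andP[lw mw]|_]; last by case: ifP.
  by rewrite ifT // /F lw; exact: robust_singletons.
apply: le_trans (H _) _; last first.
  apply: lerXn2r; rewrite ?nnegrE; [exact: mulr_ge0|exact: mulr_ge0|].
  by apply: ler_wpM2r => //; rewrite ler_nat card_singletons_le.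
(* The empty list is treated apart: only a member of the list shows that the family is nonempty,
   hence that [i] is low. *)
move=> [|S0 l0] lC pl; first by rewrite config_sum1 expr0.
move: (S0 :: l0) (mem_head S0 l0) lC pl => l S0l lC pl.
rewrite -(card_bigcup_singletons lC pl).
set Js := \bigcup_(S <- l) S.
have iJs : i \notin Js.
  have /fintype.subsetP JsN := bigcup_cond_sub lC (fun j => id).
  by apply/negP => /JsN; rewrite !inE eqxx.
pose op (j : 'I_n) := if (i < j)%N then (i, j) else (j, i).
pose J := [set op j | j in Js].
have HJ u : u \in J -> (u.1 < u.2)%N.
  move=> /imsetP[j jJ ->]; rewrite /op; case: (ssrnat.ltngtP i j) => //= /ord_inj ij.
  by rewrite -ij (negPf iJs) in jJ.
have opinj : {in Js &, injective op}.
  move=> j j' jJ j'J; rewrite /op; case: ifP => _; case: ifP => _ [] //.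
  - by move=> ij' _; rewrite ij' j'J in iJs.
  - by move=> ji _; rewrite -ji jJ in iJs.
rewrite /q mulr_sumr.
have -> : \sum_a r * (p a * y a) = \sum_a p a * (r * y a).
  by apply: eq_bigr => a _; rewrite mulrCA.
rewrite -(prod_expect_prod_on _ (fun a => r * y a)).
apply: (@le_trans _ _ (\sum_(w : config | J \subset w.2) pi w * (low (w.1 i))%:R)).
  rewrite [leRHS]big_mkcond [leLHS]big_mkcond; apply: ler_sum => w _.
  case: ifP => [/allP wl|_]; last by case: ifP => // _; apply: mulr_ge0.
  have lw : low (w.1 i).
    by have := wl _ S0l; rewrite /= /F; case: ifP => //; rewrite inE.
  rewrite lw mulr1 ifT //; apply/fintype.subsetP => u /imsetP[j jJ ->].
  have wl' S : S \in l -> S \in [set [set j] | j in N w].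
    by move=> /wl; rewrite /= /F lw.
  have /fintype.subsetP/(_ j jJ) := bigcup_cond_sub wl' (fun j => id).
  by rewrite inE /config_edge /op; case: ifP => // _ /andP[].
apply: (le_trans (config_expect_le (g := fun phi => (low (phi i))%:R) HJ _)) => //.
apply: prod_expect_le => phi; case: (boolP (low (phi i))) => lp; last first.
  by rewrite mul0r; apply: prodr_ge0 => j _; apply: mulr_ge0.
rewrite mul1r /J big_imset //=; apply: ler_prod => j _.
rewrite qbar_ge0 /op /=; case: ifP => _ /=; first exact: qy.
by rewrite qbarC; exact: qy.
Qed.

(** As [qlow] is 1, the configurations containing the edge between [i] and [j] already carry the
    whole probability of the level vector of [w]; nothing is left for those without it. *)
Lemma top_adjacent (w : config) (i j : 'I_n) :
  (forall b, qlow (w.1 i) b = 1) -> pi w != 0 -> i != j -> config_edge w i j.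
Proof.
move=> q1 pw ij; apply: contraNT pw => nij.
pose u := if (i < j)%N then (i, j) else (j, i).
have ltu : (u.1 < u.2)%N.
  by rewrite /u; case: (ssrnat.ltngtP i j) => //= /ord_inj e; rewrite e eqxx in ij.
have Hu v : v \in [set u] -> (v.1 < v.2)%N by rewrite inE => /eqP ->.
have h1 := pi_ge w.1 Hu.
have h0 v : v \in (finset.set0 : {set 'I_n * 'I_n}) -> (v.1 < v.2)%N by rewrite inE.
have h2 := pi_le w.1 h0.
rewrite big_set1 in h1; rewrite big_set0 mulr1 in h2.
have qu : qlow (w.1 u.1) (w.1 u.2) = 1.
  by rewrite /u; case: ifP => _ /=; rewrite ?q1 // qlowC q1.
rewrite qu mulr1 in h1; have := le_trans h2 h1.
rewrite (bigID (fun v : config => u \in v.2)) /= => h3.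
have : \sum_(v : config | ((v.1 == w.1) && (finset.set0 \subset v.2)) && (u \notin v.2)) pi v <= 0.
  rewrite -(lerD2l (\sum_(v : config | ((v.1 == w.1) && (finset.set0 \subset v.2)) && (u \in v.2)) pi v)) addr0.
  apply: (le_trans h3); rewrite le_eqVlt; apply/orP; left; apply/eqP.
  by apply: eq_bigl => v; rewrite finset.sub1set finset.sub0set andbT.
rewrite (bigD1 w) /=; last first.
  rewrite eqxx finset.sub0set /=; apply: contra nij; rewrite /config_edge /u.
  by case: (ssrnat.ltngtP i j) => //= /ord_inj e; rewrite e eqxx in ij.
move=> h4; rewrite eq_le pi_ge0 andbT; apply: le_trans h4.
by rewrite lerDl; apply: sumr_ge0.
Qed.

(** A weight [g] on the levels in [A] leaves the mean number of triangles inside [U] untouched,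
    since the coordinates are disjoint; the rest is linearity over the triples in [U]. *)
Lemma triangles_moment_ge (A U : {set 'I_n}) (g : {ffun 'I_n -> K} -> R) :
  [disjoint A & U] -> depends_on A g -> (forall phi, 0 <= g phi) ->
  'C(#|U|, 3)%:R * (prod_expect p g * triangle_mean qlow)
  <= \sum_(w : config) pi w * (g w.1 *
       #|[set S in cliques (config_edge w) 3 | S \subset U]|%:R).
Proof.
move=> dAU dg g0.
rewrite -cards_draws mulr_natl -sumr_const.
rewrite [leRHS](_ : _ = \sum_(S in [set S : {set 'I_n} | (S \subset U) && (#|S| == 3%N)])
   \sum_(w : config | S \in cliques (config_edge w) 3) pi w * g w.1); last first.
  rewrite (exchange_big_dep predT) //=; apply: eq_bigr => w _.
  rewrite mulrA mulr_natr -sumr_const; apply: eq_bigl => S.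
  by rewrite !inE; case: (S \subset U); case: (#|S| == 3%N); rewrite ?andbF ?andbT.
apply: ler_sum => S; rewrite inE => /andP[SU /eqP S3].
have dAS : [disjoint A & S] by apply: disjointWr dAU.
rewrite -(expect_pairs3 qlow S3) -(prod_expectM p_sum1 dAS dg (@depends_on_pairs _ _)).
have HJ u : u \in ordered_pairs S -> (u.1 < u.2)%N by rewrite inE => /and3P[].
apply: (le_trans (config_expect_ge HJ g0)).
rewrite [leRHS]big_mkcond [leLHS]big_mkcond; apply: ler_sum => w _.
case: ifP => [/cliques_pairs_sub|_]; first by rewrite S3 => ->.
by case: ifP => // _; apply: mulr_ge0.
Qed.

Lemma not_robust F b (m : R) : ~~ robust F b m ->
  exists2 U : {set 'I_n}, (#|U| <= b)%N & #|[set S in F | [disjoint S & U]]|%:R < m.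
Proof.
rewrite negb_forall => /existsP[U]; rewrite negb_imply => /andP[Ub].
by rewrite -ltNge => h; exists U.
Qed.

Lemma avoid_subset (F : {set {set 'I_n}}) (U U' : {set 'I_n}) : U \subset U' ->
  (#|[set S in F | [disjoint S & U']]| <= #|[set S in F | [disjoint S & U]]|)%N.
Proof.
move=> UU; apply: subset_leq_card; apply/fintype.subsetP => S; rewrite !inE.
by move=> /andP[-> /=]; exact: disjointWr.
Qed.

(** If none of the four events occurs, sets [U3] and [U2] of at most [3 z] and [2 z] vertices meet
    all but [m3] triangles and all but [m2] edges. Their union, of at most [5 z] vertices, is the
    [D] of [card_cliques3_le], and every vertex that is not a hub has fewer than [m1 + z]
    neighbours. *)
Lemma triangles_tail_le (hub : pred K) (z z4 : nat) (thr m1 m2 m3 m4 : R) :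
  0 <= m1 -> 0 <= m2 -> 0 <= m3 -> 0 <= m4 ->
  m3 + (5 * z)%:R * m2 + (5 * z)%:R ^+ 2 * (m1 + z%:R)
    + (m4 + z4%:R) ^+ 2 / 2 * n%:R <= thr ->
  \sum_(w : config | thr < #|cliques (config_edge w) 3|%:R) pi w
  <= \sum_(w | robust (cliques (config_edge w) 3) (3 * z) m3) pi w
   + \sum_(w | robust (cliques (config_edge w) 2) (2 * z) m2) pi w
   + \sum_(i < n) \sum_(w : config | ~~ hub (w.1 i) &&
        (m1 + z%:R <= #|[set j | config_edge w i j]|%:R)) pi w
   + \sum_(w : config | m4 + z4%:R <= #|[set j | hub (w.1 j)]|%:R) pi w.
Proof.
move=> m10 m20 m30 m40 Hthr.
have sumb (Q : pred config) : \sum_(w | Q w) pi w = \sum_w pi w * (Q w)%:R.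
  rewrite big_mkcond; apply: eq_bigr => w _; case: (Q w); by rewrite ?mulr1 ?mulr0.
rewrite !sumb; under [X in _ + X + _]eq_bigr do rewrite sumb.
rewrite exchange_big -!big_split /=; apply: ler_sum => w _.
rewrite -mulr_sumr -!mulrDr; apply: ler_wpM2l => //.
case: (ltP thr) => [hw|_]; last by rewrite !addr_ge0 // sumr_ge0.
case: (boolP (robust _ (3 * z) m3)) => /= [_|/not_robust[U3 hU3 h3]].
  by rewrite -!addrA lerDl !addr_ge0 // sumr_ge0.
case: (boolP (robust _ (2 * z) m2)) => /= [_|/not_robust[U2 hU2 h2]].
  by rewrite add0r -!addrA lerDl !addr_ge0 // sumr_ge0.
case: (boolP (m4 + z4%:R <= _)) => /= [_|]; first by rewrite lerDr !addr_ge0 // sumr_ge0.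
rewrite -ltNge !add0r addr0 => h4.
case: (boolP [exists i, ~~ hub (w.1 i) && (m1 + z%:R <= #|[set j | config_edge w i j]|%:R)]).
  move=> /existsP[i Hi]; rewrite (bigD1 i) //= Hi lerDl; exact: sumr_ge0.
rewrite negb_exists => /forallP Hlow; exfalso.
pose H := [set j | hub (w.1 j)].
pose dm := \max_(i | i \notin H) #|[set j | config_edge w i j]|.
have dmle : dm%:R <= m1 + z%:R.
  rewrite /dm; elim/big_ind: _ => [|a b ha hb|i iH].
  - by rewrite addr_ge0.
  - by rewrite natr_max ge_max ha.
  - by have := Hlow i; rewrite !inE in iH; rewrite iH /= -ltNge => /ltW.
have dmmax i : i \notin H -> (#|[set j | config_edge w i j]| <= dm)%N.
  exact: (@leq_bigmax_cond _ (fun i => i \notin H) (fun i => #|[set j | config_edge w i j]|)).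
have := @card_cliques3_le _ (config_edge w) (U3 :|: U2) H _ _ dm
  (leqnn _) (leqnn _) dmmax.
set N3 := #|[set S in cliques _ 3 | _]|; set N2 := #|[set S in cliques _ 2 | _]|.
rewrite -(ler_nat R) !natrD !natrM => hle.
have hU : (#|U3 :|: U2|%:R : R) <= (5 * z)%:R.
  rewrite ler_nat; apply: (leq_trans (leq_card_setU _ _)).
  have -> : (5 * z = 3 * z + 2 * z)%N by rewrite -mulnDl.
  exact: leq_add.
have hN3 : (N3%:R : R) <= m3.
  apply: le_trans (ltW h3); rewrite ler_nat; apply: avoid_subset; exact: finset.subsetUl.
have hN2 : (N2%:R : R) <= m2.
  apply: le_trans (ltW h2); rewrite ler_nat; apply: avoid_subset; exact: finset.subsetUr.
have hC : ('C(#|H|, 2)%:R : R) <= (m4 + z4%:R) ^+ 2 / 2.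
  have : ('C(#|H|, 2)%:R : R) * 2 <= #|H|%:R ^+ 2.
    rewrite -natrM -natrX ler_nat mulnC -[in leqLHS](expn1 2) bin2.
    by rewrite expn1 mul2n (leq_trans (leq_addr (odd (#|H| * #|H|.-1)) _)) // addnC odd_double_half expnS expn1 leq_mul2l leq_pred orbT.
  rewrite -ler_pdivlMr // => h; apply: (le_trans h); rewrite ler_pM2r ?invr_gt0 //.
  by rewrite lerXn2r ?nnegrE ?addr_ge0 // ltW.
move: hw; rewrite ltNge => /negP; apply; apply: (le_trans hle); apply: le_trans Hthr.
have -> : (5 * z)%:R ^+ 2 * (m1 + z%:R) = (5 * z)%:R * ((5 * z)%:R * (m1 + z%:R)).
  by rewrite expr2 -mulrA.
rewrite card_ord; apply: lerD; last by apply: ler_wpM2r.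
apply: lerD; last by rewrite ler_pM ?mulr_ge0 // ler_pM.
by apply: lerD => //; apply: ler_pM.
Qed.

(** * Hubs in reserved blocks *)

Definition block (l b : nat) : {set 'I_n} := [set i : 'I_n | (b * l <= i < b.+1 * l)%N].

Lemma block_disjoint l b b' : b != b' -> [disjoint block l b & block l b'].
Proof.
wlog bb : b b' / (b < b')%N.
  move=> H bb'; move: (bb'); rewrite neq_ltn => /orP[h|h]; first exact: H.
  by rewrite disjoint_sym; apply: H => //; rewrite eq_sym.
move=> _; rewrite -finset.setI_eq0; apply/eqP/finset.setP => i; rewrite !inE.
apply/negP => /andP[/andP[_ h1] /andP[h2 _]].
have : (b.+1 * l <= b' * l)%N by rewrite leq_mul2r bb orbT.
by move=> h3; have := leq_trans (leq_trans h1 h3) h2; rewrite ltnn.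
Qed.

Lemma card_block l b : (b.+1 * l <= n)%N -> #|block l b| = l.
Proof. by move=> /card_ord_range ->; rewrite mulSn addnK. Qed.

Variables (top : K) (k l : nat).
Hypothesis kl_le : (k * l <= n)%N.

Definition has_top (S : {set 'I_n}) (phi : {ffun 'I_n -> K}) : bool :=
  [exists i in S, phi i == top].

Definition all_blocks_top (phi : {ffun 'I_n -> K}) : bool :=
  all (fun b => has_top (block l b) phi) (iota 0 k).

Lemma expect_has_top (S : {set 'I_n}) :
  prod_expect p (fun phi => (has_top S phi)%:R) = 1 - (1 - p top) ^+ #|S|.
Proof.
have E phi : (has_top S phi)%:R = 1 - \prod_(i in S) (1 - (phi i == top)%:R) :> R.
  rewrite /has_top; case: (boolP [exists i in S, _]).
    move=> /existsP[i /andP[iS it]]; rewrite (bigD1 i) //= it subrr mul0r subr0 //.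
  rewrite negb_exists => /forallP H; rewrite big1 ?subrr // => i iS.
  by have := H i; rewrite iS /= => /negPf ->; rewrite subr0.
rewrite (eq_prod_expect _ E) prod_expectB prod_expect1 //; congr (_ - _).
rewrite (prod_expect_prod_on _ (fun a => 1 - (a == top)%:R)); congr (_ ^+ _).
under eq_bigr do rewrite mulrBr mulr1.
rewrite sumrB p_sum1; congr (_ - _); rewrite (bigD1 top) //= eqxx mulr1 big1 ?addr0 //.
by move=> a /negPf ->; rewrite mulr0.
Qed.

Lemma depends_has_top (S : {set 'I_n}) : depends_on S (fun phi => (has_top S phi)%:R : R).
Proof.
move=> phi psi e; congr (nat_of_bool _)%:R; apply: eq_existsb => i.
by case: (boolP (i \in S)) => //= iS; rewrite e.
Qed.

Lemma all_blocks_topE (phi : {ffun 'I_n -> K}) :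
  (all_blocks_top phi)%:R = \prod_(b <- iota 0 k) (has_top (block l b) phi)%:R :> R.
Proof.
rewrite /all_blocks_top; elim: (iota 0 k) => [|b r ih]; first by rewrite big_nil.
by rewrite big_cons -ih /=; case: has_top; rewrite ?mul1r ?mul0r.
Qed.

Lemma expect_all_blocks_top :
  prod_expect p (fun phi => (all_blocks_top phi)%:R) = (1 - (1 - p top) ^+ l) ^+ k.
Proof.
rewrite (eq_prod_expect _ all_blocks_topE).
rewrite (prod_expect_big p_sum1 (A := block l) (g := fun b phi => (has_top (block l b) phi)%:R)).
- rewrite big_seq (eq_bigr (fun=> 1 - (1 - p top) ^+ l)); last first.
    move=> b; rewrite mem_iota /= add0n => bk; rewrite expect_has_top card_block //.
    by apply: leq_trans kl_le; rewrite leq_mul2r bk orbT.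
  by rewrite -big_seq big_const_seq count_predT size_iota iter_mulr_1.
- have : uniq (iota 0 k) by exact: iota_uniq.
  rewrite uniq_pairwise; apply: sub_pairwise => b b' /= bb; exact: block_disjoint.
- by move=> b _; exact: depends_has_top.
Qed.

Let outside : {set 'I_n} := [set i : 'I_n | (k * l <= i)%N].

Lemma card_outside : #|outside| = (n - k * l)%N.
Proof. by rewrite -(card_ord_range _ (leqnn n)); apply: eq_card => i; rewrite !inE ltn_ord andbT. Qed.

Lemma blocks_outside_disjoint : [disjoint ~: outside & outside].
Proof. by rewrite -finset.setI_eq0 finset.setIC finset.setICr. Qed.

Lemma depends_all_blocks_top :
  depends_on (~: outside) (fun phi => (all_blocks_top phi)%:R : R).
Proof.
move=> phi psi e; rewrite !all_blocks_topE !big_seq; apply: eq_bigr => b.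
rewrite mem_iota /= add0n => bk; apply: depends_has_top => i; rewrite inE => /andP[_ h].
apply: e; rewrite !inE -ltnNge; apply: (leq_trans h).
by rewrite leq_mul2r bk orbT.
Qed.

(** One vertex is picked in each block; disjointness of the blocks makes the picks distinct, so
    there are exactly [k]. *)
Lemma all_blocks_top_hubs (phi : {ffun 'I_n -> K}) : all_blocks_top phi ->
  exists H : {set 'I_n}, [/\ #|H| = k, H \subset ~: outside & forall i, i \in H -> phi i = top].
Proof.
move=> /allP Hb.
have ex (b : 'I_k) : exists i, (i \in block l b) && (phi i == top).
  have /existsP[i Hi] : has_top (block l b) phi by apply: Hb; rewrite mem_iota /=.
  by exists i.
pose f b := xchoose (ex b).
have fP b : (f b \in block l b) && (phi (f b) == top) := xchooseP (ex b).
have finj : injective f.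
  move=> b b' e; apply/eqP; case: (eqVneq b b') => // bb.
  have := fP b; rewrite e => /andP[h _]; have /andP[h' _] := fP b'.
  by have := disjointFr (@block_disjoint l b b' bb) h; rewrite h'.
exists [set f b | b in 'I_k]; split.
- by rewrite card_imset // card_ord.
- apply/fintype.subsetP => i /imsetP[b _ ->]; have /andP[+ _] := fP b.
  rewrite !inE -ltnNge => /andP[_ h]; apply: (leq_trans h).
  by rewrite leq_mul2r ltn_ord orbT.
- by move=> i /imsetP[b _ ->]; have /andP[_ /eqP] := fP b.
Qed.

(* The count is at most [n ^ 3], so its mean minus [m] bounds [n ^ 3] times the
   probability of exceeding [m]. *)
Lemma triangles_tail_ge (thr m : R) : (forall b, qlow top b = 1) -> 0 <= m ->
  thr < 'C(k, 2)%:R * (n - k * l)%:R + m ->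
  ('C(n - k * l, 3)%:R * triangle_mean qlow - m) * (1 - (1 - p top) ^+ l) ^+ k
  <= n%:R ^+ 3 * \sum_(w : config | thr < #|cliques (config_edge w) 3|%:R) pi w.
Proof.
move=> qtop m0 Hthr.
have := triangles_moment_ge blocks_outside_disjoint depends_all_blocks_top
  (fun phi => ler0n _ _).
rewrite card_outside expect_all_blocks_top => H.
set E := (_ ^+ k) in H *; set D := triangle_mean qlow in H *.
rewrite mulrBl lerBlDr -mulrA [D * E]mulrC; apply: (le_trans H).
have EE : E = \sum_w pi w * (all_blocks_top w.1)%:R.
  by rewrite (config_marginal (fun phi => (all_blocks_top phi)%:R)) expect_all_blocks_top.
rewrite EE mulr_sumr mulr_sumr [X in X + _]big_mkcond -big_split /=.
apply: ler_sum => w _.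
(* Null configurations are dismissed first, because [top_adjacent] speaks only of those with nonzero
   [pi w]. *)
have [->|pw] := eqVneq (pi w) 0; first by rewrite !mul0r !mulr0; case: ifP; rewrite ?mulr0 addr0.
case: (boolP (all_blocks_top w.1)) => hw; last first.
  by rewrite mul0r !mulr0 addr0; case: ifP => // _; rewrite mulr_ge0 // exprn_ge0.
rewrite mul1r mulr1; set N := #|_|.
have N3 : (N%:R : R) <= n%:R ^+ 3.
  rewrite -natrX ler_nat; apply: (leq_trans _ (bin3_le n)).
  apply: (@leq_trans 'C(n, 3)); last by rewrite leq_pmulr.
  rewrite -[n in 'C(n, _)](card_ord n) -card_draws; apply: subset_leq_card.
  by apply/fintype.subsetP => S; rewrite !inE => /andP[/andP[-> _] _].
(* If the total exceeds [thr], the bound [n ^ 3] on [N] suffices; otherwise the triangles with two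
   hubs leave room for at most [m] inside [outside]. *)
case: ifPn => [_|]; first by rewrite mulrC [_ + m * _]addrC ler_wpDl // ?mulr_ge0 // ler_wpM2r.
rewrite -leNgt => hle; rewrite add0r mulrC ler_wpM2r //.
rewrite leNgt; apply/negP => mN; move: hle; rewrite leNgt => /negP; apply.
have [H0 [H0k H0U H0top]] := all_blocks_top_hubs hw.
have dUH : [disjoint outside & H0].
  by rewrite disjoint_sym finset.disjoints_subset.
have He i j : i \in H0 -> i != j -> config_edge w i j.
  by move=> iH ij; apply: top_adjacent => // b; rewrite H0top.
have := card_cliques3_ge (config_edge_sym w) dUH He.
rewrite H0k card_outside -/N -(ler_nat R) natrD natrM => h.
by apply: lt_le_trans h; apply: (lt_trans Hthr); rewrite ltrD2l.
Qed.

End FiniteModel.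

Local Open Scope classical_set_scope.
Local Open Scope ring_scope.

(** * From the random graph to a finite law *)

Section FiniteLaw.
Context (d : measure_display) (T : measurableType d) (R : realType)
  (P : probability T R) (Omega : finType) (X : T -> Omega).
Hypothesis mX : forall w, measurable (X @^-1` [set w]).

Definition law (w : Omega) : R := fine (P (X @^-1` [set w])).

Lemma law_ge0 w : 0 <= law w.
Proof. exact: fine_ge0. Qed.

Lemma measurable_finite_event (Q : pred Omega) : measurable [set t | Q (X t)].
Proof.
rewrite (_ : [set t | Q (X t)] = \bigcup_(w in [set w | Q w]) (X @^-1` [set w])).
  by apply: fin_bigcup_measurable => // w _; exact: mX.
by apply/seteqP; split=> [t Qt|t [w /= Qw ->]]//; exists (X t).
Qed.

Lemma law_event (Q : pred Omega) : P [set t | Q (X t)] = (\sum_(w | Q w) law w)%:E.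
Proof.
rewrite (_ : [set t | Q (X t)] = \bigcup_(w in [set` enum Q]) (X @^-1` [set w])); last first.
  apply/seteqP; split=> [t Qt|t [w /=]]; first by exists (X t) => //=; rewrite mem_enum.
  by rewrite mem_enum => Qw ->.
rewrite measure_fin_bigcup//; last by move=> w w' _ _ [t [/= <- <-]].
rewrite -fsbig_seq ?enum_uniq //.
rewrite big_enum -sumEFin; apply: eq_bigr => w _.
by rewrite /law fineK // fin_num_measure.
Qed.

Lemma law_sum1 : \sum_w law w = 1.
Proof.
have := law_event predT; rewrite (_ : [set t | _] = setT); last by apply/seteqP; split.
by rewrite probability_setT => -[<-].
Qed.

End FiniteLaw.

Lemma measurable_ge1 (R : realType) : measurable [set x : R | 1 <= x].
Proof.
rewrite (_ : [set x | _] = `[1, +oo[%classic); first exact: measurable_itv.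
by apply/seteqP; split => x; rewrite /= in_itv /= andbT.
Qed.

Section Transfer.
Context (R : realType) (d : measure_display) (T : measurableType d)
    (P : probability T R) (W : nat -> {RV P >-> R}) (n : nat) (G : T -> rel 'I_n).
Hypotheses (W_iid : iid W) (G_graph : random_graph W G)
  (W_ge1 : P [set x | 1 <= W 0%N x] = 1%E).
Context (K : finType) (lev : R -> K).
Hypothesis mlev : forall a, measurable (lev @^-1` [set a]).

Definition level_prob (a : K) : R := fine (P (W 0%N @^-1` (lev @^-1` [set a]))).

Definition level_graph (t : T) : {ffun 'I_n -> K} * {set 'I_n * 'I_n} :=
  ([ffun i : 'I_n => lev (W i t)], [set u | G t u.1 u.2]%SET).

Lemma levelsE (phi : {ffun 'I_n -> K}) :
  [set t | [ffun i : 'I_n => lev (W i t)] = phi]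
  = \bigcap_(i in [set: 'I_n]) (W i @^-1` (lev @^-1` [set phi i])).
Proof.
apply/seteqP; split=> [t <- i _|t H] /=; first by rewrite ffunE.
by apply/ffunP => i; rewrite ffunE; exact: H.
Qed.

Lemma measurable_RV_preimage i (B : set R) : measurable B -> measurable (W i @^-1` B).
Proof. by move=> mB; rewrite -[X in measurable X]setTI; exact: measurable_funP. Qed.

Lemma measurable_levels (phi : {ffun 'I_n -> K}) :
  measurable [set t | [ffun i : 'I_n => lev (W i t)] = phi].
Proof.
rewrite levelsE; apply: fin_bigcap_measurable => // i _.
exact: measurable_RV_preimage.
Qed.

Lemma measurable_level_graph w : measurable (level_graph @^-1` [set w]).
Proof.
case: w => phi A.
rewrite (_ : _ @^-1` _ = [set t | [ffun i : 'I_n => lev (W i t)] = phi] `&`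
   \bigcap_(u in [set: 'I_n * 'I_n])
     (if u \in A then [set t | G t u.1 u.2] else ~` [set t | G t u.1 u.2])).
  apply: measurableI; first exact: measurable_levels.
  apply: fin_bigcap_measurable => // u _; have [_ _ mG _] := G_graph.
  by case: ifP => _; [exact: mG|apply: measurableC; exact: mG].
apply/seteqP; split=> [t [/= <- <-]|t [/= <- H]].
  by split=> // u _; rewrite inE; case: ifPn => //= /negP.
congr pair; apply/finset.setP => u; rewrite inE; have := H u I.
by case: ifP => _ //= /negP/negbTE.
Qed.

Lemma iid_box (B : 'I_n -> set R) : (forall i, measurable (B i)) ->
  P (\bigcap_(i in [set: 'I_n]) (W i @^-1` B i)) = (\prod_i P (W 0%N @^-1` B i))%E.
Proof.
move=> mB; have [W_ind W_id] := W_iid.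
(* Independence is stated for indices in [nat]; the default [setT] concerns only indices from [n]
   on. *)
pose B' (i : nat) := if insub i is Some j then B j else setT.
have BE (i : 'I_n) : B' i = B i by rewrite /B' valK.
have mB' i : measurable (B' i) by rewrite /B'; case: insub => [j|] //; exact: mB.
have := W_ind [fset i | i in iota 0 n]%fset B' mB'.
rewrite (_ : \bigcap_(i in _) _ = \bigcap_(i in [set: 'I_n]) (W i @^-1` B i)); last first.
  apply/seteqP; split=> [t H i _|t H i /=].
    by rewrite -BE; apply: H; rewrite /= in_fset/= mem_iota ltn_ord.
  by rewrite in_fset/= mem_iota /= => ni; have := H (Ordinal ni) I; rewrite -BE.
move=> ->.
rewrite (perm_big (iota 0 n)) /=; last first.
  apply: uniq_perm; [exact: fset_uniq|exact: iota_uniq|].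
  by move=> i; rewrite in_fset.
rewrite -{1}(subn0 n) -/(index_iota 0 n) big_mkord; apply: eq_bigr => i _.
by rewrite BE; exact: (W_id i 0%N _ (mB i)).
Qed.

Lemma level_probE a : P (W 0%N @^-1` (lev @^-1` [set a])) = (level_prob a)%:E.
Proof. by rewrite /level_prob fineK // fin_num_measure //; exact: measurable_RV_preimage. Qed.

Lemma iid_levels (phi : {ffun 'I_n -> K}) :
  P [set t | [ffun i : 'I_n => lev (W i t)] = phi] = (prod_weight level_prob phi)%:E.
Proof.
rewrite levelsE iid_box // -prodEFin; apply: eq_bigr => i _; exact: level_probE.
Qed.

Lemma level_prob_ge0 a : 0 <= level_prob a.
Proof. exact: fine_ge0. Qed.

Lemma level_prob_sum1 : \sum_a level_prob a = 1.
Proof.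
apply: (@law_sum1 _ _ _ P K (fun t => lev (W 0%N t))) => a.
exact: (measurable_RV_preimage _ (mlev a)).
Qed.

(** The bounds on edge probabilities need weights at least 1, which holds only almost surely. With
    this constraint added the level event keeps its probability, and the bounds hold at each of its
    points. *)
Let box1 (phi : {ffun 'I_n -> K}) : set T :=
  \bigcap_(i in [set: 'I_n]) (W i @^-1` (lev @^-1` [set phi i] `&` [set x | 1 <= x])).

Let measurable_box1 phi : measurable (box1 phi).
Proof.
apply: fin_bigcap_measurable => // i _; apply: measurable_RV_preimage.
by apply: measurableI => //; exact: measurable_ge1.
Qed.

Let box1_prob phi : P (box1 phi) = (prod_weight level_prob phi)%:E.
Proof.
have m1 := @measurable_ge1 R.
rewrite iid_box => [|i]; last exact: measurableI.
rewrite -prodEFin; apply: eq_bigr => i _.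
rewrite -level_probE preimage_setI.
have mA := measurable_RV_preimage 0 (mlev (phi i)).
have mB := measurable_RV_preimage 0 m1.
have PC : P (~` (W 0%N @^-1` [set x | 1 <= x])) = 0%E.
  by rewrite probability_setC // W_ge1 subee.
set A := _ @^-1` _ in mA *; set B := _ @^-1` _ in mB PC *.
apply/eqP; rewrite eq_le; apply/andP; split; first exact: measureIl.
rewrite -[leRHS]adde0 -PC -[leLHS](_ : P (A `&` B `|` A `&` ~` B) = _); last first.
  by rewrite -setIUr setUv setIT.
apply: (le_trans (measureU2 _ _ _)); first exact: measurableI.
  by apply: measurableI => //; exact: measurableC.
by apply: leeD => //; apply: measureIr => //; exact: measurableC.
Qed.

Lemma box1_ae phi (A : set T) : measurable A ->
  P ([set t | [ffun i : 'I_n => lev (W i t)] = phi] `&` A) = P (box1 phi `&` A).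
Proof.
move=> mA; set E := [set t | _ = phi].
have mE : measurable E by exact: measurable_levels.
have mB : measurable (box1 phi) by [].
have BE : box1 phi `<=` E.
  by rewrite /E levelsE => t H i _; have [] := H i I.
have PE : P E = (prod_weight level_prob phi)%:E by exact: iid_levels.
have PD : P (E `\` box1 phi) = 0%E.
  have -> : P (E `\` box1 phi) = (P E - P (E `&` box1 phi))%E.
    by apply: measureD => //; exact: le_lt_trans (probability_le1 P mE) (ltry _).
  by rewrite setIidr // box1_prob PE subee.
apply/eqP; rewrite eq_le; apply/andP; split; last first.
  apply: le_measure; rewrite ?inE; [exact: measurableI|exact: measurableI|].
  by apply: setSI.
rewrite -[leRHS]adde0 -PD -[leLHS](_ : P ((box1 phi `&` A) `|` ((E `&` A) `\` box1 phi)) = _).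
  apply: (le_trans (measureU2 _ _ _)); first exact: measurableI.
    by apply: measurableD => //; exact: measurableI.
  apply: leeD => //; apply: le_measure; rewrite ?inE.
  - by apply: measurableD => //; exact: measurableI.
  - exact: measurableD.
  - by move=> t [[]].
congr (P _); apply/seteqP; split => [t [[/BE Et At]|[]]//|t [Et At]].
by have [Bt|Bt] := pselect (box1 phi t); [left|right].
Qed.

(** Membership in the conditioning sigma-algebra is what allows the conditional probabilities to be
    integrated over [box1 phi]. *)
Let sigma_box1 phi : sigma_of_first W n (box1 phi).
Proof.
apply: (@fin_bigcap_measurable _ (g_sigma_algebraType
  (\bigcup_(i in `I_n) preimage_set_system setT (W i) measurable))) => // i _.
apply: sub_sigma_algebra; exists i => //=.
exists (lev @^-1` [set phi i] `&` [set x | 1 <= x]); last by rewrite setTI.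
by apply: measurableI => //; exact: measurable_ge1.
Qed.

(** The defining identity of conditional probability is taken on [box1 phi], and [box1_ae] passes
    from there to the level event. Measurability is recorded for the comparison of the integral with
    constants. *)
Lemma level_graph_edges (phi : {ffun 'I_n -> K}) (J : {set 'I_n * 'I_n}) :
  (forall u, u \in J -> (u.1 < u.2)%N) ->
  let q (x : T) : R := \prod_(u in J) edge_prob W n u.1 u.2 x in
  (\sum_(w : {ffun 'I_n -> K} * {set 'I_n * 'I_n} | (w.1 == phi) && (J \subset w.2)) law P level_graph w)%:E
   = (\int[P]_(x in box1 phi) (q x)%:E)%E
  /\ measurable_fun (box1 phi) (EFin \o q).
Proof.
move=> HJ q; have [_ _ mG Gcond] := G_graph.
pose A := \bigcap_(u in [set` J]) [set t | G t u.1 u.2].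
have JE : [set` [fset u | u in enum J]%fset] = [set` J].
  by apply/seteqP; split => u /=; rewrite in_fset /= mem_enum.
have := Gcond [fset u | u in enum J]%fset; rewrite JE => /(_ HJ) [_ qint qE].
have prodE x : \prod_(u <- [fset u | u in enum J]%fset) edge_prob W n u.1 u.2 x
   = \prod_(u in J) edge_prob W n u.1 u.2 x.
  rewrite (perm_big (enum J)) ?big_enum //=.
  by apply: uniq_perm; [exact: fset_uniq|exact: enum_uniq|move=> u; rewrite in_fset].
have mA : measurable A by apply: fin_bigcap_measurable => // u _; exact: mG.
split.
  rewrite -(law_event P measurable_level_graph (fun w : {ffun 'I_n -> K} * {set 'I_n * 'I_n} => (w.1 == phi) && (J \subset w.2))).
  under eq_integral do rewrite /q -prodE.
  rewrite qE // setIC -box1_ae //; congr (P _); apply/seteqP; split => t /=.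
    move=> /andP[/eqP -> /fintype.subsetP JG]; split => // u uJ.
    by have := JG u uJ; rewrite inE.
  move=> [-> H]; rewrite eqxx /=; apply/fintype.subsetP => u uJ.
  by rewrite inE; exact: H.
rewrite (_ : q = fun x => \prod_(u <- [fset u | u in enum J]%fset) edge_prob W n u.1 u.2 x).
  by apply: measurable_funS (measurable_int _ qint).
by apply/funext => x; rewrite prodE.
Qed.

Lemma level_graph_edges_le (qbar : K -> K -> R) (phi : {ffun 'I_n -> K})
    (J : {set 'I_n * 'I_n}) :
  (forall u v, 1 <= u -> 1 <= v ->
     0 <= Num.min (u * v / (weight_mean W * n%:R)) 1 <= qbar (lev u) (lev v)) ->
  (forall u, u \in J -> (u.1 < u.2)%N) ->
  \sum_(w : {ffun 'I_n -> K} * {set 'I_n * 'I_n} | (w.1 == phi) && (J \subset w.2)) law P level_graph w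
   <= prod_weight level_prob phi * \prod_(u in J) qbar (phi u.1) (phi u.2).
Proof.
move=> Hq HJ; rewrite -lee_fin; have [-> mq] := level_graph_edges phi HJ.
rewrite mulrC EFinM -box1_prob -integral_cst //.
apply: ge0_le_integral => //= [x Ex|x Ex].
  rewrite lee_fin; apply: prodr_ge0 => u _.
  by have [[_ h1] [_ h2]] := (Ex u.1 I, Ex u.2 I); have /andP[] := Hq _ _ h1 h2.
rewrite lee_fin; apply: ler_prod => u _.
have [[/= <- h1] [/= <- h2]] := (Ex u.1 I, Ex u.2 I); exact: Hq.
Qed.

Lemma level_graph_edges_ge (qlow : K -> K -> R) (phi : {ffun 'I_n -> K})
    (J : {set 'I_n * 'I_n}) :
  (forall u v, 1 <= u -> 1 <= v ->
     0 <= qlow (lev u) (lev v) <= Num.min (u * v / (weight_mean W * n%:R)) 1) ->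
  (forall u, u \in J -> (u.1 < u.2)%N) ->
  prod_weight level_prob phi * \prod_(u in J) qlow (phi u.1) (phi u.2)
   <= \sum_(w : {ffun 'I_n -> K} * {set 'I_n * 'I_n} | (w.1 == phi) && (J \subset w.2)) law P level_graph w.
Proof.
move=> Hq HJ; rewrite -lee_fin; have [-> mq] := level_graph_edges phi HJ.
rewrite mulrC EFinM -box1_prob -integral_cst //.
apply: ge0_le_integral => //= [x Ex|x Ex]; rewrite lee_fin.
  apply: prodr_ge0 => u _.
  have [[/= <- h1] [/= <- h2]] := (Ex u.1 I, Ex u.2 I).
  by have /andP[] := Hq _ _ h1 h2.
apply: ler_prod => u _.
have [[/= <- h1] [/= <- h2]] := (Ex u.1 I, Ex u.2 I); exact: Hq.
Qed.

End Transfer.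

(** * Discretisation of the triple integral *)

Section PowerIntegral.
Context (R : realType).
Local Notation lambda := (@lebesgue_measure R).

Lemma measurable_powR_EFin (D : set R) (q : R) :
  measurable D -> measurable_fun D (fun x : R => (x `^ q)%:E).
Proof.
move=> mD; apply/measurable_EFinP; apply: measurable_funTS; exact: measurable_powR.
Qed.

Lemma integral_powR_itv (alpha a b : R) : 0 < alpha -> 0 < a -> a < b ->
  (\int[lambda]_(x in `]a, b]) (x `^ (- alpha - 1))%:E)%E
  = ((a `^ (- alpha) - b `^ (- alpha)) / alpha)%:E.
Proof.
move=> al0 a0 ab.
rewrite integral_itv_obnd_cbnd; last by apply: measurable_powR_EFin.
have al : alpha != 0 by rewrite gt_eqF.
pose F (x : R) : R := - alpha^-1 * x `^ (- alpha).
have dF (x : R) : 0 < x -> is_derive x (1 : R) F (x `^ (- alpha - 1)).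
  move=> x0; have h := is_derive1_powR (- alpha) x0.
  have -> : x `^ (- alpha - 1) = - alpha^-1 *: (- alpha * x `^ (- alpha - 1)).
    by rewrite /GRing.scale /= mulrA mulrNN mulVf // mul1r.
  exact: is_deriveZ.
rewrite (@continuous_FTC2 _ _ F) //.
- rewrite -EFinB; congr EFin; rewrite /F; by field.
- apply/continuous_in_subspaceT => x; rewrite inE /= in_itv /= => /andP[ax _].
  have x0 : 0 < x by apply: lt_le_trans ax.
  have [D _] := is_derive1_powR (- alpha - 1) x0.
  by apply: differentiable_continuous; apply/derivable1_diffP.
- have cF (x : R) : 0 < x -> {for x, continuous F}.
    move=> /dF[D _]; apply: differentiable_continuous; exact/derivable1_diffP.
  split.
  + by move=> x; rewrite in_itv /= => /andP[ax _]; have [] := dF x (lt_trans a0 ax).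
  + by apply: cvg_at_right_filter; exact: cF.
  + by apply: cvg_at_left_filter; apply: cF; exact: lt_trans ab.
- move=> x; rewrite in_itv /= => /andP[ax _].
  by rewrite derive1E; have [_ ->] := dF x (lt_trans a0 ax).
Qed.

Lemma monotone_cvg_integral d (T : measurableType d) (mu : measure T R)
    (g_ : nat -> T -> \bar R) (g : T -> \bar R) :
  (forall n, measurable_fun setT (g_ n)) -> (forall n x, (0 <= g_ n x)%E) ->
  (forall x, nondecreasing_seq (g_ ^~ x)) -> (forall x, g_ ^~ x @ \oo --> g x) ->
  (\int[mu]_x g_ n x)%E @[n --> \oo] --> (\int[mu]_x g x)%E.
Proof.
move=> mg g0 ndg cg.
have -> : g = (fun x => limn (g_ ^~ x)).
  by apply/funext => x; apply/esym/cvg_lim => //; exact: cg.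
by apply: cvg_monotone_convergence => // x _; exact: ndg.
Qed.

End PowerIntegral.

(** * Geometric grids and windows *)

Section Grid.
Context (R : realType) (c : R).
Hypothesis c_gt1 : 1 < c.
Implicit Types (B j : nat) (u : R).

(** The power [c ^ (j - B)]: the value 1 sits at index [B], so natural indices also reach small
    values. *)
Definition grid B j : R := c ^+ j / c ^+ B.

Let c_gt0 : 0 < c. Proof. exact: lt_trans c_gt1. Qed.

Lemma grid_gt0 B j : 0 < grid B j.
Proof. by rewrite divr_gt0 // exprn_gt0. Qed.

Lemma gridS B j : grid B j.+1 / c = grid B j.
Proof.
have c0 : c != 0 by rewrite gt_eqF.
have cB : c ^+ B != 0 by rewrite expf_neq0.
by rewrite /grid exprS; field; rewrite ?c0 ?cB.
Qed.

Lemma le_grid B j j' : (j <= j')%N -> grid B j <= grid B j'.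
Proof.
move=> jj; rewrite ler_pM2r ?invr_gt0 ?exprn_gt0 //.
by rewrite ler_eXn2l.
Qed.

Definition cell B j : set R := `]grid B j / c, grid B j].

Definition window B : set R := `]grid B 0 / c, grid B (B + B)].

Lemma cell_disjoint B j j' u : cell B j u -> cell B j' u -> j = j'.
Proof.
wlog jj : j j' / (j <= j')%N.
  by move=> H; case/orP: (leq_total j j') => h h1 h2; [|apply/esym]; exact: H.
rewrite leq_eqVlt in jj; case/orP: jj => [/eqP //|jj].
rewrite /cell /= !in_itv /= => /andP[_ h1] /andP[h2 _].
case: j' jj h2 => // j' jj; rewrite gridS ltNge => /negP[].
by apply: (le_trans h1); exact: le_grid.
Qed.

Lemma window_cell B u : window B u -> exists j : 'I_(B + B).+1, cell B j u.
Proof.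
rewrite /window /= in_itv /= => /andP[h1 h2].
have ex : exists j, u <= grid B j by exists (B + B)%N.
case: (ex_minnP ex) => j uj jmin.
have jB : (j < (B + B).+1)%N by rewrite ltnS; exact: jmin.
exists (Ordinal jB); rewrite /cell /= in_itv /= uj andbT.
case: j uj jmin jB => // j uj jmin jB.
by rewrite gridS ltNge; apply/negP => /jmin; rewrite ltnn.
Qed.

Lemma cell_window B (j : 'I_(B + B).+1) u : cell B j u -> window B u.
Proof.
rewrite /cell /window /= !in_itv /= => /andP[h1 h2]; apply/andP; split.
  apply: le_lt_trans h1; rewrite ler_pM2r ?invr_gt0 //; exact: le_grid.
by apply: (le_trans h2); apply: le_grid; rewrite -ltnS.
Qed.

Lemma window_gt0 B u : window B u -> 0 < u.
Proof.
rewrite /window /= in_itv /= => /andP[h1 _]; apply: lt_trans h1.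
by rewrite divr_gt0 // grid_gt0.
Qed.

Lemma subset_window B B' : (B <= B')%N -> window B `<=` window B'.
Proof.
move=> BB u; rewrite /window /= !in_itv /= => /andP[h1 h2]; apply/andP; split.
  apply: le_lt_trans h1; rewrite ler_pM2r ?invr_gt0 // /grid !expr0 !div1r.
  by rewrite lef_pV2 ?posrE ?exprn_gt0 // ler_eXn2l.
apply: (le_trans h2); rewrite /grid !exprD !mulfK ?gt_eqF ?exprn_gt0 //.
by rewrite ler_eXn2l.
Qed.

Lemma window_cover u : 0 < u -> exists B, window B u.
Proof.
move=> u0.
(* By Bernoulli's inequality, [B (c - 1) <= c ^ B]. *)
have ex (x : R) : exists B, x <= c ^+ B.
  have [B h] : exists B, `|x| / (c - 1) < B%:R.
    by exists (Num.bound (`|x| / (c - 1))); apply: archi_boundP; rewrite divr_ge0 // subr_ge0 ltW.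
  exists B; have c1 : 0 < c - 1 by rewrite subr_gt0.
  apply: (le_trans (ler_norm x)).
  have h' : `|x| <= B%:R * (c - 1) by rewrite ltW // -ltr_pdivrMr.
  apply: (le_trans h'); elim: (B) => [|k ih]; first by rewrite mul0r exprn_ge0 // ltW.
  rewrite exprS -natr1; have : 1 <= c ^+ k by rewrite exprn_ege1 // ltW.
  move: ih; set t := c ^+ k => ih t1; nra.
have [B1 h1] := ex u; have [B2 h2] := ex u^-1; exists (B1 + B2)%N.
rewrite /window /= in_itv /= /grid expr0 div1r; apply/andP; split; last first.
  rewrite exprD mulfK ?gt_eqF ?exprn_gt0 //; apply: (le_trans h1).
  by rewrite ler_eXn2l // leq_addr.
rewrite -(invrK u) -invfM ltf_pV2 ?posrE ?mulr_gt0 ?invr_gt0 ?exprn_gt0 //.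
apply: (le_lt_trans h2); rewrite -exprSr ltr_eXn2l //; lia.
Qed.

End Grid.

(** * Comparison of the triple integral with step functions *)

Section TripleIntegral.
Context (R : realType) (c mu alpha : R).
Hypotheses (c_gt1 : 1 < c) (mu_gt0 : 0 < mu) (alpha_gt0 : 0 < alpha).
Local Notation lambda := (@lebesgue_measure R).
Local Notation Z := (`]0%R, +oo[%classic : set R).

Implicit Types (E : set R) (u v w : R).

Let c_gt0 : 0 < c. Proof. exact: lt_trans c_gt1. Qed.

Lemma f1_ge0 (m u v w : R) : 0 < m -> 0 <= u -> 0 <= v -> 0 <= w -> 0 <= f1 m u v w.
Proof.
by move=> m0 u0 v0 w0; rewrite /f1 !mulr_ge0 // le_min ler01 andbT divr_ge0 ?mulr_ge0 // ltW.
Qed.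

Lemma f1_le (m u v w u' v' w' : R) : 0 < m -> 0 <= u <= u' -> 0 <= v <= v' -> 0 <= w <= w' ->
  f1 m u v w <= f1 m u' v' w'.
Proof.
move=> m0 /andP[u0 uu] /andP[v0 vv] /andP[w0 ww].
have mle (x y x' y' : R) : 0 <= x -> x <= x' -> 0 <= y -> y <= y' ->
    0 <= Num.min (x * y / m) 1 <= Num.min (x' * y' / m) 1.
  move=> x0 xx y0 yy; have h : 0 <= x * y / m by rewrite divr_ge0 ?mulr_ge0 // ltW.
  rewrite le_min h ler01 /=.
  rewrite le_min !ge_min lexx orbT andbT ler_pM2r ?invr_gt0 //.
  by rewrite ler_pM.
have /andP[a0 a1] := mle u v u' v' u0 uu v0 vv.
have /andP[b0 b1] := mle v w v' w' v0 vv w0 ww.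
have /andP[d0 d1] := mle u w u' w' u0 uu w0 ww.
by rewrite /f1 ler_pM ?mulr_ge0 // ler_pM.
Qed.

(** Each of the three truncated factors grows by at most [c ^ 2]. *)
Lemma f1_scale (m u v w : R) : 0 < m -> 0 <= u -> 0 <= v -> 0 <= w ->
  f1 m (c * u) (c * v) (c * w) <= c ^+ 6 * f1 m u v w.
Proof.
move=> m0 u0 v0 w0.
have mle (x y : R) : 0 <= x -> 0 <= y -> 0 <= Num.min (x * y / m) 1 /\
   0 <= Num.min (c * x * (c * y) / m) 1 <= c ^+ 2 * Num.min (x * y / m) 1.
  move=> x0 y0; have h : 0 <= x * y / m by rewrite divr_ge0 ?mulr_ge0 // ltW.
  have -> : c * x * (c * y) / m = c ^+ 2 * (x * y / m) by rewrite expr2; ring.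
  have c2 : 1 <= c ^+ 2 by rewrite exprn_ege1 // ltW.
  have h2 : 0 <= c ^+ 2 * (x * y / m) by rewrite mulr_ge0 // exprn_ge0 // ltW.
  rewrite !le_min h h2 ler01 /=; split=> //.
  by rewrite minr_pMr ?exprn_ge0 ?(ltW c_gt0) // mulr1 le_min !ge_min lexx c2 orbT.
have [p1 /andP[a0 a1]] := mle u v u0 v0.
have [p2 /andP[b0 b1]] := mle v w v0 w0.
have [p3 /andP[d0 d1]] := mle u w u0 w0.
have -> : c ^+ 6 * f1 m u v w = c ^+ 2 * Num.min (u * v / m) 1
   * (c ^+ 2 * Num.min (v * w / m) 1) * (c ^+ 2 * Num.min (u * w / m) 1).
  by rewrite /f1; ring.
by rewrite /f1 ler_pM ?mulr_ge0 // ler_pM.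
Qed.

(** This is [alpha] times the integral of [u ^ (- alpha - 1)] over the cell. *)
Definition cell_mass B j : R :=
  (grid c B j / c) `^ (- alpha) - grid c B j `^ (- alpha).

Definition window_sum B : R :=
  \sum_(l < (B + B).+1) \sum_(k < (B + B).+1) \sum_(j < (B + B).+1)
    cell_mass B l * cell_mass B k * cell_mass B j
    * f1 mu (grid c B j) (grid c B k) (grid c B l).

Let kap (u : R) : R := u `^ (- alpha - 1).
(** With indicators in place of restricted domains, every inner integral is a function on the whole
    line, to which Tonelli measurability and monotone convergence apply. *)
Let ker E (w v u : R) : R :=
  f1 mu u v w * kap u * kap v * kap w * (\1_E u * \1_E v * \1_E w).

Let kap_ge0 u : 0 <= kap u. Proof. exact: powR_ge0. Qed.
Let indic_ge0 (E : set R) u : 0 <= (\1_E u : R). Proof. by rewrite indicE. Qed.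

Let ker_ge0 E w v u : E `<=` Z -> 0 <= ker E w v u.
Proof.
move=> EZ; rewrite /ker !indicE.
have pos x : x \in E -> 0 <= x.
  by rewrite inE => /EZ /=; rewrite in_itv /= andbT => /ltW.
case: (boolP (u \in E)) => uE; last by rewrite !mul0r mulr0.
case: (boolP (v \in E)) => vE; last by rewrite !(mul0r, mulr0).
case: (boolP (w \in E)) => wE; last by rewrite !(mul0r, mulr0).
rewrite !mulr1; do 3! apply: mulr_ge0 => //; by apply: f1_ge0 => //; exact: pos.
Qed.

Let measurable_ker E : measurable E ->
  measurable_fun setT (fun x : (R * R) * R => (ker E x.1.1 x.1.2 x.2)%:E).
Proof.
move=> mE; apply/measurable_EFinP.
have m1 : measurable_fun setT (fun x : (R * R) * R => x.1.1).
  exact: (measurableT_comp measurable_fst measurable_fst).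
have m2 : measurable_fun setT (fun x : (R * R) * R => x.1.2).
  exact: (measurableT_comp measurable_snd measurable_fst).
have m3 : measurable_fun setT (fun x : (R * R) * R => x.2) by exact: measurable_snd.
have mk (f : (R * R) * R -> R) : measurable_fun setT f ->
    measurable_fun setT (fun x => kap (f x)).
  move=> mf; have h : measurable_fun setT kap by exact: measurable_powR.
  exact: (measurableT_comp h mf).
have mi (f : (R * R) * R -> R) : measurable_fun setT f ->
    measurable_fun setT (fun x => \1_E (f x) : R).
  move=> mf; have h : measurable_fun setT (\1_E : R -> R) by exact: measurable_indic.
  exact: (measurableT_comp h mf).
have mm (f g : (R * R) * R -> R) : measurable_fun setT f -> measurable_fun setT g ->
    measurable_fun setT (fun x => Num.min (f x * g x / mu) 1).
  move=> mf mg; apply: measurable_minr => //.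
  by apply: measurable_funM => //; exact: measurable_funM.
rewrite /ker /f1.
by repeat apply: measurable_funM; [exact: mm|exact: mm|exact: mm|exact: mk|exact: mk|exact: mk|exact: mi|exact: mi|exact: mi].
Qed.

Let inner E (w v : R) : \bar R := (\int[lambda]_u (ker E w v u)%:E)%E.
Let middle E (w : R) : \bar R := (\int[lambda]_v inner E w v)%E.
Let outer E : \bar R := (\int[lambda]_w middle E w)%E.

Let measurable_inner2 E : measurable E -> E `<=` Z ->
  measurable_fun setT (fun x : R * R => inner E x.1 x.2).
Proof.
move=> mE EZ.
have pos (x : (R * R) * R) : (0 <= (ker E x.1.1 x.1.2 x.2)%:E)%E.
  by rewrite lee_fin; exact: ker_ge0.
exact: (@measurable_fun_fubini_tonelli_F _ _ _ _ R lambda _ (measurable_ker mE) pos).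
Qed.

Let inner_ge0 E w v : E `<=` Z -> (0 <= inner E w v)%E.
Proof. by move=> EZ; apply: integral_ge0 => u _; rewrite lee_fin; exact: ker_ge0. Qed.

Let measurable_middle E : measurable E -> E `<=` Z ->
  measurable_fun setT (middle E).
Proof.
move=> mE EZ.
have pos (x : R * R) : (0 <= inner E x.1 x.2)%E by exact: inner_ge0.
exact: (@measurable_fun_fubini_tonelli_F _ _ _ _ R lambda _ (measurable_inner2 mE EZ) pos).
Qed.

Let measurable_inner E w : measurable E -> E `<=` Z -> measurable_fun setT (inner E w).
Proof.
move=> mE EZ; have := measurable_inner2 mE EZ => h.
exact: (measurableT_comp h (measurable_pair1 w)).
Qed.

Let measurable_ker1 E w v : measurable E ->
  measurable_fun setT (fun u => (ker E w v u)%:E).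
Proof.
move=> mE; have h := measurable_ker mE.
exact: (measurableT_comp h (measurable_pair1 (w, v))).
Qed.

Let middle_ge0 E w : E `<=` Z -> (0 <= middle E w)%E.
Proof. by move=> EZ; apply: integral_ge0 => v _; exact: inner_ge0. Qed.

Let window_sub B : window c B `<=` Z.
Proof. by move=> u /(window_gt0 c_gt1) u0; rewrite /= in_itv /= u0. Qed.

Let measurable_window B : measurable (window c B).
Proof. exact: measurable_itv. Qed.

Let measurable_Z : measurable Z. Proof. exact: measurable_itv. Qed.

Let ker_in E w v u : E u -> E v -> E w ->
  ker E w v u = f1 mu u v w * kap u * kap v * kap w.
Proof. by move=> uE vE wE; rewrite /ker !indicE !mem_set // !mulr1. Qed.

Let ker_out E w v u : ~ (E u /\ E v /\ E w) -> ker E w v u = 0.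
Proof.
move=> nE; rewrite /ker !indicE.
case: (boolP (u \in E)) => [|_]; last by rewrite !(mul0r, mulr0).
case: (boolP (v \in E)) => [|_]; last by rewrite !(mul0r, mulr0).
case: (boolP (w \in E)) => [|_]; last by rewrite !(mul0r, mulr0).
by rewrite !inE => wE vE uE; case: nE.
Qed.

Let ker_nd w v u : nondecreasing_seq (fun B => (ker (window c B) w v u)%:E).
Proof.
move=> B B' BB; rewrite lee_fin.
have [[uB [vB wB]]|nB] := pselect (window c B u /\ window c B v /\ window c B w).
  by rewrite !ker_in //; apply: (subset_window c_gt1 BB).
by rewrite ker_out // ker_ge0.
Qed.

Let ker_cvg w v u : (ker (window c B) w v u)%:E @[B --> \oo] --> (ker Z w v u)%:E.
Proof.
have [[uZ [vZ wZ]]|nZ] := pselect (Z u /\ Z v /\ Z w); last first.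
  apply: cvg_near_cst; apply: nearW => B; rewrite !ker_out //.
  by move=> [/window_sub uB [/window_sub vB /window_sub wB]]; apply: nZ.
have pos x : Z x -> 0 < x by rewrite /= in_itv /= andbT.
have [B1 h1] := window_cover c_gt1 (pos _ uZ).
have [B2 h2] := window_cover c_gt1 (pos _ vZ).
have [B3 h3] := window_cover c_gt1 (pos _ wZ).
apply: cvg_near_cst; exists (maxn B1 (maxn B2 B3)) => // B /=.
rewrite !geq_max => /and3P[b1 b2 b3]; rewrite ker_in; first by rewrite ker_in.
- exact: (subset_window c_gt1 b1).
- exact: (subset_window c_gt1 b2).
- exact: (subset_window c_gt1 b3).
Qed.

Let inner_nd w v : nondecreasing_seq (fun B => inner (window c B) w v).
Proof.
move=> B B' BB; apply: ge0_le_integral => //.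
- by move=> u _; rewrite lee_fin ker_ge0.
- exact: measurable_ker1.
- exact: measurable_ker1.
- by move=> u _; exact: (ker_nd w v u BB).
Qed.

Let middle_nd w : nondecreasing_seq (fun B => middle (window c B) w).
Proof.
move=> B B' BB; apply: ge0_le_integral => //.
- by move=> v _; exact: inner_ge0.
- exact: measurable_inner.
- exact: measurable_inner.
- by move=> v _; exact: (inner_nd w v BB).
Qed.

(** Monotone convergence, once per variable; at a given point the kernel is constant from some
    window on. *)
Lemma outer_cvg : outer (window c B) @[B --> \oo] --> outer Z.
Proof.
apply: monotone_cvg_integral => [B|B w|w|w].
- exact: measurable_middle.
- exact: middle_ge0.
- exact: middle_nd.
apply: monotone_cvg_integral => [B|B v|v|v].
- exact: measurable_inner.
- exact: inner_ge0.
- exact: inner_nd.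
apply: monotone_cvg_integral => [B|B u|u|u].
- exact: measurable_ker1.
- by rewrite lee_fin ker_ge0.
- exact: ker_nd.
- exact: ker_cvg.
Qed.

Let bump B j (u : R) : R := \1_(cell c B j) u * kap u.

Let bump_ge0 B j u : 0 <= bump B j u. Proof. exact: mulr_ge0. Qed.

Let measurable_bump B j : measurable_fun setT (bump B j).
Proof.
by apply: measurable_funM; [apply: measurable_indic; exact: measurable_itv|exact: measurable_powR].
Qed.

Let integral_bump B j : (\int[lambda]_u (bump B j u)%:E)%E = (cell_mass B j / alpha)%:E.
Proof.
rewrite -integral_powR_itv //; last 2 first.
- by rewrite divr_gt0 // grid_gt0.
- by rewrite ltr_pdivrMr // ltr_pMr // grid_gt0.
rewrite [RHS]integral_mkcond; apply: eq_integral => u _.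
by rewrite /bump patchE indicE /cell; case: ifP => _; rewrite ?mul1r ?mul0r.
Qed.

Let integral_steps B (a : 'I_(B + B).+1 -> R) : (forall j, 0 <= a j) ->
  (\int[lambda]_u (\sum_j a j * bump B j u)%:E)%E = (\sum_j a j * (cell_mass B j / alpha))%:E.
Proof.
move=> a0; under eq_integral do rewrite -sumEFin.
rewrite ge0_integral_sum //; last 2 first.
- by move=> j; apply/measurable_EFinP; apply: measurable_funM => //; exact: measurable_bump.
- by move=> j u _; rewrite lee_fin mulr_ge0.
rewrite -sumEFin; apply: eq_bigr => j _.
under eq_integral do rewrite EFinM.
rewrite ge0_integralZl_EFin //.
- by rewrite integral_bump.
- by move=> u _; rewrite lee_fin.
- by apply/measurable_EFinP; exact: measurable_bump.
Qed.

Let f1g B (j k l : nat) := f1 mu (grid c B j) (grid c B k) (grid c B l).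

(** [step1] freezes [f1] at the upper corner of each triple of cells; [step2] and [step3] come from
    integrating out [u], then [v], and the last integration leaves [window_sum B / alpha ^+ 3]. *)
Let step1 B (w v u : R) : R :=
  \sum_(j < (B + B).+1) (\sum_(k < (B + B).+1) (\sum_(l < (B + B).+1)
     f1g B j k l * bump B l w) * bump B k v) * bump B j u.

Let step2 B (w v : R) : R :=
  \sum_(k < (B + B).+1) (\sum_(l < (B + B).+1) (\sum_(j < (B + B).+1)
     f1g B j k l * (cell_mass B j / alpha)) * bump B l w) * bump B k v.

Let step3 B (w : R) : R :=
  \sum_(l < (B + B).+1) (\sum_(k < (B + B).+1) (\sum_(j < (B + B).+1)
     f1g B j k l * (cell_mass B j / alpha)) * (cell_mass B k / alpha)) * bump B l w.

Let f1g_ge0 B j k l : 0 <= f1g B j k l.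
Proof. by apply: f1_ge0 => //; apply/ltW; exact: grid_gt0. Qed.

Lemma cell_mass_ge0 B j : 0 <= cell_mass B j.
Proof.
have g0 := grid_gt0 c_gt1 B j; have gc0 : 0 < grid c B j / c by exact: divr_gt0.
rewrite /cell_mass subr_ge0 !powRN lef_pV2 ?posrE ?powR_gt0 //.
apply: ge0_ler_powR; rewrite ?nnegrE ?(ltW alpha_gt0) //.
- exact: ltW.
- exact: ltW.
- by rewrite ler_pdivrMr // ler_pMr // ltW.
Qed.

Let mass_ge0 B j : 0 <= cell_mass B j / alpha.
Proof. by rewrite divr_ge0 ?cell_mass_ge0 // ltW. Qed.

Let step1_int B w v : (\int[lambda]_u (step1 B w v u)%:E)%E = (step2 B w v)%:E.
Proof.
rewrite integral_steps => [|j]; last first.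
  by apply: sumr_ge0 => k _; rewrite mulr_ge0 //; apply: sumr_ge0 => l _; rewrite mulr_ge0.
congr EFin; rewrite /step2.
under eq_bigr => j _ do rewrite mulr_suml.
rewrite exchange_big /=; apply: eq_bigr => k _.
under [in RHS]eq_bigr => l _ do rewrite mulr_suml.
rewrite exchange_big /= mulr_suml; apply: eq_bigr => j _.
rewrite !mulr_suml; apply: eq_bigr => l _; ring.
Qed.

Let step2_int B w : (\int[lambda]_v (step2 B w v)%:E)%E = (step3 B w)%:E.
Proof.
rewrite integral_steps => [|k]; last first.
  apply: sumr_ge0 => l _; rewrite mulr_ge0 //; apply: sumr_ge0 => j _; rewrite mulr_ge0 //.
congr EFin; rewrite /step3.
under eq_bigr => k _ do rewrite mulr_suml.
rewrite exchange_big /=; apply: eq_bigr => l _.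
rewrite mulr_suml; apply: eq_bigr => k _; ring.
Qed.

Let step3_int B : (\int[lambda]_w (step3 B w)%:E)%E = (window_sum B / alpha ^+ 3)%:E.
Proof.
rewrite integral_steps => [|l]; last first.
  apply: sumr_ge0 => k _; rewrite mulr_ge0 //; apply: sumr_ge0 => j _; rewrite mulr_ge0 //.
congr EFin; rewrite /window_sum mulr_suml; apply: eq_bigr => l _.
rewrite !mulr_suml; apply: eq_bigr => k _.
rewrite !mulr_suml; apply: eq_bigr => j _; rewrite /f1g.
by field; rewrite gt_eqF.
Qed.

Let sum_bump B (a : nat -> R) u (j0 : 'I_(B + B).+1) : cell c B j0 u ->
  \sum_(j < (B + B).+1) a j * bump B j u = a j0 * kap u.
Proof.
move=> uj; rewrite (bigD1 j0) //= big1 ?addr0.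
  by rewrite /bump indicE mem_set // mul1r.
move=> j jj; rewrite /bump indicE memNset ?mul0r ?mulr0 // => uj'.
by move/eqP: jj; apply; apply: ord_inj; exact: (cell_disjoint c_gt1 uj' uj).
Qed.

Let sum_bump0 B (a : nat -> R) u : ~ window c B u ->
  \sum_(j < (B + B).+1) a j * bump B j u = 0.
Proof.
move=> uB; rewrite big1 // => j _; rewrite /bump indicE memNset ?mul0r ?mulr0 //.
by move=> uj; apply: uB; exact: (cell_window c_gt1 uj).
Qed.

Let step1_in B w v u (j k l : 'I_(B + B).+1) : cell c B j u -> cell c B k v -> cell c B l w ->
  step1 B w v u = f1g B j k l * kap u * kap v * kap w.
Proof.
move=> uj vk wl; rewrite /step1.
rewrite (sum_bump (fun j => \sum_(k < (B + B).+1) (\sum_(l < (B + B).+1)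
     f1g B j k l * bump B l w) * bump B k v) uj).
rewrite (sum_bump (fun k => \sum_(l < (B + B).+1) f1g B j k l * bump B l w) vk).
rewrite (sum_bump (fun l => f1g B j k l) wl); ring.
Qed.

Let step1_out B w v u : ~ (window c B u /\ window c B v /\ window c B w) ->
  step1 B w v u = 0.
Proof.
move=> nB; rewrite /step1.
have [uB|uB] := pselect (window c B u); last first.
  exact: (sum_bump0 (fun j => \sum_(k < (B + B).+1) (\sum_(l < (B + B).+1)
     f1g B j k l * bump B l w) * bump B k v) uB).
rewrite big1 // => j _; have [vB|vB] := pselect (window c B v); last first.
  by rewrite (sum_bump0 (fun k => \sum_(l < (B + B).+1) f1g B j k l * bump B l w) vB) mul0r.
rewrite big1 ?mul0r // => k _; have [wB|wB] := pselect (window c B w).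
  by case: nB.
by rewrite (sum_bump0 (fun l => f1g B j k l) wB) mul0r.
Qed.

Let ker_le_step B w v u : ker (window c B) w v u <= step1 B w v u.
Proof.
have [[uB [vB wB]]|nB] := pselect (window c B u /\ window c B v /\ window c B w); last first.
  by rewrite ker_out // step1_out.
have [j uj] := window_cell c_gt1 uB; have [k vk] := window_cell c_gt1 vB.
have [l wl] := window_cell c_gt1 wB.
rewrite (step1_in uj vk wl) ker_in // !ler_wpM2r // /f1g.
have H x (i : nat) : window c B x -> cell c B i x -> 0 <= x <= grid c B i.
  by move=> /(window_gt0 c_gt1)/ltW ->; rewrite /cell /= in_itv /= => /andP[_ ->].
by apply: f1_le => //; exact: H.
Qed.

Let step_le_ker B w v u : step1 B w v u <= c ^+ 6 * ker Z w v u.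
Proof.
have [[uB [vB wB]]|nB] := pselect (window c B u /\ window c B v /\ window c B w); last first.
  by rewrite step1_out // mulr_ge0 // ?exprn_ge0 ?ker_ge0 // ltW.
have [j uj] := window_cell c_gt1 uB; have [k vk] := window_cell c_gt1 vB.
have [l wl] := window_cell c_gt1 wB.
rewrite (step1_in uj vk wl) ker_in; [|exact: window_sub uB|exact: window_sub vB|exact: window_sub wB].
have -> : c ^+ 6 * (f1 mu u v w * kap u * kap v * kap w)
        = c ^+ 6 * f1 mu u v w * kap u * kap v * kap w by ring.
rewrite !ler_wpM2r // /f1g.
have pos x : window c B x -> 0 <= x by move=> /(window_gt0 c_gt1)/ltW.
apply: le_trans (f1_scale mu_gt0 (pos _ uB) (pos _ vB) (pos _ wB)).
have H x (i : nat) : window c B x -> cell c B i x -> 0 <= grid c B i <= c * x.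
  move=> _; rewrite /cell /= in_itv /= (ltW (grid_gt0 c_gt1 _ _)) /= => /andP[h _].
  by rewrite mulrC -ler_pdivrMr // ltW.
by apply: f1_le => //; exact: H.
Qed.

Let measurable_steps B (a : 'I_(B + B).+1 -> R) :
  measurable_fun setT (fun u => (\sum_j a j * bump B j u)%:E).
Proof.
apply/measurable_EFinP; apply: measurable_sum => j.
by apply: measurable_funM => //; exact: measurable_bump.
Qed.

Lemma outer_window_le B : (outer (window c B) <= (window_sum B / alpha ^+ 3)%:E)%E.
Proof.
rewrite -step3_int; apply: ge0_le_integral => //.
- by move=> w _; exact: middle_ge0.
- exact: measurable_middle.
- exact: measurable_steps.
move=> w _; rewrite -step2_int; apply: ge0_le_integral => //.
- by move=> v _; exact: inner_ge0.
- exact: measurable_inner.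
- exact: measurable_steps.
move=> v _; rewrite -step1_int; apply: ge0_le_integral => //.
- by move=> u _; rewrite lee_fin ker_ge0.
- exact: measurable_ker1.
- exact: measurable_steps.
by move=> u _; rewrite lee_fin ker_le_step.
Qed.

Lemma outer_ge B : ((window_sum B / alpha ^+ 3)%:E <= (c ^+ 6)%:E * outer Z)%E.
Proof.
have c6 : 0 <= c ^+ 6 by rewrite exprn_ge0 // ltW.
have bump_sum_ge0 (a : 'I_(B + B).+1 -> R) u : (forall j, 0 <= a j) ->
    (0 <= (\sum_j a j * bump B j u)%:E)%E.
  by move=> a0; rewrite lee_fin; apply: sumr_ge0 => j _; rewrite mulr_ge0.
rewrite -step3_int -ge0_integralZl_EFin //; last 2 first.
- by move=> w _; exact: middle_ge0.
- exact: measurable_middle.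
apply: ge0_le_integral => //.
- move=> w _; apply: bump_sum_ge0 => l.
  by apply: sumr_ge0 => k _; rewrite mulr_ge0 //; apply: sumr_ge0 => j _; rewrite mulr_ge0.
- exact: measurable_steps.
- by apply: measurable_funeM; exact: measurable_middle.
move=> w _; rewrite -step2_int -ge0_integralZl_EFin //; last 2 first.
- by move=> v _; exact: inner_ge0.
- exact: measurable_inner.
apply: ge0_le_integral => //.
- move=> v _; apply: bump_sum_ge0 => k.
  by apply: sumr_ge0 => l _; rewrite mulr_ge0 //; apply: sumr_ge0 => j _; rewrite mulr_ge0.
- exact: measurable_steps.
- by apply: measurable_funeM; exact: measurable_inner.
move=> v _; rewrite -step1_int -ge0_integralZl_EFin //; last 2 first.
- by move=> u _; rewrite lee_fin ker_ge0.
- exact: measurable_ker1.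
apply: ge0_le_integral => //.
- move=> u _; apply: bump_sum_ge0 => j.
  by apply: sumr_ge0 => k _; rewrite mulr_ge0 //; apply: sumr_ge0 => l _; rewrite mulr_ge0.
- exact: measurable_steps.
- by apply: measurable_funeM; exact: measurable_ker1.
by move=> u _; rewrite -EFinM lee_fin step_le_ker.
Qed.

Lemma outerE : outer Z = (\int[lambda]_(w in Z) \int[lambda]_(v in Z) \int[lambda]_(u in Z)
  (f1 mu u v w * u `^ (- alpha - 1) * v `^ (- alpha - 1) * w `^ (- alpha - 1))%:E)%E.
Proof.
rewrite [RHS]integral_mkcond; apply: eq_integral => w _; rewrite patchE.
case: ifPn => wZ; last first.
  have i0 : \1_Z w = 0 :> R by rewrite indicE (negPf wZ).
  rewrite /middle /inner integral0_eq // => v _; rewrite integral0_eq // => u _.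
  by rewrite /ker i0 !mulr0.
rewrite [RHS]integral_mkcond; apply: eq_integral => v _; rewrite patchE.
case: ifPn => vZ; last first.
  have i0 : \1_Z v = 0 :> R by rewrite indicE (negPf vZ).
  by rewrite /inner integral0_eq // => u _; rewrite /ker i0 !(mulr0, mul0r).
rewrite [RHS]integral_mkcond; apply: eq_integral => u _; rewrite patchE.
by rewrite /ker !indicE vZ wZ !mulr1; case: ifP => _; rewrite ?mulr1 ?mulr0.
Qed.

(* Both directions compare the kernel on each cell of a geometric grid of ratio
   [c] with its value at the upper corner: [f1] changes there by at most [c ^ 6]. *)
Lemma window_sum_bounds (M : R) : (forall B, window_sum B <= M) ->
  [/\ forall B, window_sum B <= c ^+ 6 * (6 * Hconst mu alpha) &
      forall eps, 0 < eps -> exists B, 6 * Hconst mu alpha - eps <= window_sum B].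
Proof.
move=> HM.
have a3 : 0 < alpha ^+ 3 by rewrite exprn_gt0.
(* The bound [M] makes the integral finite, so the [fine] in [Hconst] returns its true value. *)
have fin : outer Z \is a fin_num.
  rewrite ge0_fin_numE; last by apply: integral_ge0 => w _; exact: middle_ge0.
  apply: (@le_lt_trans _ _ (M / alpha ^+ 3)%:E); last exact: ltry.
  apply: (cvge_to_le outer_cvg); apply: nearW => B.
  by apply: (le_trans (outer_window_le B)); rewrite lee_fin ler_pM2r ?invr_gt0.
have HE : (outer Z = (6 * Hconst mu alpha / alpha ^+ 3)%:E)%E.
  rewrite -(fineK fin) outerE /Hconst; congr EFin; field; exact: lt0r_neq0.
move: HE; set H := Hconst mu alpha; move: H => H HE.
split=> [B|eps eps0].
  have := outer_ge B; rewrite HE -EFinM lee_fin ler_pdivrMr //.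
  suff -> : c ^+ 6 * (6 * H / alpha ^+ 3) * alpha ^+ 3 = c ^+ 6 * (6 * H) by [].
  by rewrite -!mulrA mulVf ?mulr1 // gt_eqF.
have /fine_cvgP[_] : outer (window c B) @[B --> \oo] --> (6 * H / alpha ^+ 3)%:E.
  by rewrite -HE; exact: outer_cvg.
have e3 : 0 < eps / alpha ^+ 3 by rewrite divr_gt0.
move=> /cvgrPdist_le/(_ _ e3)[B _ /(_ B (leqnn B))] /=.
rewrite ler_distlC => /andP[h _]; exists B.
have ofin : outer (window c B) \is a fin_num.
  rewrite ge0_fin_numE; first exact: (le_lt_trans (outer_window_le B) (ltry _)).
  by apply: integral_ge0 => w _; exact: middle_ge0.
have h2 : fine (outer (window c B)) <= window_sum B / alpha ^+ 3.
  by rewrite -lee_fin (fineK ofin); exact: outer_window_le.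
by have := le_trans h h2; rewrite -mulrBl ler_pM2r ?invr_gt0.
Qed.

End TripleIntegral.

(** * Tail and mean of the weights *)

Section Tails.
Context (R : realType) (d : measure_display) (T : measurableType d)
    (P : probability T R) (W : nat -> {RV P >-> R}) (alpha C : R).
Hypotheses (W_ge1 : P [set x | 1 <= W 0%N x] = 1%E)
    (W_tail : asymp_equiv (fun t => fine (P [set x | t < W 0%N x]))
                (fun t => C * t `^ (- alpha)))
    (C_gt0 : 0 < C) (alpha_gt1 : 1 < alpha).
Local Notation lambda := (@lebesgue_measure R).

Definition tail (t : R) : R := fine (P [set x | t < W 0%N x]).

Lemma measurable_gtW t : measurable [set x | t < W 0%N x].
Proof.
rewrite (_ : [set x | _] = W 0%N @^-1` `]t, +oo[).
  by apply: measurable_RV_preimage; exact: measurable_itv.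
by apply/seteqP; split => x; rewrite /= in_itv /= andbT.
Qed.

Lemma tailE t : P [set x | t < W 0%N x] = (tail t)%:E.
Proof. by rewrite /tail fineK // fin_num_measure //; exact: measurable_gtW. Qed.

Lemma tail_ge0 t : 0 <= tail t.
Proof. exact: fine_ge0. Qed.

Lemma tail_le1 t : tail t <= 1.
Proof. by rewrite -lee_fin -tailE; apply: probability_le1; exact: measurable_gtW. Qed.

Lemma tail_asymp (e : R) : 0 < e -> exists2 t0 : R, 0 < t0 & forall t, t0 <= t ->
  (1 - e) * C * t `^ (- alpha) <= tail t <= (1 + e) * C * t `^ (- alpha).
Proof.
move=> e0; have /cvgrPdist_le/(_ e e0)[M [_ HM]] := W_tail.
exists (Num.max 1 (M + 1)); first by rewrite lt_max ltr01.
move=> t; rewrite ge_max => /andP[t1 tM].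
have t0 : 0 < t by apply: lt_le_trans t1.
have Ct : 0 < C * t `^ (- alpha) by rewrite mulr_gt0 // powR_gt0.
have /= := HM t; rewrite -/(tail t) ler_distlC => /(_ _)/andP[|h1 h2].
  by apply: lt_le_trans tM; rewrite ltrDl.
by rewrite -!mulrA -ler_pdivlMr // h1 -ler_pdivrMr // h2.
Qed.

(** Beyond [t0] this is the asymptotic estimate; below [t0] the trivial bound 1 is at most
    [t0 ^ alpha * t ^ (- alpha)]. *)
Lemma tail_bound : exists2 M : R, 1 <= M & forall t, 0 < t -> tail t <= M * t `^ (- alpha).
Proof.
have [t0 t00 Ht] := tail_asymp (@ltr01 R).
exists (Num.max 1 (Num.max (2 * C) (t0 `^ alpha))); first by rewrite le_max lexx.
move=> t tgt0; have [tt|tt] := leP t0 t.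
  have /andP[_ h] := Ht _ tt; apply: (le_trans h).
  have -> : (1 + 1) * C = 2 * C by ring.
  by rewrite ler_wpM2r ?powR_ge0 // !le_max lexx orbT.
apply: (le_trans (tail_le1 t)).
apply: (@le_trans _ _ (t0 `^ alpha * t `^ (- alpha))); last first.
  by rewrite ler_wpM2r ?powR_ge0 // !le_max lexx !orbT.
rewrite powRN -ler_pdivrMr ?invr_gt0 ?powR_gt0 // invrK mul1r.
by apply: ge0_ler_powR; rewrite ?nnegrE ?ltW //; exact: lt_trans alpha_gt1.
Qed.

Lemma powR_decay (q : R) : 0 < q -> x `^ (- q) @[x --> +oo] --> (0 : R).
Proof.
move=> q0; apply/cvgr0Pnorm_le => e e0.
exists (e^-1 `^ q^-1); split; first exact: num_real.
move=> x /= hx; have x0 : 0 < x by apply: le_lt_trans hx; exact: powR_ge0.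
rewrite ger0_norm ?powR_ge0 // powRN -[leRHS]invrK lef_pV2 ?posrE ?powR_gt0 ?invr_gt0 //.
have -> : e^-1 = (e^-1 `^ q^-1) `^ q.
  by rewrite -powRrM mulVf ?gt_eqF // powRr1 // invr_ge0 ltW.
by apply: ge0_ler_powR; rewrite ?nnegrE ?(ltW q0) ?powR_ge0 ?(ltW x0) // ltW.
Qed.

(** The mean is the integral of the tail, finite because [alpha > 1]; so the [fine] in [weight_mean]
    takes no default value. *)
Lemma weight_mean_fin : ('E_P[W 0%N] \is a fin_num)%E /\ 1 <= weight_mean W.
Proof.
have mA : measurable [set x | 1 <= W 0%N x].
  exact: (measurable_RV_preimage W 0 (@measurable_ge1 R)).
have PA0 : P (~` [set x | 1 <= W 0%N x]) = 0%E.
  by rewrite probability_setC // W_ge1 subee.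
(* The tail formula is applied to a variable that is nonnegative everywhere; the positive part
   equals the weight almost surely. *)
pose X : {RV P >-> R} := ((W 0%N)^\+)%R.
have WX : ('E_P[W 0%N] = 'E_P[X])%E.
  rewrite unlock; apply: ae_eq_integral => //.
  - by apply/measurable_EFinP.
  - by apply/measurable_EFinP.
  exists (~` [set x | 1 <= W 0%N x]); split.
  - exact: measurableC.
  - exact: PA0.
  move=> x /= H h1; apply: H => _.
  by rewrite /X /funrpos /= max_l // (le_trans _ h1).
have [M M1 HM] := tail_bound.
have al1 : 0 < alpha - 1 by rewrite subr_gt0.
(* The tail is bounded by 1 on [[0, 1)] and by [M * r ^ (- alpha)] beyond, which gives the two
   terms. *)
have EX : ('E_P[X] <= (1 + M / (alpha - 1))%:E)%E.
  rewrite ge0_expectation_ccdf; last by move=> x; rewrite /X /funrpos le_max lexx orbT.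
  have mccdf D : measurable D -> measurable_fun D (ccdf X).
    by move=> mD; apply: measurable_funTS; exact: ccdf_measurable.
  have cc r : 0 <= r -> ccdf X r = (tail r)%:E.
    move=> r0; rewrite -tailE /ccdf /distribution /pushforward; congr (P _).
    apply/seteqP; split => x /=; rewrite in_itv /= andbT /X /funrpos lt_max.
      by rewrite (ltNge r 0) r0 orbF.
    by move=> ->.
  have -> : `[0, +oo[%classic = `[0, 1[%classic `|` `[1, +oo[%classic :> set R.
    apply/seteqP; split => x /=; rewrite !in_itv /= !andbT.
      by move=> x0; case: (ltP x 1) => h; [left; rewrite x0|right].
    by move=> [/andP[]//|]; apply: le_trans.
  rewrite ge0_integral_setU //; last 2 first.
  - by apply: mccdf; exact: measurableU.
  - apply/disj_setPS => x [] /=; rewrite !in_itv /= andbT => /andP[_ h1] h2.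
    by move: h1; rewrite ltNge h2.
  rewrite EFinD; apply: leeD.
    apply: (@le_trans _ _ (\int[lambda]_(r in `[0%R, 1%R[) cst 1 r)%E).
      apply: ge0_le_integral => //=.
      - exact: mccdf.
      - move=> r; rewrite in_itv /= => /andP[r0 _]; rewrite cc // lee_fin; exact: tail_le1.
    by rewrite integral_cst //= mul1e lebesgue_measure_itv /= lte01 sube0.
  apply: (@le_trans _ _ (\int[lambda]_(r in `[1%R, +oo[) (M * r `^ (- alpha))%:E)%E).
    apply: ge0_le_integral => //=.
    - exact: mccdf.
    - by apply/measurable_EFinP; apply: measurable_funM => //; apply: measurable_funTS; exact: measurable_powR.
    move=> r; rewrite in_itv /= andbT => r1; have r0 : 0 < r by apply: lt_le_trans r1.
    by rewrite cc ?(ltW r0) // lee_fin HM.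
  pose F (x : R) : R := - (M / (alpha - 1)) * x `^ (- (alpha - 1)).
  have dF (x : R) : 0 < x -> is_derive x (1 : R) F (M * x `^ (- alpha)).
    move=> x0; have h := is_derive1_powR (- (alpha - 1)) x0.
    have -> : M * x `^ (- alpha)
       = - (M / (alpha - 1)) *: (- (alpha - 1) * x `^ (- (alpha - 1) - 1)).
      rewrite /GRing.scale /= (_ : - (alpha - 1) - 1 = - alpha); last by ring.
      by field; rewrite gt_eqF.
    exact: is_deriveZ.
  have cF (x : R) : 0 < x -> {for x, continuous F}.
    move=> /dF[D _]; apply: differentiable_continuous; exact/derivable1_diffP.
  rewrite (@ge0_continuous_FTC2y _ _ F 1 0).
  - by rewrite /F powR1 mulr1 EFinN oppeK add0e.
  - by move=> x _; rewrite mulr_ge0 ?powR_ge0 // (le_trans ler01).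
  - apply/continuous_in_subspaceT => x; rewrite inE /= in_itv /= andbT => x1.
    have x0 : 0 < x by apply: lt_le_trans x1.
    have [D _] := is_derive1_powR (- alpha) x0.
    have cp : {for x, continuous (fun y : R => y `^ (- alpha))}.
      by apply: differentiable_continuous; apply/derivable1_diffP.
    by apply: cvgM; [exact: cvg_cst|exact: cp].
  - rewrite -[X in _ --> X](mulr0 (- (M / (alpha - 1)))).
    by apply: cvgM; [exact: cvg_cst|exact: powR_decay].
  - by move=> x x1; have [] := dF x (lt_trans ltr01 x1).
  - by apply: cvg_at_right_filter; apply: cF.
  - move=> x; rewrite in_itv /= andbT => x1.
    by rewrite derive1E; have [_ ->] := dF x (lt_trans ltr01 x1).
have fX : ('E_P[X] \is a fin_num)%E.
  rewrite ge0_fin_numE; first exact: (le_lt_trans EX (ltry _)).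
  by rewrite unlock; apply: integral_ge0 => x _; rewrite lee_fin /X /funrpos le_max lexx orbT.
split; first by rewrite WX.
rewrite /weight_mean WX -lee_fin fineK // -W_ge1.
rewrite -[X in P X]setIT -integral_indic // unlock; apply: ge0_le_integral => //.
- by apply/measurable_EFinP; exact: measurable_indic.
- by apply/measurable_EFinP.
move=> x _; rewrite lee_fin indicE /X /funrpos; case: (boolP (x \in _)).
  by rewrite inE /= le_max => ->.
by rewrite le_max lexx orbT.
Qed.

End Tails.

(** * Weight levels *)

Section Levels.
Context (R : realType) (c s mu : R) (A : nat).
Hypotheses (c_gt1 : 1 < c) (s_ge1 : 1 <= s) (mu_ge1 : 1 <= mu)
  (A_ge : c * mu * s <= c ^+ A) (A_le : c ^+ A <= c ^+ 2 * mu * s).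
Local Notation K := 'I_(A + A).+1.

(** With [s = sqrt n], the weights [s u] and [s v] are joined with probability [min (u v / mu, 1)],
    free of [n]. The hypotheses on [A] place the last knot just above [mu * s ^+ 2], the weight from
    which on a vertex is joined to all others. *)
Definition knot (a : nat) : R := s * grid c A a.

(* The last level [2 A] collects all weights above [knot (2 A - 1)], so every other
   weight [w >= 1] satisfies [low_knot (lev w) <= w <= knot (lev w)]. *)
Definition lev (w : R) : K := inord (find (fun a => w <= knot a) (iota 0 (A + A))).

Definition qbar (a b : K) : R := Num.min (grid c A a * grid c A b / mu) 1.

(** The lower end of a level, raised to 1 because weights are at least 1; this also serves level 0,
    which has no knot below it. *)
Definition low_knot (a : nat) : R := Num.max (knot a / c) 1.

Definition qlow (a b : K) : R := Num.min (low_knot a * low_knot b / (mu * s ^+ 2)) 1.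

Let c_gt0 : 0 < c. Proof. exact: lt_trans c_gt1. Qed.
Let s_gt0 : 0 < s. Proof. exact: lt_le_trans s_ge1. Qed.
Let mu_gt0 : 0 < mu. Proof. exact: lt_le_trans mu_ge1. Qed.
Let cA_gt0 : 0 < c ^+ A. Proof. exact: exprn_gt0. Qed.

Lemma knot_gt0 a : 0 < knot a.
Proof. by rewrite mulr_gt0 // grid_gt0. Qed.

Lemma le_knot a b : (a <= b)%N -> knot a <= knot b.
Proof. by move=> ab; rewrite ler_pM2l //; exact: le_grid. Qed.

Lemma knotS a : knot a.+1 / c = knot a.
Proof. by rewrite /knot -mulrA gridS. Qed.

Lemma knot_top : c * (mu * s ^+ 2) <= knot (A + A) <= c ^+ 2 * (mu * s ^+ 2).
Proof.
rewrite /knot /grid exprD mulfK ?gt_eqF //.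
have -> : c * (mu * s ^+ 2) = s * (c * mu * s) by ring.
have -> : c ^+ 2 * (mu * s ^+ 2) = s * (c ^+ 2 * mu * s) by ring.
by rewrite !ler_pM2l // A_ge A_le.
Qed.

Lemma knot0 : (c ^+ 2 * mu)^-1 <= knot 0 <= 1.
Proof.
rewrite /knot /grid expr0 div1r; apply/andP; split; last first.
  rewrite ler_pdivrMr // mul1r; apply: le_trans A_ge.
  by rewrite ler_peMl ?(ltW s_gt0) // mulr_ege1 // ltW.
rewrite ler_pdivlMr // ler_pdivrMl; last by rewrite mulr_gt0 // exprn_gt0.
by [].
Qed.

Lemma lev_nat w : (lev w : nat) = find (fun a => w <= knot a) (iota 0 (A + A)).
Proof.
rewrite inordK // ltnS; apply: (leq_trans (find_size _ _)).
by rewrite size_iota.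
Qed.

Lemma lev_le w : (lev w < A + A)%N -> w <= knot (lev w).
Proof.
rewrite lev_nat => h; have hs : has (fun a => w <= knot a) (iota 0 (A + A)).
  by rewrite has_find size_iota.
by have := nth_find 0%N hs; rewrite nth_iota // add0n.
Qed.

Lemma lev_gt w a : (a < lev w)%N -> knot a < w.
Proof.
rewrite lev_nat => h; have := before_find 0%N h.
have aA : (a < A + A)%N.
  apply: (leq_trans h); apply: (leq_trans (find_size _ _)); by rewrite size_iota.
by rewrite nth_iota // add0n => /negbT; rewrite -ltNge.
Qed.

Lemma levP w (a : K) : lev w = a <->
  ((0 < a)%N -> knot a.-1 < w) /\ ((a < A + A)%N -> w <= knot a).
Proof.
split=> [<-|[h1 h2]].
  by split=> h; [apply: lev_gt; rewrite prednK|exact: lev_le].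
apply: ord_inj; case: (ssrnat.ltngtP (lev w) a) => // h.
  have a0 : (0 < a)%N by apply: leq_ltn_trans h.
  have := lev_le (leq_trans h (ltn_ord a : (a <= A + A)%N)).
  rewrite leNgt => /negP[]; apply: le_lt_trans (h1 a0).
  by apply: le_knot; rewrite -ltnS prednK.
have aA : (a < A + A)%N by apply: (leq_trans h); rewrite -ltnS.
by have := lev_gt h; rewrite ltNge h2.
Qed.

Lemma measurable_lev (a : K) : measurable (lev @^-1` [set a]).
Proof.
rewrite (_ : _ @^-1` _ = (if (0 < a)%N then `]knot a.-1, +oo[%classic else setT)
   `&` (if (a < A + A)%N then `]-oo, knot a]%classic else setT)).
  by apply: measurableI; case: ifP => _ //; exact: measurable_itv.
apply/seteqP; split => w /=.
  move=> /levP[h1 h2]; split.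
    by case: ifP => // a0; rewrite /= in_itv /= andbT h1.
  by case: ifP => // a0; rewrite /= in_itv /= h2.
move=> [h1 h2]; apply/levP; split => h.
  by move: h1; rewrite h /= in_itv /= andbT.
by move: h2; rewrite h /= in_itv.
Qed.

(** The last level is unbounded, so its knot dominates weights only up to [mu * s ^+ 2]. This is
    enough: a larger weight has edge probability 1 with every weight at least 1. *)
Lemma lev_min w : Num.min w (mu * s ^+ 2) <= knot (lev w).
Proof.
have : (lev w <= A + A)%N by rewrite -ltnS.
rewrite leq_eqVlt => /orP[/eqP h|/lev_le h]; last by rewrite ge_min h.
rewrite ge_min h; apply/orP; right; have /andP[h1 _] := knot_top.
by apply: le_trans h1; rewrite ler_peMl ?ltW // mulr_gt0 // exprn_gt0.
Qed.

Lemma low_knot_le w : 1 <= w -> low_knot (lev w) <= w.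
Proof.
move=> w1; rewrite /low_knot ge_max w1 andbT; case E : (lev w : nat) => [|a].
  have /andP[_ h] := knot0; apply: (le_trans _ w1).
  by rewrite ler_pdivrMr // mul1r (le_trans h) // ltW.
by rewrite knotS; apply/ltW/lev_gt; rewrite E.
Qed.

Lemma low_knot_ge1 a : 1 <= low_knot a.
Proof. by rewrite le_max lexx orbT. Qed.

Let ms_ge1 : 1 <= mu * s ^+ 2.
Proof. by rewrite mulr_ege1 // exprn_ege1. Qed.

Let ms_gt0 : 0 < mu * s ^+ 2. Proof. exact: lt_le_trans ms_ge1. Qed.

Lemma qbarE (a b : K) : qbar a b = Num.min (knot a * knot b / (mu * s ^+ 2)) 1.
Proof.
rewrite /qbar /knot; congr Num.min; field.
by rewrite !gt_eqF.
Qed.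

Lemma edge_prob_le_qbar u v : 1 <= u -> 1 <= v ->
  0 <= Num.min (u * v / (mu * s ^+ 2)) 1 <= qbar (lev u) (lev v).
Proof.
move=> u1 v1; have uv0 : 0 <= u * v by rewrite mulr_ge0 // (le_trans ler01).
rewrite le_min ler01 andbT divr_ge0 ?(ltW ms_gt0) //= qbarE le_min !ge_min lexx orbT andbT.
have knot1 w : 1 <= w -> 1 <= knot (lev w).
  by move=> w1; apply: le_trans (lev_min w); rewrite le_min w1.
have big w w' : 1 <= w' -> mu * s ^+ 2 <= w ->
    1 <= knot (lev w) * knot (lev w') / (mu * s ^+ 2).
  move=> w1 hw; rewrite ler_pdivlMr // mul1r -[leLHS]mulr1 ler_pM ?(ltW ms_gt0) //.
    by apply: le_trans (lev_min w); rewrite le_min hw lexx.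
  exact: knot1.
have [hu|hu] := leP (mu * s ^+ 2) u; first by rewrite (big u v) ?orbT.
have [hv|hv] := leP (mu * s ^+ 2) v.
  by rewrite [knot _ * _]mulrC (big v u) ?orbT.
apply/orP; left; rewrite ler_pM2r ?invr_gt0 // ler_pM ?(le_trans ler01) //.
  by apply: le_trans (lev_min u); rewrite le_min lexx ltW.
by apply: le_trans (lev_min v); rewrite le_min lexx ltW.
Qed.

Lemma qlow_le_edge_prob u v : 1 <= u -> 1 <= v ->
  0 <= qlow (lev u) (lev v) <= Num.min (u * v / (mu * s ^+ 2)) 1.
Proof.
move=> u1 v1; have h a : 0 <= low_knot a by apply: le_trans (low_knot_ge1 a).
rewrite /qlow le_min ler01 andbT divr_ge0 ?(ltW ms_gt0) ?mulr_ge0 //=.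
rewrite le_min !ge_min lexx orbT andbT ler_pM2r ?invr_gt0 //.
by rewrite ler_pM ?low_knot_le.
Qed.

(** The spare factor [c] in [A_ge] keeps even the lower end of the last level at or above
    [mu * s ^+ 2]. *)
Lemma qlow_top (b : K) : qlow ord_max b = 1.
Proof.
apply/min_idPr; rewrite /= ler_pdivlMr // mul1r -[leLHS]mulr1.
apply: ler_pM; rewrite ?(ltW ms_gt0) //; last exact: low_knot_ge1.
by rewrite le_max ler_pdivlMr // mulrC; have /andP[-> _] := knot_top.
Qed.

Lemma qlow_ge (a b : K) : qbar a b <= c ^+ 2 * qlow a b.
Proof.
have c2 : 1 <= c ^+ 2 by rewrite exprn_ege1 // ltW.
have c20 : 0 <= c ^+ 2 by rewrite (le_trans ler01).
rewrite qbarE /qlow minr_pMr // mulr1 le_min !ge_min c2 orbT andbT; apply/orP; left.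
have -> : knot a * knot b / (mu * s ^+ 2)
   = c ^+ 2 * (knot a / c * (knot b / c) / (mu * s ^+ 2)).
  by field; rewrite !gt_eqF.
rewrite ler_pM2l ?exprn_gt0 // ler_pM2r ?invr_gt0 //.
have k0 e : 0 <= knot e / c by rewrite divr_ge0 // ltW // knot_gt0.
by rewrite ler_pM // /low_knot le_max lexx.
Qed.

Lemma qbarC (a b : K) : qbar a b = qbar b a.
Proof. by rewrite /qbar [_ * grid c A b]mulrC. Qed.

Lemma qlowC (a b : K) : qlow a b = qlow b a.
Proof. by rewrite /qlow [_ * low_knot b]mulrC. Qed.

Lemma qbar_ge0 (a b : K) : 0 <= qbar a b.
Proof.
by rewrite /qbar le_min ler01 andbT divr_ge0 ?(ltW mu_gt0) // mulr_ge0 // ltW // grid_gt0.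
Qed.

Lemma qlow_ge0 (a b : K) : 0 <= qlow a b.
Proof.
have h e : 0 <= low_knot e by apply: le_trans (low_knot_ge1 e).
by rewrite /qlow le_min ler01 andbT divr_ge0 ?(ltW ms_gt0) // mulr_ge0.
Qed.

Lemma qbar_le (a b : K) : qbar a b <= knot a / (mu * s ^+ 2) * knot b.
Proof. by rewrite qbarE ge_min mulrAC lexx. Qed.

Lemma triangle_f1 (a b e : K) :
  qbar a b * (qbar a e * qbar b e) = f1 mu (grid c A a) (grid c A b) (grid c A e).
Proof. by rewrite /qbar /f1; ring. Qed.

End Levels.

Lemma exists_grid_size (R : realType) (c m : R) : 1 < c -> 1 <= m ->
  exists A : nat, c * m <= c ^+ A <= c ^+ 2 * m.
Proof.
move=> c1 m1; have c0 : 0 < c by apply: lt_trans c1.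
have ex : exists A : nat, c * m <= c ^+ A.
  have [B] := window_cover c1 (mulr_gt0 c0 (lt_le_trans ltr01 m1)).
  rewrite /window /= in_itv /= => /andP[_ h]; exists B; apply: (le_trans h).
  by rewrite /grid exprD mulfK // gt_eqF // exprn_gt0.
case: (ex_minnP ex) => A hA Amin; exists A; rewrite hA /=.
case: A hA Amin => [|A] hA Amin.
  by rewrite expr0 mulr_ege1 // exprn_ege1 // ltW.
have : ~~ (c * m <= c ^+ A) by apply/negP => /Amin; rewrite ltnn.
rewrite -ltNge => /ltW h; rewrite exprS expr2 -mulrA.
by rewrite ler_pM2l.
Qed.

(** * The mean number of triangles *)

Section Domination.
Context (R : realType).

Lemma min1_le_powR (t theta : R) : 0 < t -> 0 <= theta <= 1 -> Num.min t 1 <= t `^ theta.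
Proof.
move=> t0 /andP[th0 th1]; rewrite ge_min; have [t1|t1] := leP t 1.
  apply/orP; left; rewrite -[leLHS]powRr1 ?(ltW t0) //.
  by apply: ger_powR; rewrite ?t0.
by apply/orP; right; rewrite -(powRr0 t); apply: ler_powR => //; exact: ltW.
Qed.

(** Each factor [min (x y / mu, 1)] is at most [(x y) ^ (th / 2)] for any [th] in [[0, 2]]. Giving
    the pairs the exponents [(e1 + e2 - e3) / 2], [(e2 + e3 - e1) / 2] and [(e1 + e3 - e2) / 2]
    makes the powers of [u], [v], [w] add up to [e1], [e2], [e3]. *)
Lemma f1_le_powR (mu u v w e1 e2 e3 : R) : 1 <= mu -> 0 < u -> 0 < v -> 0 < w ->
  0 <= e1 + e2 - e3 <= 2 -> 0 <= e2 + e3 - e1 <= 2 -> 0 <= e1 + e3 - e2 <= 2 ->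
  f1 mu u v w <= u `^ e1 * v `^ e2 * w `^ e3.
Proof.
move=> mu1 u0 v0 w0 h1 h2 h3; have mu0 : 0 < mu by apply: lt_le_trans mu1.
have mle (x y th : R) : 0 < x -> 0 < y -> 0 <= th <= 2 ->
    0 <= Num.min (x * y / mu) 1 <= x `^ (th / 2) * y `^ (th / 2).
  move=> x0 y0 hth; have xy0 : 0 < x * y by exact: mulr_gt0.
  rewrite le_min ler01 andbT divr_ge0 ?(ltW xy0) ?(ltW mu0) //=.
  rewrite -powRM ?(ltW x0) ?(ltW y0) //.
  apply: le_trans (min1_le_powR xy0 _); last first.
    have /andP[a b] := hth; apply/andP; split; lra.
  rewrite le_min !ge_min lexx orbT andbT ler_pdivrMr //.
  by rewrite ler_peMr // ltW.
have /andP[a0 a1] := mle u v _ u0 v0 h1.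
have /andP[b0 b1] := mle v w _ v0 w0 h2.
have /andP[d0 d1] := mle u w _ u0 w0 h3.
apply: (@le_trans _ _ ((u `^ ((e1 + e2 - e3) / 2) * v `^ ((e1 + e2 - e3) / 2)) *
  (v `^ ((e2 + e3 - e1) / 2) * w `^ ((e2 + e3 - e1) / 2)) *
  (u `^ ((e1 + e3 - e2) / 2) * w `^ ((e1 + e3 - e2) / 2)))).
  by rewrite /f1 ler_pM ?mulr_ge0 // ler_pM.
have pD (x a b e : R) : 0 < x -> a + b = e -> x `^ a * x `^ b = x `^ e.
  by move=> x0 <-; rewrite powRD // (gt_eqF x0) implybT.
rewrite -(pD u ((e1 + e2 - e3) / 2) ((e1 + e3 - e2) / 2) e1) //; last by field.
rewrite -(pD v ((e1 + e2 - e3) / 2) ((e2 + e3 - e1) / 2) e2) //; last by field.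
rewrite -(pD w ((e2 + e3 - e1) / 2) ((e1 + e3 - e2) / 2) e3) //; last by field.
by rewrite le_eqVlt; apply/orP; left; apply/eqP; ring.
Qed.

Variables (alpha eta : R).
Hypotheses (eta_gt0 : 0 < eta) (eta_lo : 3 * eta <= alpha) (eta_hi : alpha + 3 * eta <= 2).

Definition two_power (u : R) : R := Num.min (u `^ eta) (u `^ (- eta)).

(** Each variable picks its own sign of [eta], and [f1_le_powR] is used with exponents [alpha] plus
    or minus [eta]. Its conditions then follow once [alpha - 3 * eta] and [alpha + 3 * eta] lie in
    [[0, 2]], whence the hypotheses on [eta]. *)
Lemma f1_dom (mu u v w : R) : 1 <= mu -> 0 < u -> 0 < v -> 0 < w ->
  u `^ (- alpha) * v `^ (- alpha) * w `^ (- alpha) * f1 mu u v w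
  <= two_power u * two_power v * two_power w.
Proof.
move=> mu1 u0 v0 w0.
have tp (x : R) : 0 < x -> exists2 e, - eta <= e <= eta & two_power x = x `^ e.
  have he : 0 < eta by exact: eta_gt0.
  move=> x0; rewrite /two_power; case: leP => _.
    by exists eta => //; rewrite lexx andbT; lra.
  by exists (- eta) => //; rewrite lexx; lra.
have [e1 /andP[a1 b1] ->] := tp u u0; have [e2 /andP[a2 b2] ->] := tp v v0.
have [e3 /andP[a3 b3] ->] := tp w w0.
have H : f1 mu u v w <= u `^ (alpha + e1) * v `^ (alpha + e2) * w `^ (alpha + e3).
  have h1 : 3 * eta <= alpha by exact: eta_lo.
  have h2 : alpha + 3 * eta <= 2 by exact: eta_hi.
  by apply: f1_le_powR => //; apply/andP; split; lra.
apply: (le_trans (ler_wpM2l _ H)); first by rewrite !mulr_ge0 ?powR_ge0.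
have pD (x e : R) : 0 < x -> x `^ (- alpha) * x `^ (alpha + e) = x `^ e.
  by move=> x0; rewrite -powRD ?(gt_eqF x0) ?implybT // addKr.
rewrite -(pD u e1) // -(pD v e2) // -(pD w e3) //.
by rewrite le_eqVlt; apply/orP; left; apply/eqP; ring.
Qed.

Lemma two_power_ge0 u : 0 <= two_power u.
Proof. by rewrite /two_power le_min !powR_ge0. Qed.

Variable (c : R).
Hypothesis c_gt1 : 1 < c.

Definition ratio : R := c `^ (- eta).

Lemma ratio_bounds : 0 < ratio < 1.
Proof.
have c0 : 0 < c by apply: lt_trans c_gt1.
rewrite /ratio powR_gt0 //= powRN invf_lt1 ?powR_gt0 //.
have <- : 1 `^ eta = 1 :> R by rewrite powR1.
by apply: gt0_ltr_powR; rewrite ?nnegrE ?ler01 ?(ltW c0).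
Qed.

Lemma geometric_sum_le (r : R) k : 0 < r < 1 -> \sum_(i < k) r ^+ i <= (1 - r)^-1.
Proof.
move=> /andP[r0 r1]; have r1' : 0 < 1 - r by rewrite subr_gt0.
rewrite -div1r ler_pdivlMr // mulrC -opprB mulNr -subrX1 opprB.
by rewrite lerBlDr lerDl exprn_ge0 // ltW.
Qed.

(** Subtraction is truncated: each bound is informative on one side of the centre [A] and on the
    other side only says that the value is at most 1. *)
Lemma two_power_grid A a : (two_power (grid c A a) <= ratio ^+ (A - a)) /\
  (two_power (grid c A a) <= ratio ^+ (a - A)).
Proof.
have c0 : 0 < c by apply: lt_trans c_gt1.
have /andP[r0 r1] := ratio_bounds.
have gE : grid c A a = c `^ (a%:R - A%:R).
  by rewrite powRD ?(gt_eqF c0) ?implybT // powRN !powR_mulrn // ltW.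
have rE k : ratio ^+ k = c `^ (- eta * k%:R) by rewrite /ratio -powR_mulrn ?powR_ge0 // -powRrM.
have he : 0 < eta by exact: eta_gt0.
rewrite /two_power !ge_min gE -!powRrM !rE; split; apply/orP.
  have [aA|Aa] := leqP a A.
    by left; apply: ler_powR; rewrite ?(ltW c_gt1) // natrB //; lra.
  right; apply: ler_powR; rewrite ?(ltW c_gt1) //.
  have : (A%:R : R) <= a%:R by rewrite ler_nat ltnW.
  have -> : (A - a = 0)%N by lia. 
  by nra.
have [aA|Aa] := leqP a A.
  left; apply: ler_powR; rewrite ?(ltW c_gt1) //.
  have : (a%:R : R) <= A%:R by rewrite ler_nat.
  have -> : (a - A = 0)%N by lia.
  by nra.
by right; apply: ler_powR; rewrite ?(ltW c_gt1) // natrB ?(ltnW Aa) //; lra.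
Qed.

Definition in_window A B (a : nat) := (A - B <= a <= A + B)%N.

(** Two geometric tails, each starting at distance [B.+1] from the centre. *)
Lemma sum_outside_le A B : (B <= A)%N ->
  \sum_(a < (A + A).+1 | ~~ in_window A B a) two_power (grid c A a)
  <= 2 * ratio ^+ B.+1 / (1 - ratio).
Proof.
move=> BA; have rb := ratio_bounds; have /andP[r0 r1] := rb.
pose F a := two_power (grid c A a).
rewrite -(big_mkord (fun a => ~~ in_window A B a) F).
rewrite (@big_cat_nat _ _ _ (A - B)) //=; last by lia.
rewrite [X in _ + X](@big_cat_nat _ _ _ (A + B).+1) //=; [|lia|lia].
rewrite [X in _ + (X + _)]big_nat_cond [X in _ + (X + _)]big1 ?add0r; last first.
  by move=> i; rewrite /in_window; lia.
have -> : 2 * ratio ^+ B.+1 / (1 - ratio)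
   = ratio ^+ B.+1 * (1 - ratio)^-1 + ratio ^+ B.+1 * (1 - ratio)^-1 by ring.
have geo k : \sum_(i < k) ratio ^+ (B.+1 + i) <= ratio ^+ B.+1 * (1 - ratio)^-1.
  under eq_bigr do rewrite exprD.
  by rewrite -mulr_sumr ler_wpM2l ?geometric_sum_le // exprn_ge0 // ltW.
apply: lerD.
  apply: le_trans (geo (A - B)%N).
  rewrite big_nat_rev -(big_mkord xpredT (fun i => ratio ^+ (B.+1 + i))).
  rewrite big_mkcond /= !big_nat; apply: ler_sum => i /andP[_ iA].
  case: ifP => _; last by rewrite exprn_ge0 // ltW.
  apply: (le_trans (two_power_grid A _).1); rewrite le_eqVlt; apply/orP; left; apply/eqP.
  by congr (_ ^+ _); lia.
apply: le_trans (geo (A + A - (A + B))%N).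
rewrite -{1}(add0n (A + B).+1) big_addn -(big_mkord xpredT (fun i => ratio ^+ (B.+1 + i))).
rewrite subSS big_mkcond /= !big_nat; apply: ler_sum => i /andP[_ iA].
case: ifP => _; last by rewrite exprn_ge0 // ltW.
apply: (le_trans (two_power_grid A _).2); rewrite le_eqVlt; apply/orP; left; apply/eqP.
by congr (_ ^+ _); lia.
Qed.

Definition total_bound : R := 1 + 2 / (1 - ratio).

Lemma sum_two_power_le A :
  \sum_(a < (A + A).+1) two_power (grid c A a) <= total_bound.
Proof.
have rb := ratio_bounds; have /andP[r0 r1] := rb.
have aA : (A < (A + A).+1)%N by lia.
rewrite (bigD1 (Ordinal aA)) //=; apply: lerD.
  by have [+ _] := two_power_grid A A; rewrite subnn expr0.
apply: (@le_trans _ _ (2 * ratio ^+ 1 / (1 - ratio))).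
  apply: le_trans (sum_outside_le (leq0n A)).
  rewrite le_eqVlt; apply/orP; left; apply/eqP; apply: eq_bigl => a.
  by rewrite /in_window -val_eqE /=; lia.
by rewrite expr1 ler_pM2r ?invr_gt0 ?subr_gt0 // ler_piMr // ltW.
Qed.

Lemma sum_window_reindex A B (F : nat -> R) : (B <= A)%N ->
  \sum_(a < (A + A).+1 | in_window A B a) F a = \sum_(j < (B + B).+1) F (A - B + j)%N.
Proof.
move=> BA; rewrite -(big_mkord (fun a => in_window A B a) F).
rewrite (@big_cat_nat _ _ _ (A - B)) //=; last by lia.
rewrite [X in _ + X](@big_cat_nat _ _ _ (A + B).+1) //=; [|lia|lia].
rewrite big_nat_cond big1 ?add0r; last by move=> i; rewrite /in_window; lia.
rewrite [X in _ + X]big_nat_cond [X in _ + X]big1 ?addr0; last first.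
  by move=> i; rewrite /in_window; lia.
rewrite -{1}(add0n (A - B)%N) big_addn.
rewrite (_ : ((A + B).+1 - (A - B) = (B + B).+1)%N); last by lia.
rewrite -(big_mkord xpredT (fun j => F (A - B + j)%N)) big_nat_cond [RHS]big_nat_cond.
by apply: eq_big => [i|i _]; [rewrite /in_window; lia|rewrite addnC].
Qed.

(** Offset and size select a cube of levels, so that the sum over all levels and the sum over a
    window around the centre are instances of one expression. *)
Definition cube_sum (mu : R) (Q : nat -> R) A off N : R :=
  \sum_(a < N) \sum_(b < N) \sum_(e < N)
    Q (off + a)%N * Q (off + b)%N * Q (off + e)%N
    * f1 mu (grid c A (off + a)) (grid c A (off + b)) (grid c A (off + e)).

Lemma sum_prod3 N (f g h : nat -> R) :
  \sum_(a < N) \sum_(b < N) \sum_(e < N) f a * g b * h e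
  = (\sum_(a < N) f a) * (\sum_(a < N) g a) * (\sum_(a < N) h a).
Proof.
rewrite !mulr_suml; apply: eq_bigr => a _.
rewrite -mulrA mulr_suml mulr_sumr; apply: eq_bigr => b _.
by rewrite mulrA mulr_sumr.
Qed.

(** A term outside the window has an index far from the centre. With [w] the indicator of the
    window, [1 - w a * w b * w e] is at most the sum of the three single defects, each of which
    yields one geometric tail and two factors [total_bound]. *)
Lemma cube_sum_window_bounds (mu M : R) A B (Q : nat -> R) : 1 <= mu -> (B <= A)%N -> 0 <= M ->
  (forall a, 0 <= Q a <= M * grid c A a `^ (- alpha)) ->
  cube_sum mu Q A (A - B) (B + B).+1 <= cube_sum mu Q A 0 (A + A).+1 <=
    cube_sum mu Q A (A - B) (B + B).+1
      + 3 * M ^+ 3 * total_bound ^+ 2 * (2 * ratio ^+ B.+1 / (1 - ratio)).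
Proof.
move=> mu1 BA M0 HQ; have mu0 : 0 < mu by apply: lt_le_trans mu1.
pose F a b e := Q a * Q b * Q e * f1 mu (grid c A a) (grid c A b) (grid c A e).
set full := cube_sum mu Q A 0 _; set win := cube_sum mu Q A (A - B) _.
have fullE : full = \sum_(a < (A + A).+1) \sum_(b < (A + A).+1) \sum_(e < (A + A).+1) F a b e.
  by [].
pose t a := two_power (grid c A a).
have t0 a : 0 <= t a by exact: two_power_ge0.
have g0 a : 0 < grid c A a by exact: grid_gt0.
have F0 a b e : 0 <= F a b e.
  have /andP[qa _] := HQ a; have /andP[qb _] := HQ b; have /andP[qe _] := HQ e.
  apply: mulr_ge0; first by rewrite !mulr_ge0.
  by apply: f1_ge0 => //; exact: ltW.
have FM a b e : F a b e <= M ^+ 3 * (t a * t b * t e).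
  have /andP[qa qa'] := HQ a; have /andP[qb qb'] := HQ b; have /andP[qe qe'] := HQ e.
  have f0 : 0 <= f1 mu (grid c A a) (grid c A b) (grid c A e) by rewrite f1_ge0 // ltW.
  apply: (@le_trans _ _ ((M * grid c A a `^ (- alpha)) * (M * grid c A b `^ (- alpha))
     * (M * grid c A e `^ (- alpha)) * f1 mu (grid c A a) (grid c A b) (grid c A e))).
    by rewrite ler_wpM2r // ler_pM ?mulr_ge0 // ler_pM.
  apply: (@le_trans _ _ (M ^+ 3 * (grid c A a `^ (- alpha) * grid c A b `^ (- alpha) *
     grid c A e `^ (- alpha) * f1 mu (grid c A a) (grid c A b) (grid c A e)))).
    by rewrite le_eqVlt; apply/orP; left; apply/eqP; ring.
  by rewrite ler_wpM2l ?exprn_ge0 // f1_dom.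
have winE : win = \sum_(a < (A + A).+1 | in_window A B a)
   \sum_(b < (A + A).+1 | in_window A B b) \sum_(e < (A + A).+1 | in_window A B e) F a b e.
  rewrite (@sum_window_reindex A B (fun a => \sum_(b < (A + A).+1 | in_window A B b) \sum_(e < (A + A).+1 | in_window A B e) F a b e)) //.
  apply: eq_bigr => a _.
  rewrite (@sum_window_reindex A B (fun b => \sum_(e < (A + A).+1 | in_window A B e) F (A - B + a)%N b e)) //.
  by apply: eq_bigr => b _; rewrite (@sum_window_reindex A B (fun e => F _ _ e)).
pose w a : R := (in_window A B a)%:R.
have winE' : win = \sum_(a < (A + A).+1) \sum_(b < (A + A).+1) \sum_(e < (A + A).+1)
   w a * w b * w e * F a b e.
  rewrite winE big_mkcond; apply: eq_bigr => a _; rewrite /w.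
  case: ifP => _; last by rewrite big1 // => b _; rewrite big1 // => e _; rewrite !mul0r.
  rewrite big_mkcond; apply: eq_bigr => b _.
  case: ifP => _; last by rewrite big1 // => e _; rewrite mulr0 !mul0r.
  by rewrite big_mkcond; apply: eq_bigr => e _; case: ifP => _; rewrite ?mulr1 ?mul1r ?mulr0 ?mul0r.
have w01 a : 0 <= w a <= 1 by rewrite /w; case: in_window; rewrite /= ?lexx ?ler01.
apply/andP; split.
  rewrite winE' fullE; apply: ler_sum => a _; apply: ler_sum => b _; apply: ler_sum => e _.
  have /andP[a0 a1] := w01 a; have /andP[b0 b1] := w01 b; have /andP[e0 e1] := w01 e.
  by rewrite ler_piMl // mulr_ile1 // ?mulr_ge0 // mulr_ile1.
set tau := 2 * ratio ^+ _ / _.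
pose S := \sum_(a < (A + A).+1) t a.
pose O := \sum_(a < (A + A).+1) (1 - w a) * t a.
have SG : S <= total_bound by exact: sum_two_power_le.
have S0 : 0 <= S by apply: sumr_ge0.
have O0 : 0 <= O.
  by apply: sumr_ge0 => a _; have /andP[_ h] := w01 a; rewrite mulr_ge0 // subr_ge0.
have OT : O <= tau.
  apply: le_trans (sum_outside_le BA); rewrite [leRHS]big_mkcond; apply: ler_sum => a _.
  by rewrite /w; case: in_window; rewrite /= ?subrr ?mul0r // subr0 mul1r.
have H : full <= win + M ^+ 3 * (O * S * S + S * O * S + S * S * O).
  pose o a := (1 - w a) * t a.
  rewrite winE' fullE /S /O -(sum_prod3 _ o t t) -(sum_prod3 _ t o t) -(sum_prod3 _ t t o).
  rewrite -!big_split /= mulr_sumr -big_split /=.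
  apply: ler_sum => a _; rewrite -!big_split /= mulr_sumr -big_split /=.
  apply: ler_sum => b _; rewrite -!big_split /= mulr_sumr -big_split /=.
  apply: ler_sum => e _.
  have /andP[a0 a1] := w01 a; have /andP[b0 b1] := w01 b; have /andP[e0 e1] := w01 e.
  have hF := FM a b e; have hF0 := F0 a b e.
  have ab1 : w a * w b <= 1 by rewrite mulr_ile1.
  have h1 : 0 <= (1 - w a) * (1 - w b) by rewrite mulr_ge0 // subr_ge0.
  have h2 : 0 <= (1 - w a * w b) * (1 - w e) by rewrite mulr_ge0 // subr_ge0.
  have w3 : 1 - w a * w b * w e <= (1 - w a) + (1 - w b) + (1 - w e) by lra.
  have w30 : 0 <= 1 - w a * w b * w e.
    by rewrite subr_ge0 mulr_ile1 // ?mulr_ge0 // mulr_ile1.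
  rewrite [leLHS](_ : _ = w a * w b * w e * F a b e + (1 - w a * w b * w e) * F a b e); last by ring.
  apply: lerD => //.
  apply: (@le_trans _ _ (((1 - w a) + (1 - w b) + (1 - w e)) * (M ^+ 3 * (t a * t b * t e)))).
    exact: ler_pM.
  by rewrite /o le_eqVlt; apply/orP; left; apply/eqP; ring.
apply: (le_trans H); rewrite lerD2l.
have M3 : 0 <= M ^+ 3 by rewrite exprn_ge0.
have -> : O * S * S + S * O * S + S * S * O = 3 * (S ^+ 2 * O) by ring.
have -> : 3 * M ^+ 3 * total_bound ^+ 2 * tau = M ^+ 3 * (3 * (total_bound ^+ 2 * tau)) by ring.
rewrite ler_wpM2l // ler_wpM2l // ler_pM // ?exprn_ge0 //.
by rewrite lerXn2r // nnegrE // (le_trans S0).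
Qed.

Lemma cube_sum_le (mu M : R) B (Q : nat -> R) : 1 <= mu -> 0 <= M ->
  (forall a, 0 <= Q a <= M * grid c B a `^ (- alpha)) ->
  cube_sum mu Q B 0 (B + B).+1 <= M ^+ 3 * total_bound ^+ 3.
Proof.
move=> mu1 M0 HQ; have mu0 : 0 < mu by apply: lt_le_trans mu1.
pose t a := two_power (grid c B a).
have t0 a : 0 <= t a by exact: two_power_ge0.
have g0 a : 0 < grid c B a by exact: grid_gt0.
pose S := \sum_(a < (B + B).+1) t a.
have SG : S <= total_bound by exact: sum_two_power_le.
have S0 : 0 <= S by apply: sumr_ge0.
apply: (@le_trans _ _ (M ^+ 3 * (S * S * S))); last first.
  rewrite ler_wpM2l ?exprn_ge0 // (_ : total_bound ^+ 3 = total_bound * total_bound * total_bound).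
    by rewrite ler_pM ?mulr_ge0 // ler_pM.
  by ring.
have -> : M ^+ 3 * (S * S * S) = \sum_(a < (B + B).+1) \sum_(b < (B + B).+1)
    \sum_(e < (B + B).+1) M ^+ 3 * (t a * t b * t e).
  rewrite /S -(sum_prod3 _ t t t) mulr_sumr; apply: eq_bigr => a _.
  by rewrite mulr_sumr; apply: eq_bigr => b _; rewrite mulr_sumr.
apply: ler_sum => a _; apply: ler_sum => b _; apply: ler_sum => e _.
have /andP[qa qa'] := HQ a; have /andP[qb qb'] := HQ b; have /andP[qe qe'] := HQ e.
have f0 : 0 <= f1 mu (grid c B a) (grid c B b) (grid c B e) by rewrite f1_ge0 // ltW.
apply: (@le_trans _ _ ((M * grid c B a `^ (- alpha)) * (M * grid c B b `^ (- alpha))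
   * (M * grid c B e `^ (- alpha)) * f1 mu (grid c B a) (grid c B b) (grid c B e))).
  by rewrite ler_wpM2r // ler_pM ?mulr_ge0 // ler_pM.
apply: (@le_trans _ _ (M ^+ 3 * (grid c B a `^ (- alpha) * grid c B b `^ (- alpha) *
   grid c B e `^ (- alpha) * f1 mu (grid c B a) (grid c B b) (grid c B e)))).
  by rewrite le_eqVlt; apply/orP; left; apply/eqP; ring.
by rewrite ler_wpM2l ?exprn_ge0 // f1_dom.
Qed.

End Domination.

(** * Level probabilities and the limit of the mean number of triangles *)

Section LevelMasses.
Context (R : realType) (d : measure_display) (T : measurableType d)
    (P : probability T R) (W : nat -> {RV P >-> R}) (alpha C : R).
Hypotheses (W_ge1 : P [set x | 1 <= W 0%N x] = 1%E)
    (W_tail : asymp_equiv (fun t => fine (P [set x | t < W 0%N x]))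
                (fun t => C * t `^ (- alpha)))
    (C_gt0 : 0 < C) (alpha_gt1 : 1 < alpha) (alpha_lt2 : alpha < 2).
Variable c : R.
Hypothesis c_gt1 : 1 < c.
Let mu := weight_mean W.

Let c_gt0 : 0 < c. Proof. exact: lt_trans c_gt1. Qed.
Let alpha_gt0 : 0 < alpha. Proof. exact: lt_trans alpha_gt1. Qed.
Let mu_ge1 : 1 <= mu.
Proof. by have [] := weight_mean_fin W_ge1 W_tail C_gt0 alpha_gt1. Qed.
Let mu_gt0 : 0 < mu. Proof. exact: lt_le_trans mu_ge1. Qed.

Section FixedScale.
Variables (s : R) (A : nat).
Hypotheses (s_ge1 : 1 <= s) (A_ge : c * mu * s <= c ^+ A) (A_le : c ^+ A <= c ^+ 2 * mu * s).
Local Notation K := 'I_(A + A).+1.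
Local Notation p := (level_prob W (@lev R c s A)).
Let s_gt0 : 0 < s. Proof. exact: lt_le_trans s_ge1. Qed.

Lemma sum_level_prob (Q : pred K) :
  (\sum_(a | Q a) p a)%:E = P [set x | Q (lev c s A (W 0%N x))].
Proof.
rewrite (@law_event _ _ _ P K (fun x => lev c s A (W 0%N x))) // => a.
exact: (measurable_RV_preimage W 0 (measurable_lev c_gt1 s_ge1 a)).
Qed.

Lemma sum_level_prob_le_tail (Q : pred K) (t : R) :
  (forall a, Q a -> (0 < a)%N /\ t <= knot c s A a.-1) ->
  \sum_(a | Q a) p a <= tail W t.
Proof.
move=> HQ; rewrite -lee_fin sum_level_prob -tailE.
apply: le_measure; rewrite ?inE; last first.
- move=> x /= /HQ[a0 ht]; apply: (le_lt_trans ht).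
  by apply: lev_gt; rewrite prednK.
- exact: measurable_gtW.
apply: (@measurable_finite_event _ _ K (fun x => lev c s A (W 0%N x))) => a.
exact: (measurable_RV_preimage W 0 (measurable_lev c_gt1 s_ge1 a)).
Qed.

Lemma level_prob_le_tail (a : K) : (0 < a)%N -> p a <= tail W (knot c s A a.-1).
Proof.
move=> a0; have := @sum_level_prob_le_tail (pred1 a) (knot c s A a.-1).
by rewrite big_pred1_eq; apply => b /eqP ->.
Qed.

Lemma level_prob_window (a : K) : (0 < a < A + A)%N ->
  p a = tail W (knot c s A a.-1) - tail W (knot c s A a).
Proof.
move=> /andP[a0 aA]; apply/eqP; rewrite eq_sym subr_eq; apply/eqP; apply: EFin_inj.
rewrite EFinD -!tailE -level_probE; last exact: (measurable_lev c_gt1 s_ge1).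
rewrite -measureU.
- congr (P _); apply/seteqP; split => x /=.
    move=> h; have [h2|h2] := ltP (knot c s A a) (W 0%N x); first by right.
    by left; apply/(levP c_gt1 s_ge1).
  move=> [/(levP c_gt1 s_ge1)[/(_ a0) //]|]; apply: le_lt_trans.
  by apply: le_knot => //; exact: leq_pred.
- exact: (measurable_RV_preimage W 0 (measurable_lev c_gt1 s_ge1 a)).
- exact: measurable_gtW.
- apply/seteqP; split => x //= -[/(levP c_gt1 s_ge1)[_ /(_ aA) h]].
  by rewrite ltNge h.
Qed.

Lemma level_prob_top : (0 < A)%N -> p ord_max = tail W (knot c s A (A + A) / c).
Proof.
move=> A0; have AA : (0 < A + A)%N by rewrite addn_gt0 A0.
have -> : knot c s A (A + A) / c = knot c s A (A + A).-1.
  by rewrite -[in LHS](prednK AA) knotS.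
apply: EFin_inj; rewrite -tailE -level_probE; last exact: (measurable_lev c_gt1 s_ge1).
congr (P _); apply/seteqP; split => x /=; first by move=> /(levP c_gt1 s_ge1)[/(_ AA) h _].
by move=> h; apply/(levP c_gt1 s_ge1); split => //=; rewrite ltnn.
Qed.

Lemma level_prob_le (M : R) (a : K) : 1 <= M ->
  (forall t, 0 < t -> tail W t <= M * t `^ (- alpha)) ->
  p a <= M * c `^ alpha * knot c s A a `^ (- alpha).
Proof.
move=> M1 HM; have M0 : 0 <= M by apply: le_trans M1.
have ca1 : 1 <= c `^ alpha by rewrite -(powRr0 c); apply: ler_powR; rewrite ltW.
have k0 b : 0 < knot c s A b by apply: knot_gt0.
(* Level 0 is not bounded by a tail at a lower knot, but [knot 0] is at most 1, so there the claimed
   bound is at least 1. *)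
case: (posnP a) => a0.
  apply: (@le_trans _ _ 1).
    have <- := @level_prob_sum1 _ _ _ P W K (@lev R c s A) (measurable_lev c_gt1 s_ge1).
    by rewrite (bigD1 a) //= lerDl sumr_ge0 // => i _; exact: level_prob_ge0.
  rewrite -[leLHS]mulr1; apply: ler_pM => //; first by rewrite mulr_ege1.
  rewrite powRN -[leLHS]invr1 lef_pV2 ?posrE ?powR_gt0 //.
  have /andP[_ h] := knot0 c_gt1 s_ge1 mu_ge1 A_ge A_le.
  have <- : 1 `^ alpha = 1 :> R by rewrite powR1.
  rewrite a0; apply: ge0_ler_powR; rewrite ?nnegrE ?ler01 ?(ltW (k0 _)) //.
  exact: ltW.
apply: (le_trans (level_prob_le_tail a0)); apply: (le_trans (HM _ (k0 _))).
rewrite -mulrA ler_wpM2l //.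
have -> : knot c s A a = knot c s A a.-1 * c.
  by rewrite -(knotS s A c_gt1 a.-1) prednK // divfK // gt_eqF.
rewrite powRM ?(ltW (k0 _)) ?(ltW c_gt0) // mulrCA -powRD ?addrN ?powRr0 ?mulr1 //.
by rewrite (gt_eqF c_gt0) implybT.
Qed.

End FixedScale.

(** The factor [s ^ alpha] compensates the decay of the tail at weights of order [s], so that the
    mass of a fixed cell has a limit. *)
Definition window_mass (B : nat) (s : R) (j : nat) : R :=
  s `^ alpha * (tail W (s * (grid c B j / c)) - tail W (s * grid c B j)).

Lemma scaled_tail_cvg (z : R) : 0 < z ->
  s `^ alpha * tail W (s * z) @[s --> +oo] --> C * z `^ (- alpha).
Proof.
move=> z0; apply/cvgrPdist_le => e e0.
have Cz0 : 0 < C * z `^ (- alpha) by rewrite mulr_gt0 // powR_gt0.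
have e1 : 0 < e / (C * z `^ (- alpha)) by rewrite divr_gt0.
have [t0 t00 Ht] := tail_asymp W_tail C_gt0 e1.
exists (t0 / z); split; first exact: num_real.
move=> s /= hs; have s0 : 0 < s by apply: lt_trans hs; rewrite divr_gt0.
have hsz : t0 <= s * z by rewrite -ler_pdivrMr // ltW.
have /andP[h1 h2] := Ht _ hsz.
have sE : s `^ alpha * (s * z) `^ (- alpha) = z `^ (- alpha).
  rewrite powRM ?(ltW s0) ?(ltW z0) // mulrA -powRD ?(gt_eqF s0) ?implybT //.
  by rewrite addrN powRr0 mul1r.
have sa : 0 <= s `^ alpha by exact: powR_ge0.
have eE : e = e / (C * z `^ (- alpha)) * (C * z `^ (- alpha)) by rewrite divfK // gt_eqF.
move: (ler_wpM2l sa h1) (ler_wpM2l sa h2).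
have -> x : s `^ alpha * (x * C * (s * z) `^ (- alpha)) = x * (C * z `^ (- alpha)).
  by rewrite -sE; ring.
have -> x : s `^ alpha * (x * C * (s * z) `^ (- alpha)) = x * (C * z `^ (- alpha)).
  by rewrite -sE; ring.
rewrite mulrBl mulrDl mul1r -eE => h3 h4.
by rewrite ler_distlC h3 h4.
Qed.

Lemma window_mass_cvg B j : window_mass B s j @[s --> +oo] --> C * cell_mass c alpha B j.
Proof.
have g0 := grid_gt0 c_gt1 B j; have gc0 : 0 < grid c B j / c by rewrite divr_gt0.
rewrite /window_mass /cell_mass mulrBr.
under eq_fun do rewrite mulrBr.
by apply: cvgB; exact: scaled_tail_cvg.
Qed.

Definition window_cube (B : nat) (s : R) : R :=
  \sum_(l < (B + B).+1) \sum_(k < (B + B).+1) \sum_(j < (B + B).+1)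
    window_mass B s l * window_mass B s k * window_mass B s j
    * f1 mu (grid c B l) (grid c B k) (grid c B j).

Lemma f1_rev (m u v w : R) : f1 m u v w = f1 m w v u.
Proof. by rewrite /f1 [u * v]mulrC [v * w]mulrC [u * w]mulrC; ring. Qed.

Lemma window_cube_cvg B :
  window_cube B s @[s --> +oo] --> C ^+ 3 * window_sum c mu alpha B.
Proof.
have cvg_sum (f : 'I_(B + B).+1 -> R -> R) (l : 'I_(B + B).+1 -> R) :
    (forall i, f i s @[s --> +oo] --> l i) ->
    (\sum_i f i s) @[s --> +oo] --> \sum_i l i.
  by move=> H; apply: cvg_big => //; exact: add_continuous.
rewrite /window_sum mulr_sumr; apply: (cvg_sum _ _) => l.
rewrite mulr_sumr; apply: (cvg_sum _ _) => k.
rewrite mulr_sumr; apply: (cvg_sum _ _) => j.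
(* [window_sum] lists the three cells in the opposite order, and [f1] is invariant under this
   reversal. *)
rewrite f1_rev; set f := f1 _ _ _ _.
have -> : C ^+ 3 * (cell_mass c alpha B l * cell_mass c alpha B k * cell_mass c alpha B j * f)
  = C * cell_mass c alpha B l * (C * cell_mass c alpha B k) * (C * cell_mass c alpha B j) * f.
  by ring.
apply: cvgM; last exact: cvg_cst.
by apply: cvgM; [apply: cvgM|]; exact: window_mass_cvg.
Qed.

(** The largest value meeting both conditions of [f1_dom]; it is positive because
    [0 < alpha < 2]. *)
Let eta : R := Num.min (alpha / 3) ((2 - alpha) / 3).

Let eta_gt0 : 0 < eta.
Proof. by rewrite lt_min !divr_gt0 // subr_gt0. Qed.
Let eta_lo : 3 * eta <= alpha.
Proof. by rewrite mulrC -ler_pdivlMr // ge_min lexx. Qed.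
Let eta_hi : alpha + 3 * eta <= 2.
Proof. by rewrite addrC -lerBrDr mulrC -ler_pdivlMr // ge_min lexx orbT. Qed.

Lemma cell_mass_le B j : 0 <= cell_mass c alpha B j <= c `^ alpha * grid c B j `^ (- alpha).
Proof.
have g0 := grid_gt0 c_gt1 B j.
rewrite cell_mass_ge0 //=; rewrite /cell_mass; apply: le_trans (_ : (grid c B j / c) `^ (- alpha) <= _).
  by rewrite lerBlDr lerDl powR_ge0.
rewrite powRM ?(ltW g0) ?invr_ge0 ?(ltW c_gt0) // mulrC.
by rewrite -powR_inv1 ?(ltW c_gt0) // -powRrM mulN1r opprK.
Qed.

Lemma window_sum_bounded : exists M, forall B, window_sum c mu alpha B <= M.
Proof.
exists ((c `^ alpha) ^+ 3 * total_bound eta c ^+ 3) => B.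
have := @cube_sum_le R alpha eta eta_gt0 eta_lo eta_hi c c_gt1 mu (c `^ alpha) B
  (cell_mass c alpha B) mu_ge1 (powR_ge0 _ _) (fun j => cell_mass_le B j).
apply: le_trans; rewrite /window_sum /cube_sum.
apply: ler_sum => l _; apply: ler_sum => k _; apply: ler_sum => j _.
by rewrite f1_rev.
Qed.

Lemma grid_shift A B j : (B <= A)%N -> grid c A (A - B + j) = grid c B j.
Proof.
move=> BA; have cn k : c ^+ k != 0 by rewrite expf_neq0 // gt_eqF.
rewrite /grid -{2}(subnK BA) !exprD; field.
by rewrite !cn.
Qed.

Section ScaledMass.
Variables (s M : R) (A : nat).
Hypotheses (s_ge1 : 1 <= s) (A_ge : c * mu * s <= c ^+ A) (A_le : c ^+ A <= c ^+ 2 * mu * s).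
Hypotheses (M_ge1 : 1 <= M) (HM : forall t, 0 < t -> tail W t <= M * t `^ (- alpha)).

(** Extended by 0 beyond the last level, to give a function on [nat] whose bound holds at every
    index. *)
Let scaled_mass (a : nat) : R :=
  if (a < (A + A).+1)%N then s `^ alpha * level_prob W (@lev R c s A) (inord a) else 0.

Lemma scaled_mass_bound a :
  0 <= scaled_mass a <= M * c `^ alpha * grid c A a `^ (- alpha).
Proof.
have s0 : 0 < s by exact: lt_le_trans s_ge1.
have g0 := grid_gt0 c_gt1 A a.
have M'0 : 0 <= M * c `^ alpha by rewrite mulr_ge0 ?powR_ge0 // (le_trans ler01).
rewrite /scaled_mass; case: ifP => aA; last by rewrite lexx mulr_ge0 // powR_ge0.
rewrite mulr_ge0 ?powR_ge0 ?level_prob_ge0 //=.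
have := ler_wpM2l (powR_ge0 s alpha) (level_prob_le s_ge1 A_ge A_le (inord a) M_ge1 HM).
move=> h; apply: (le_trans h); rewrite inordK // /knot powRM ?(ltW s0) ?(ltW g0) //.
rewrite mulrCA; rewrite [s `^ alpha * _]mulrA -powRD ?(gt_eqF s0) ?implybT //.
by rewrite addrN powRr0 mul1r.
Qed.

Lemma scaled_triangle_mean :
  s `^ alpha ^+ 3 * triangle_mean (level_prob W (@lev R c s A)) (@qbar R c mu A)
  = cube_sum c mu scaled_mass A 0 (A + A).+1.
Proof.
rewrite /triangle_mean /cube_sum mulr_sumr; apply: eq_bigr => a _.
rewrite mulr_sumr; apply: eq_bigr => b _; rewrite mulr_sumr; apply: eq_bigr => e _.
by rewrite triangle_f1 !add0n /scaled_mass !ltn_ord !inord_val; ring.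
Qed.

(** The inequality is strict so that the window contains neither the first nor the last level, whose
    masses are not differences of tails at consecutive knots. *)
Lemma scaled_window B : (B < A)%N ->
  cube_sum c mu scaled_mass A (A - B) (B + B).+1 = window_cube B s.
Proof.
move=> BA; have QE (j : 'I_(B + B).+1) : scaled_mass (A - B + j) = window_mass B s j.
  have jB : (j <= B + B)%N by rewrite -ltnS.
  have a0 : (0 < A - B + j)%N by rewrite addn_gt0 subn_gt0 BA.
  have aA' : (A - B + j < A + A)%N.
    have : (A - B + j <= A - B + (B + B))%N by rewrite leq_add2l.
    by move=> h; apply: (leq_ltn_trans h); rewrite addnA subnK ?(ltnW BA) // ltn_add2l.
  have aA : (A - B + j < (A + A).+1)%N by apply: ltnW.
  have hw : (0 < (inord (A - B + j) : 'I_(A + A).+1) < A + A)%N.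
    by rewrite inordK // a0 aA'.
  rewrite /scaled_mass aA /window_mass (level_prob_window s_ge1 hw) inordK //.
  rewrite -(knotS s A c_gt1 (A - B + j).-1) (prednK a0).
  by rewrite /knot grid_shift ?(ltnW BA) // mulrA.
rewrite /cube_sum /window_cube; apply: eq_bigr => l _; apply: eq_bigr => k _.
by apply: eq_bigr => j _; rewrite !QE !grid_shift // ltnW.
Qed.

Lemma triangle_mean_window B : (B < A)%N ->
  window_cube B s
  <= s `^ alpha ^+ 3 * triangle_mean (level_prob W (@lev R c s A)) (@qbar R c mu A)
  <= window_cube B s + 3 * (M * c `^ alpha) ^+ 3 * total_bound eta c ^+ 2
       * (2 * ratio eta c ^+ B.+1 / (1 - ratio eta c)).
Proof.
move=> BA; have M'0 : 0 <= M * c `^ alpha by rewrite mulr_ge0 ?powR_ge0 // (le_trans ler01).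
rewrite scaled_triangle_mean -(scaled_window BA).
exact: (cube_sum_window_bounds eta_gt0 eta_lo eta_hi c_gt1 mu_ge1 (ltnW BA) M'0 scaled_mass_bound).
Qed.

End ScaledMass.

(** Windows are fixed first: [B1] for the lower bound, [B2] to make the geometric error small. Only
    then does [s] grow, and the finitely many cells of both windows converge. Half of [e] goes to
    the window, half to the limit in [s]; [c ^+ 6] is the price of evaluating [f1] at upper
    corners. *)
Lemma triangle_mean_asymp (e : R) : 0 < e -> exists2 s0 : R, 1 <= s0 & forall s A, s0 <= s ->
  c * mu * s <= c ^+ A -> c ^+ A <= c ^+ 2 * mu * s ->
  C ^+ 3 * (6 * Hconst mu alpha) - e
  <= s `^ alpha ^+ 3 * triangle_mean (level_prob W (@lev R c s A)) (@qbar R c mu A)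
  <= C ^+ 3 * (c ^+ 6 * (6 * Hconst mu alpha)) + e.
Proof.
move=> e0; have [M0 HM0] := window_sum_bounded.
have [Hup Hlow] := window_sum_bounds c_gt1 mu_gt0 alpha_gt0 HM0.
have [M M1 HM] := tail_bound W_tail C_gt0 alpha_gt1.
have rb := ratio_bounds eta_gt0 c_gt1; have /andP[r0 r1] := rb.
have C3 : 0 < C ^+ 3 by rewrite exprn_gt0.
have e2 : 0 < e / 2 by rewrite divr_gt0.
have [B1 HB1] := Hlow (e / 2 / C ^+ 3) (divr_gt0 e2 C3).
pose kappa := 3 * (M * c `^ alpha) ^+ 3 * total_bound eta c ^+ 2 * (2 / (1 - ratio eta c)).
have [B2 HB2] : exists B, kappa * ratio eta c ^+ B.+1 <= e / 2.
  have : kappa * ratio eta c ^+ n.+1 @[n --> \oo] --> (0 : R).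
    rewrite -[X in _ --> X](mulr0 kappa); apply: cvgM; first exact: cvg_cst.
    rewrite (cvg_shiftS (fun n => ratio eta c ^+ n)).
    by apply: cvg_expr; rewrite ger0_norm // ltW.
  move=> /cvgr0Pnorm_le/(_ _ e2)[B _ HB]; exists B.
  by apply: le_trans (HB B (leqnn B)); exact: ler_norm.
have wc1 : window_cube B1 s @[s --> +oo] --> C ^+ 3 * window_sum c mu alpha B1.
  exact: window_cube_cvg.
have /cvgrPdist_le/(_ _ e2)[s1 [_ Hs1]] := wc1.
have wc2 : window_cube B2 s @[s --> +oo] --> C ^+ 3 * window_sum c mu alpha B2.
  exact: window_cube_cvg.
have /cvgrPdist_le/(_ _ e2)[s2 [_ Hs2]] := wc2.
exists (Num.max 1 (Num.max (Num.max (s1 + 1) (s2 + 1)) (Num.max (c ^+ B1) (c ^+ B2)))).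
  by rewrite le_max lexx.
move=> s A; rewrite !ge_max => /and3P[s_ge1 /andP[hs1 hs2] /andP[sB1 sB2]] A_ge A_le.
have s0 : 0 < s by exact: lt_le_trans s_ge1.
have BA B : c ^+ B <= s -> (B < A)%N.
  move=> sB; suff : c ^+ B < c ^+ A by rewrite ltr_eXn2l.
  apply: lt_le_trans A_ge.
  apply: (le_lt_trans sB); rewrite ltr_pMl //.
  by apply: (lt_le_trans c_gt1); rewrite ler_peMr // ltW.
have /andP[lo _] := triangle_mean_window s_ge1 A_ge A_le M1 HM (BA _ sB1).
have /andP[_ hi] := triangle_mean_window s_ge1 A_ge A_le M1 HM (BA _ sB2).
have /= := Hs1 s _; rewrite ler_distlC => /(_ _)/andP[|lo1 _].
  by apply: lt_le_trans hs1; rewrite ltrDl.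
have /= := Hs2 s _; rewrite ler_distlC => /(_ _)/andP[|_ hi1].
  by apply: lt_le_trans hs2; rewrite ltrDl.
apply/andP; split.
  apply: (le_trans _ lo); apply: (le_trans _ lo1).
  have := ler_wpM2l (ltW C3) HB1; rewrite mulrBr [C ^+ 3 * (e / 2 / _)]mulrC divfK ?gt_eqF //.
  by move=> h; lra.
apply: (le_trans hi).
have -> : 3 * (M * c `^ alpha) ^+ 3 * total_bound eta c ^+ 2
   * (2 * ratio eta c ^+ B2.+1 / (1 - ratio eta c)) = kappa * ratio eta c ^+ B2.+1.
  by rewrite /kappa; ring.
have := ler_wpM2l (ltW C3) (Hup B2).
by move=> h; lra.
Qed.

End LevelMasses.

(** * Bounds for a graph of fixed size *)

Section FixedSize.
Context (R : realType) (d : measure_display) (T : measurableType d)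
    (P : probability T R) (W : nat -> {RV P >-> R}) (alpha C : R).
Hypotheses (W_iid : iid W) (W_ge1 : P [set x | 1 <= W 0%N x] = 1%E)
    (W_tail : asymp_equiv (fun t => fine (P [set x | t < W 0%N x]))
                (fun t => C * t `^ (- alpha)))
    (C_gt0 : 0 < C) (alpha_gt1 : 1 < alpha) (alpha_lt2 : alpha < 2).
Variable c : R.
Hypothesis c_gt1 : 1 < c.
Let mu := weight_mean W.

Let c_gt0 : 0 < c. Proof. exact: lt_trans c_gt1. Qed.
Let mu_ge1 : 1 <= mu.
Proof. by have [] := weight_mean_fin W_ge1 W_tail C_gt0 alpha_gt1. Qed.
Let mu_gt0 : 0 < mu. Proof. exact: lt_le_trans mu_ge1. Qed.

(** By [level_prob_le] the term of level [a] is at most a constant times [knot a ^ (1 - alpha)].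
    These powers form a geometric sequence of ratio [c ^ (1 - alpha) < 1], and its first term is
    bounded because [knot 0] is at least [(c ^ 2 mu)^-1], whatever [s] is. *)
Lemma level_mean_bound : exists2 Y : R, 0 <= Y & forall (s : R) (A : nat),
  1 <= s -> c * mu * s <= c ^+ A -> c ^+ A <= c ^+ 2 * mu * s ->
  \sum_a level_prob W (@lev R c s A) a * knot c s A a <= Y.
Proof.
have [M M1 HM] := tail_bound W_tail C_gt0 alpha_gt1.
have M0 : 0 <= M by apply: le_trans M1.
pose q := alpha - 1; have q0 : 0 < q by rewrite subr_gt0.
have rb := ratio_bounds q0 c_gt1; have /andP[r0 r1] := rb.
exists (M * c `^ alpha * ((c ^+ 2 * mu) `^ q * (1 - ratio q c)^-1)).
  by rewrite !mulr_ge0 ?powR_ge0 ?invr_ge0 ?subr_ge0 // ltW.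
move=> s A s1 A_ge A_le; have s0 : 0 < s by apply: lt_le_trans s1.
have k0 a : 0 < knot c s A a by exact: knot_gt0.
have /andP[kl _] := knot0 c_gt1 s1 mu_ge1 A_ge A_le.
have cm0 : 0 < c ^+ 2 * mu by rewrite mulr_gt0 // exprn_gt0.
have kq : knot c s A 0 `^ (- q) <= (c ^+ 2 * mu) `^ q.
  rewrite powRN -[leRHS]invrK lef_pV2 ?posrE ?invr_gt0 ?powR_gt0 //.
  have -> : ((c ^+ 2 * mu) `^ q)^-1 = ((c ^+ 2 * mu)^-1) `^ q.
    by rewrite -powRN -powR_inv1 ?(ltW cm0) // -powRrM mulN1r.
  by apply: ge0_ler_powR; rewrite ?nnegrE ?(ltW q0) ?invr_ge0 ?(ltW cm0) ?(ltW (k0 _)).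
apply: (@le_trans _ _ (\sum_(a < (A + A).+1)
   M * c `^ alpha * ((c ^+ 2 * mu) `^ q * ratio q c ^+ a))).
  apply: ler_sum => a _.
  apply: (le_trans (ler_wpM2r (ltW (k0 a)) (level_prob_le W_ge1 W_tail C_gt0 alpha_gt1 c_gt1 s1 A_ge A_le a M1 HM))).
  rewrite -[leLHS]mulrA; apply: ler_wpM2l; first by rewrite mulr_ge0 ?powR_ge0.
  have -> : knot c s A a `^ (- alpha) * knot c s A a = knot c s A a `^ (- q).
    rewrite -[X in _ * X]powRr1 ?(ltW (k0 _)) // -powRD ?(gt_eqF (k0 _)) ?implybT //.
    by congr (_ `^ _); rewrite /q; ring.
  have -> : knot c s A a = knot c s A 0 * c ^+ a.
    by rewrite /knot /grid expr0 div1r; ring.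
  rewrite powRM ?(ltW (k0 _)) ?exprn_ge0 ?(ltW c_gt0) //.
  have -> : (c ^+ a) `^ (- q) = ratio q c ^+ a.
    rewrite /ratio -(powR_mulrn _ (ltW c_gt0)) -(powR_mulrn _ (powR_ge0 _ _)) -!powRrM.
    by congr (_ `^ _); rewrite mulrC.
  by apply: ler_wpM2r => //; rewrite exprn_ge0 // ltW.
rewrite -!mulr_sumr !ler_wpM2l ?powR_ge0 ?mulr_ge0 ?powR_ge0 //.
exact: geometric_sum_le.
Qed.

Variables (n : nat) (G : T -> rel 'I_n).
Hypotheses (n_gt0 : (0 < n)%N) (G_graph : random_graph W G).
Variable A : nat.
Let s : R := Num.sqrt n%:R.
Hypotheses (A_ge : c * mu * s <= c ^+ A) (A_le : c ^+ A <= c ^+ 2 * mu * s).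
Local Notation K := 'I_(A + A).+1.
Local Notation p := (level_prob W (@lev R c s A)).
Local Notation X := (level_graph W G (@lev R c s A)).
Local Notation qb := (@qbar R c mu A).
Local Notation ql := (@qlow R c s mu A).

Let n1 : 1 <= (n%:R : R). Proof. by rewrite ler1n. Qed.
Let n0 : 0 < (n%:R : R). Proof. by rewrite ltr0n. Qed.
Let s_ge1 : 1 <= s. Proof. by rewrite /s -[leLHS]sqrtr1 ler_sqrt. Qed.
Let s2 : s ^+ 2 = n%:R. Proof. by rewrite sqr_sqrtr. Qed.
Let mlev := measurable_lev c_gt1 s_ge1 (A := A).
Let mX := measurable_level_graph G_graph mlev.

Lemma config_edge_level_graph t i j : config_edge (X t) i j = G t i j.
Proof.
have [Gsym Girr _ _] := G_graph.
rewrite /config_edge /= !inE /=; case: (ssrnat.ltngtP i j) => //= [_|/ord_inj ->].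
  exact: Gsym.
by rewrite Girr.
Qed.

Lemma triangles_law (thr : R) :
  P [set t | thr < (triangles (G t))%:R]
  = (\sum_(w | thr < #|cliques (config_edge w) 3|%:R) law P X w)%:E.
Proof.
rewrite -(law_event P mX (fun w => thr < #|cliques (config_edge w) 3|%:R)).
congr (P _); apply/seteqP; split => t /=; apply: etrans; congr (_ < _%:R);
  apply: eq_card => S; rewrite !inE; congr (_ && _);
  apply: eq_forallb => i; congr (_ ==> _); apply: eq_forallb => j;
  by rewrite config_edge_level_graph.
Qed.

Let p0 a : 0 <= p a. Proof. exact: level_prob_ge0. Qed.
Let p1 : \sum_a p a = 1. Proof. exact: (level_prob_sum1 W mlev). Qed.
Let pi0 w : 0 <= law P X w. Proof. exact: law_ge0. Qed.
Let qb0 (a b : K) : 0 <= qb a b. Proof. exact: qbar_ge0. Qed.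
Let ql0 (a b : K) : 0 <= ql a b. Proof. exact: qlow_ge0. Qed.

Let pi_le (phi : {ffun 'I_n -> K}) (J : {set 'I_n * 'I_n}) :
  (forall u, u \in J -> (u.1 < u.2)%N) ->
  \sum_(w : {ffun 'I_n -> K} * {set 'I_n * 'I_n} | (w.1 == phi) && (J \subset w.2)) law P X w
    <= prod_weight p phi * \prod_(u in J) qb (phi u.1) (phi u.2).
Proof.
move=> HJ; apply: (level_graph_edges_le W_iid G_graph W_ge1 mlev) => // u v u1 v1.
by have := edge_prob_le_qbar c_gt1 s_ge1 mu_ge1 A_ge A_le u1 v1; rewrite s2.
Qed.

Let pi_ge (phi : {ffun 'I_n -> K}) (J : {set 'I_n * 'I_n}) :
  (forall u, u \in J -> (u.1 < u.2)%N) ->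
  prod_weight p phi * \prod_(u in J) ql (phi u.1) (phi u.2)
    <= \sum_(w : {ffun 'I_n -> K} * {set 'I_n * 'I_n} | (w.1 == phi) && (J \subset w.2)) law P X w.
Proof.
move=> HJ; apply: (level_graph_edges_ge W_iid G_graph W_ge1 mlev) => // u v u1 v1.
by have := qlow_le_edge_prob c_gt1 s_ge1 mu_ge1 A_ge A_le u1 v1; rewrite s2.
Qed.

Lemma triangle_mean_qlow_ge : triangle_mean p qb <= c ^+ 6 * triangle_mean p ql.
Proof.
rewrite /triangle_mean mulr_sumr; apply: ler_sum => a _.
rewrite mulr_sumr; apply: ler_sum => b _; rewrite mulr_sumr; apply: ler_sum => e _.
rewrite [leRHS]mulrCA; apply: ler_wpM2l; first by rewrite !mulr_ge0.
have h (x y : K) : qb x y <= c ^+ 2 * ql x y by exact: qlow_ge.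
have -> : c ^+ 6 * (ql a b * (ql a e * ql b e))
   = (c ^+ 2 * ql a b) * ((c ^+ 2 * ql a e) * (c ^+ 2 * ql b e)) by ring.
by apply: ler_pM => //; [exact: mulr_ge0|apply: ler_pM].
Qed.

Lemma edge_mean_le : edge_mean p qb <= (\sum_a p a * knot c s A a) ^+ 2 / n%:R.
Proof.
rewrite /edge_mean expr2 mulr_suml mulr_suml; apply: ler_sum => a _.
rewrite mulr_sumr mulr_suml; apply: ler_sum => b _.
have h : qb a b <= knot c s A a / (mu * s ^+ 2) * knot c s A b by exact: qbar_le.
have k0 x : 0 < knot c s A x by exact: knot_gt0.
have -> : p a * knot c s A a * (p b * knot c s A b) / n%:R
  = p a * p b * (knot c s A a / n%:R * knot c s A b) by ring.
rewrite ler_wpM2l ?mulr_ge0 //; apply: (le_trans h); rewrite s2.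
rewrite ler_wpM2r ?(ltW (k0 _)) // ler_wpM2l ?(ltW (k0 _)) //.
by rewrite lef_pV2 ?posrE ?mulr_gt0 // ler_peMl // ltW.
Qed.

(** Each term is a power of mean over threshold. The means are at most [n ^ 3 * triangle_mean / 6]
    for triangles, [n * Y ^ 2] for edges, [t * Y] for neighbours of a vertex of rounded weight at
    most [t], and [n * tail (t / c)] for hubs; [t / c] appears because hubs are selected by rounded
    weight. *)
Lemma triangles_prob_upper (Y t thr m1 m2 m3 m4 : R) (z z4 : nat) : 1 <= t ->
  \sum_a p a * knot c s A a <= Y ->
  0 < m1 -> 0 < m2 -> 0 < m3 -> 0 < m4 ->
  m3 + (5 * z)%:R * m2 + (5 * z)%:R ^+ 2 * (m1 + z%:R)
    + (m4 + z4%:R) ^+ 2 / 2 * n%:R <= thr ->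
  fine (P [set x | thr < (triangles (G x))%:R])
  <= (n%:R ^+ 3 * triangle_mean p qb / (6 * m3)) ^+ z
   + (n%:R * Y ^+ 2 / m2) ^+ z + n%:R * (t * Y / m1) ^+ z
   + (n%:R * tail W (t / c) / m4) ^+ z4.
Proof.
move=> t1 HY m10 m20 m30 m40 Hthr; rewrite triangles_law /=.
have k0 a : 0 < knot c s A a by exact: knot_gt0.
have Y0 : 0 <= \sum_a p a * knot c s A a.
  by apply: sumr_ge0 => a _; rewrite mulr_ge0 // ltW.
have Y0' := le_trans Y0 HY.
pose hub : pred K := fun a => t < knot c s A a.
apply: (le_trans (triangles_tail_le pi0 hub (ltW m10) (ltW m20) (ltW m30) (ltW m40) Hthr)).
have divp (x y m : R) k : 0 < m -> x * m ^+ k <= y ^+ k -> x <= (y / m) ^+ k.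
  by move=> m0 h; rewrite expr_div_n ler_pdivlMr ?exprn_gt0.
have mono (x y : R) k : 0 <= x -> x <= y -> x ^+ k <= y ^+ k.
  by move=> x0 xy; rewrite lerXn2r ?nnegrE // (le_trans x0).
have D30 : 0 <= triangle_mean p qb.
  by apply: sumr_ge0 => a _; apply: sumr_ge0 => b _; apply: sumr_ge0 => e _; rewrite !mulr_ge0.
have D20 : 0 <= edge_mean p qb.
  by apply: sumr_ge0 => a _; apply: sumr_ge0 => b _; rewrite !mulr_ge0.
apply: lerD; [apply: lerD; [apply: lerD|]|].
- have h := cliques_deletion p1 pi0 pi_le z (ltW m30) D30 (fun S => @expect_pairs3 _ _ _ _ p1 qb S).
  apply: (le_trans (divp _ _ _ _ m30 h)).
  apply: mono; first by rewrite divr_ge0 ?mulr_ge0 // (ltW m30).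
  rewrite ler_pdivrMr //.
  have -> : n%:R ^+ 3 * triangle_mean p qb / (6 * m3) * m3 = n%:R ^+ 3 * triangle_mean p qb / 6.
    by field; rewrite gt_eqF.
  by rewrite ler_pdivlMr // mulrAC ler_wpM2r // -natrX -natrM ler_nat bin3_le.
- have h := cliques_deletion p1 pi0 pi_le z (ltW m20) D20 (fun S => @expect_pairs2 _ _ _ _ p1 qb S).
  apply: (le_trans (divp _ _ _ _ m20 h)).
  apply: mono; first by rewrite divr_ge0 ?mulr_ge0 // (ltW m20).
  rewrite ler_pM2r ?invr_gt0 //.
  apply: (@le_trans _ _ (n%:R ^+ 2 * (Y ^+ 2 / n%:R))).
    apply: ler_pM => //.
      rewrite -natrX ler_nat; apply: (@leq_trans (n ^_ 2)); first by rewrite -bin_ffact leq_pmulr.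
      by rewrite !ffactnS ffactn0 muln1 expnS expn1 leq_mul // leq_pred.
    apply: (le_trans edge_mean_le); rewrite ler_pM2r ?invr_gt0 //.
    by rewrite lerXn2r ?nnegrE.
  rewrite le_eqVlt; apply/orP; left; apply/eqP; field.
  by rewrite gt_eqF.
- apply: (@le_trans _ _ (\sum_(i < n) (t * Y / m1) ^+ z)); last first.
    by rewrite sumr_const card_ord mulr_natl.
  apply: ler_sum => i _.
  have r0 : 0 <= t / (mu * n%:R) by rewrite divr_ge0 ?mulr_ge0 // ?(ltW mu_gt0) // (le_trans ler01).
  have qy (a b : K) : ~~ hub a -> qb a b <= t / (mu * n%:R) * knot c s A b.
    rewrite /hub -leNgt => ha.
    have h : qb a b <= knot c s A a / (mu * s ^+ 2) * knot c s A b by exact: qbar_le.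
    apply: (le_trans h); rewrite s2.
    rewrite ler_wpM2r ?(ltW (k0 _)) // ler_wpM2r //.
    by rewrite invr_ge0 mulr_ge0 // ltW.
  have qC (a b : K) : qb a b = qb b a by exact: qbarC.
  have h := neighbours_deletion (low := fun a => ~~ hub a) p0 p1 pi0 qb0 qC pi_le pi_ge i z
    (ltW m10) r0 (fun a => ltW (k0 a)) qy.
  apply: (le_trans (divp _ _ _ _ m10 h)).
  apply: mono; first by rewrite divr_ge0 ?(ltW m10) // mulr_ge0 // mulr_ge0.
  rewrite ler_pM2r ?invr_gt0 //.
  have -> : n%:R * (t / (mu * n%:R) * \sum_a p a * knot c s A a)
     = t * (mu^-1 * \sum_a p a * knot c s A a).
    by field; rewrite !gt_eqF.
  rewrite ler_wpM2l ?(le_trans ler01 t1) //; apply: le_trans HY.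
  by rewrite ler_piMl // invf_le1.
- have h := hubs_deletion p0 p1 pi0 pi_le pi_ge hub z4 (ltW m40).
  apply: (le_trans (divp _ _ _ _ m40 h)).
  have h0 : 0 <= \sum_(a | hub a) p a by apply: sumr_ge0.
  apply: mono; first by rewrite divr_ge0 ?(ltW m40) // mulr_ge0.
  rewrite ler_pM2r ?invr_gt0 // ler_wpM2l //.
  apply: (sum_level_prob_le_tail W c_gt1 s_ge1) => a; rewrite /hub => ha.
  have a0 : (0 < a)%N.
    case: (posnP a) => // a0; move: ha; rewrite a0 ltNge => /negP[]; apply: le_trans t1.
    by have /andP[_] := knot0 c_gt1 s_ge1 mu_ge1 A_ge A_le.
  split => //; rewrite ler_pdivrMr //.
  have -> : knot c s A a.-1 * c = knot c s A a.
    by rewrite -(knotS s A c_gt1 a.-1) prednK // divfK // gt_eqF.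
  exact: ltW.
Qed.

(** Passing from [qlow] to [qbar] costs [c ^+ 6]; in return both tails rest on the asymptotics of
    the same mean. *)
Lemma triangles_prob_lower (thr m : R) (k l : nat) : (k * l <= n)%N -> 0 <= m -> (0 < A)%N ->
  thr < 'C(k, 2)%:R * (n - k * l)%:R + m ->
  ('C(n - k * l, 3)%:R * triangle_mean p qb / c ^+ 6 - m)
     * (1 - (1 - tail W (knot c s A (A + A) / c)) ^+ l) ^+ k
  <= n%:R ^+ 3 * fine (P [set x | thr < (triangles (G x))%:R]).
Proof.
move=> kln m0 A0 Hthr; rewrite triangles_law /=.
have qt (b : K) : ql ord_max b = 1 by exact: qlow_top.
have := triangles_tail_ge p1 pi0 (@qlowC _ _ _ _ _) pi_le pi_ge kln qt m0 Hthr.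
rewrite (level_prob_top W c_gt1 s_ge1) //; apply: le_trans; apply: ler_wpM2r.
  apply: exprn_ge0; rewrite subr_ge0 exprn_ile1 ?subr_ge0 ?tail_le1 //.
  by rewrite lerBlDr lerDl tail_ge0.
rewrite lerD2r -mulrA ler_wpM2l // ler_pdivrMr ?exprn_gt0 // mulrC.
exact: triangle_mean_qlow_ge.
Qed.

End FixedSize.

(** * Asymptotics *)

Section Eventually.
Context (R : realType).
Implicit Types (x q k : R).

Lemma near_natr_ge k : \forall n \near \oo, k <= (n%:R : R).
Proof.
exists (Num.bound `|k|) => // n /= hn; apply: (le_trans (ler_norm k)).
by apply: (le_trans (ltW (archi_boundP (normr_ge0 k)))); rewrite ler_nat.
Qed.

Lemma powR_mulE x p q : 0 < x -> x `^ p * x `^ q = x `^ (p + q).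
Proof. by move=> x0; rewrite powRD // (gt_eqF x0) implybT. Qed.

Lemma near_powR_ge q k : 0 < q -> \forall n \near \oo, k <= (n%:R : R) `^ q.
Proof.
move=> q0; near=> n.
have n1 : (1 : R) <= n%:R by near: n; exact: near_natr_ge.
have h : (Num.max k 1) `^ q^-1 <= (n%:R : R) by near: n; exact: near_natr_ge.
have m0 : 0 < Num.max k 1 by rewrite lt_max ltr01 orbT.
apply: (@le_trans _ _ (Num.max k 1)); first by rewrite le_max lexx.
have -> : Num.max k 1 = ((Num.max k 1) `^ q^-1) `^ q.
  by rewrite -powRrM mulVf ?gt_eqF // powRr1 // ltW.
by apply: ge0_ler_powR; rewrite ?nnegrE ?(ltW q0) ?powR_ge0.
Unshelve. all: by end_near. Qed.

Lemma near_powR_le p q k : p < q ->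
  \forall n \near \oo, k * (n%:R : R) `^ p <= n%:R `^ q.
Proof.
move=> pq; near=> n.
have n0 : (0 : R) < n%:R by apply: lt_le_trans ltr01 _; near: n; exact: near_natr_ge.
rewrite -[in leRHS](subrK p q) -powR_mulE //; apply: ler_wpM2r; first exact: powR_ge0.
by near: n; apply: near_powR_ge; rewrite subr_gt0.
Unshelve. all: by end_near. Qed.

Lemma near_ln_le q k : 0 < q -> 0 <= k ->
  \forall n \near \oo, k * ln (n%:R : R) <= n%:R `^ q.
Proof.
move=> q0 k0; near=> n.
have n0 : (0 : R) < n%:R by apply: lt_le_trans ltr01 _; near: n; exact: near_natr_ge.
have h : k * (2 / q) * (n%:R : R) `^ (q / 2) <= n%:R `^ q.
  by near: n; apply: near_powR_le; rewrite ltr_pdivrMr // ltr_pMr // ltr1n.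
apply: le_trans h; rewrite -mulrA ler_wpM2l //.
have -> : ln (n%:R : R) = 2 / q * ln ((n%:R : R) `^ (q / 2)).
  by rewrite ln_powR; field; rewrite gt_eqF.
rewrite ler_wpM2l ?divr_ge0 ?(ltW q0) //; apply/ltW/ln_sublinear; exact: powR_gt0.
Unshelve. all: by end_near. Qed.

Lemma near_ln_ge k : \forall n \near \oo, k <= ln (n%:R : R).
Proof.
near=> n; have h : expR k <= (n%:R : R) by near: n; exact: near_natr_ge.
by rewrite -(expRK k) ler_ln ?posrE ?expR_gt0 // (lt_le_trans (expR_gt0 k)).
Unshelve. all: by end_near. Qed.

Lemma powR_expR x q : 0 < x -> x `^ q = expR (q * ln x).
Proof. by move=> x0; rewrite /powR gt_eqF. Qed.

(** Lowering [b] to [b'] absorbs the constant [K]. The bound is uniform in [x] and [z] because both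
    will depend on [n]. *)
Lemma near_powR_exprn_le K b b' : b' < b ->
  \forall n \near \oo, forall x (z : nat), 0 <= x <= K * (n%:R : R) `^ (- b) ->
    x ^+ z <= expR (- (b' * z%:R * ln n%:R)).
Proof.
move=> bb; near=> n => x z /andP[x0 xK].
have n0 : (0 : R) < n%:R by apply: lt_le_trans ltr01 _; near: n; exact: near_natr_ge.
have h : K * (n%:R : R) `^ (- b) <= n%:R `^ (- b').
  by near: n; apply: near_powR_le; rewrite ltrN2.
have -> : - (b' * z%:R * ln n%:R) = (- b' * ln (n%:R : R)) * z%:R by ring.
rewrite expRM_natr -powR_expR //.
by rewrite lerXn2r ?nnegrE ?powR_ge0 // (le_trans xK).
Unshelve. all: by end_near. Qed.

Lemma near_powR_exprn_ge K b b' : 0 < K -> b < b' ->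
  \forall n \near \oo, forall x (z : nat), K * (n%:R : R) `^ (- b) <= x ->
    expR (- (b' * z%:R * ln n%:R)) <= x ^+ z.
Proof.
move=> K0 bb; near=> n => x z xK.
have n0 : (0 : R) < n%:R by apply: lt_le_trans ltr01 _; near: n; exact: near_natr_ge.
have h : K^-1 * (n%:R : R) `^ (- b') <= n%:R `^ (- b).
  by near: n; apply: near_powR_le; rewrite ltrN2.
have -> : - (b' * z%:R * ln n%:R) = (- b' * ln (n%:R : R)) * z%:R by ring.
rewrite expRM_natr -powR_expR //.
have h2 : (n%:R : R) `^ (- b') <= x.
  by apply: le_trans xK; rewrite -ler_pdivrMl.
by rewrite lerXn2r ?nnegrE ?powR_ge0 // (le_trans (powR_ge0 _ _) h2).
Unshelve. all: by end_near. Qed.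

(** A constant ratio to a power [n ^ (la + eta)] beats [n ^ (- th n ^ la)] for every [th]. The
    factor [n] serves the union over vertices, the 1/4 the four terms of the upper bound. *)
Lemma near_geometric_le (r la eta th : R) : 0 < r < 1 -> 0 < la -> 0 < eta -> 0 <= th ->
  \forall n \near \oo, forall z : nat, (n%:R : R) `^ (la + eta) <= z%:R ->
    n%:R * r ^+ z <= expR (- (th * (n%:R `^ la * ln n%:R))) / 4.
Proof.
move=> /andP[r0 r1] la0 eta0 th0.
have g0 : 0 < - ln r by rewrite oppr_gt0 ln_lt0 // r0.
have q0 : 0 <= (2 + th) / - ln r.
  by apply: divr_ge0; [exact: addr_ge0|exact: ltW].
near=> n => z hz.
have n1 : (1 : R) <= n%:R by near: n; exact: near_natr_ge.
have n0 : (0 : R) < n%:R by exact: lt_le_trans n1.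
have h4 : ln 4 <= ln (n%:R : R) by near: n; exact: near_ln_ge.
have hL : (1 : R) <= n%:R `^ la by near: n; exact: near_powR_ge.
(* In [2 + th], one unit pays for the factor [n], one for [ln 4], and [th] is the rate to be
   beaten. *)
have hE : ((2 + th) / - ln r) * ln (n%:R : R) <= n%:R `^ eta.
  by near: n; apply: near_ln_le.
have -> : n%:R * r ^+ z = expR (ln n%:R + ln r * z%:R).
  by rewrite expRD expRM_natr !lnK ?posrE.
have -> : expR (- (th * (n%:R `^ la * ln n%:R))) / 4
   = expR (- (th * (n%:R `^ la * ln n%:R)) - ln (4 : R)).
  by rewrite expRD [expR (- ln 4)]expRN lnK ?posrE.
rewrite ler_expR.
have hz' : - ln r * (n%:R `^ la * n%:R `^ eta) <= - ln r * z%:R.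
  by rewrite ler_wpM2l ?(ltW g0) // (powR_mulE _ _ n0).
have ln0 : 0 <= ln (n%:R : R) by rewrite ln_ge0.
have hE' : (2 + th) * ln (n%:R : R) <= - ln r * n%:R `^ eta.
  by move: hE; rewrite mulrAC ler_pdivrMr // [X in _ <= X]mulrC.
have hE2 : n%:R `^ la * ((2 + th) * ln (n%:R : R)) <= n%:R `^ la * (- ln r * n%:R `^ eta).
  by rewrite ler_wpM2l // (le_trans ler01).
have hl : ln (n%:R : R) <= n%:R `^ la * ln n%:R by rewrite ler_peMl.
set l := ln (n%:R : R) in hE2 hl h4 ln0 *; set Lr := n%:R `^ la in hz' hE2 hl *.
set E := n%:R `^ eta in hz' hE2 *.
have e1 : Lr * ((2 + th) * l) = 2 * (Lr * l) + th * (Lr * l) by ring.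
have e2 : Lr * (- ln r * E) = - ln r * (Lr * E) by ring.
rewrite e1 e2 in hE2.
by lra.
Unshelve. all: by end_near. Qed.

Lemma trunc_bounds x : 0 <= x -> (Num.truncn x)%:R <= x < (Num.truncn x)%:R + 1.
Proof. by move=> x0; have := truncn_itv x0; rewrite natr1. Qed.

End Eventually.

Lemma exists_exprn6 (R : realType) (q : R) : 0 < q -> exists2 c : R, 1 < c & c ^+ 6 = 1 + q.
Proof.
move=> q0; have q1 : 0 < 1 + q by rewrite addr_gt0.
have h : ((1 + q) `^ 6^-1) ^+ 6 = 1 + q.
  by rewrite -powR_mulrn ?powR_ge0 // -powRrM mulVf // powRr1 // ltW.
exists ((1 + q) `^ 6^-1) => //; rewrite ltNge; apply/negP => hc.
by have := exprn_ile1 6 (powR_ge0 _ _) hc; rewrite h gerDl leNgt q0.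
Qed.

(** The terms of order [z n], [z ^ 2 n ^ (1 - de)] and [z ^ 3] have exponents [la + eta + 1],
    [2 (la + eta) + 1 - de] and [3 (la + eta)]. The conditions on [eta] and [la] put each strictly
    below [1 + 2 la], and each term receives a third of [e]. *)
Lemma budget_near (R : realType) (la eta de Y e : R) : 0 < eta -> 0 < la -> la < 1 / 4 -> eta <= la / 2 ->
  eta <= de / 4 -> 0 < e ->
  \forall n \near \oo, forall z : nat, (z%:R : R) <= 2 * n%:R `^ (la + eta) ->
    (5 * z)%:R * (2 * Y ^+ 2 * n%:R) + (5 * z)%:R ^+ 2 * (2 * (n%:R `^ (1 - de) * Y) + z%:R)
      <= e * (n%:R : R) `^ (1 + 2 * la).
Proof.
move=> eta0 la0 la4 el ed e0; have e3 : 0 < e / 3 by rewrite divr_gt0.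
near=> n => z hz.
have n0 : (0 : R) < n%:R by apply: lt_le_trans ltr01 _; near: n; exact: near_natr_ge.
have h1 : 20 * Y ^+ 2 / (e / 3) * (n%:R : R) `^ (la + eta + 1) <= n%:R `^ (1 + 2 * la).
  by near: n; apply: near_powR_le; lra.
have h2 : 200 * `|Y| / (e / 3) * (n%:R : R) `^ (2 * (la + eta) + (1 - de)) <= n%:R `^ (1 + 2 * la).
  by near: n; apply: near_powR_le; lra.
have h3 : 200 / (e / 3) * (n%:R : R) `^ (3 * (la + eta)) <= n%:R `^ (1 + 2 * la).
  by near: n; apply: near_powR_le; lra.
move: h1 h2 h3; set X := n%:R `^ (1 + 2 * la).
have z0 : (0 : R) <= z%:R by [].
have -> : (n%:R : R) `^ (la + eta + 1) = n%:R `^ (la + eta) * n%:R.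
  by rewrite -[X in _ * X]powRr1 ?(ltW n0) // powR_mulE.
have -> : (n%:R : R) `^ (2 * (la + eta) + (1 - de)) = n%:R `^ (la + eta) ^+ 2 * n%:R `^ (1 - de).
  by rewrite expr2 !powR_mulE //; congr (_ `^ _); ring.
have -> : (n%:R : R) `^ (3 * (la + eta)) = n%:R `^ (la + eta) ^+ 3.
  by rewrite !exprS mulr1 !powR_mulE //; congr (_ `^ _); ring.
move: hz; set Z := n%:R `^ (la + eta); set D := n%:R `^ (1 - de) => hz.
have D0 : 0 <= D by exact: powR_ge0.
rewrite ![_ / (e / 3) * _]mulrAC !ler_pdivrMr // => h1 h2 h3.
have s2 : (z%:R : R) ^+ 2 <= 4 * Z ^+ 2.
  by have := lerXn2r 2 z0 (le_trans z0 hz) hz; rewrite exprMn; set q := Z ^+ 2; clear; lra.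
have s3 : (z%:R : R) ^+ 3 <= 8 * Z ^+ 3.
  by have := lerXn2r 3 z0 (le_trans z0 hz) hz; rewrite exprMn; set q := Z ^+ 3; clear; lra.
have t1 : z%:R * (Y ^+ 2 * n%:R) <= 2 * Z * (Y ^+ 2 * n%:R).
  by apply: ler_wpM2r => //; rewrite mulr_ge0 ?sqr_ge0 ?(ltW n0).
have t2 : (z%:R : R) ^+ 2 * (D * Y) <= 4 * Z ^+ 2 * (D * `|Y|).
  apply: le_trans (_ : z%:R ^+ 2 * (D * `|Y|) <= _).
    by rewrite ler_wpM2l ?sqr_ge0 // ler_wpM2l // ler_norm.
  by apply: ler_wpM2r => //; rewrite mulr_ge0.
rewrite natrM.
have -> : 5 * z%:R * (2 * Y ^+ 2 * n%:R) + (5 * z%:R) ^+ 2 * (2 * (D * Y) + z%:R)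
  = 10 * (z%:R * (Y ^+ 2 * n%:R)) + 50 * (z%:R ^+ 2 * (D * Y)) + 25 * z%:R ^+ 3 :> R by ring.
have u1 : 20 * Y ^+ 2 * (Z * n%:R) = 10 * (2 * Z * (Y ^+ 2 * n%:R)) :> R by ring.
have u2 : 200 * `|Y| * (Z ^+ 2 * D) = 50 * (4 * Z ^+ 2 * (D * `|Y|)) :> R by ring.
rewrite u1 in h1; rewrite u2 in h2; clear -h1 h2 h3 s3 t1 t2; lra.
Unshelve. all: by end_near. Qed.

Section HconstPositive.
Context (R : realType) (d : measure_display) (T : measurableType d)
    (P : probability T R) (W : nat -> {RV P >-> R}) (alpha C : R).
Hypotheses (alpha_gt1 : 1 < alpha) (alpha_lt2 : alpha < 2) (C_gt0 : 0 < C)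
    (W_ge1 : P [set x | 1 <= W 0%N x] = 1%E)
    (W_tail : asymp_equiv (fun t => fine (P [set x | t < W 0%N x]))
                (fun t => C * t `^ (- alpha))).
Let mu := weight_mean W.
Let H := Hconst mu alpha.
Let alpha_gt0 : 0 < alpha. Proof. exact: lt_trans alpha_gt1. Qed.
Let mu_gt0 : 0 < mu.
Proof.
have [_ h] := weight_mean_fin W_ge1 W_tail C_gt0 alpha_gt1.
exact: lt_le_trans h.
Qed.

(** One cell suffices: for ratio 2 and [B = 0] the window sum is positive, and it is bounded by a
    multiple of [H]. Positivity allows errors to be taken relative to [C ^ 3 H]. *)
Lemma Hconst_gt0 : 0 < H.
Proof.
have c1 : (1 : R) < 2 by rewrite ltr1n.
have [M HM] := window_sum_bounded W_ge1 W_tail C_gt0 alpha_gt1 alpha_lt2 c1.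
have [/(_ 0%N) h _] := window_sum_bounds c1 mu_gt0 alpha_gt0 HM.
move: h; rewrite /window_sum !big_ord1 /= /cell_mass /grid expr0 divr1 -/mu -/H => h.
have m0 : 0 < (1 / 2) `^ (- alpha) - (1 : R) `^ (- alpha).
  rewrite subr_gt0 !powRN ltf_pV2 ?posrE ?powR_gt0 //.
  by rewrite gt0_ltr_powR ?nnegrE // ltr_pdivrMr // mul1r ltr1n.
have f0 : 0 < f1 mu 1 1 1 :> R.
  have hm : 0 < Num.min mu^-1 1 by rewrite lt_min invr_gt0 mu_gt0 ltr01.
  by rewrite /f1 !mul1r !mulr_gt0.
have h2 : 0 < 2 ^+ 6 * (6 * H).
  by apply: (lt_le_trans _ h); exact: (mulr_gt0 (mulr_gt0 (mulr_gt0 m0 m0) m0) f0).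
by move: h2; rewrite pmulr_rgt0 ?exprn_gt0 // pmulr_rgt0.
Qed.

End HconstPositive.

Lemma sqrt_powR (R : realType) (alpha : R) n : (0 < n)%N -> (Num.sqrt n%:R : R) `^ alpha ^+ 3 * n%:R `^ (3 - 3 / 2 * alpha) = n%:R ^+ 3.
Proof.
move=> n0; have n0' : (0 : R) < n%:R by rewrite ltr0n.
have -> : (Num.sqrt n%:R : R) `^ alpha = n%:R `^ (alpha / 2).
  by rewrite -powR12_sqrt ?ler0n // -powRrM; congr (_ `^ _); ring.
rewrite -!powR_mulrn ?powR_ge0 // -powRrM powR_mulE //; congr (_ `^ _).
by field.
Qed.

Lemma near_sqrt_ge (R : realType) (k : R) : \forall n \near \oo, k <= (Num.sqrt n%:R : R).
Proof.
near=> n; have h : k ^+ 2 <= (n%:R : R) by near: n; exact: near_natr_ge.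
rewrite (le_trans (ler_norm k)) // -sqrtr_sqr ler_wsqrtr //.
Unshelve. all: by end_near. Qed.

Lemma upper_tail (R : realType) (d : measure_display) (T : measurableType d)
    (P : probability T R) (W : nat -> {RV P >-> R})
    (G : forall n : nat, T -> rel 'I_n) (alpha C a eps : R) :
  iid W -> (forall n, random_graph W (@G n)) -> 1 < alpha -> alpha < 4 / 3 -> 0 < C ->
  P [set x | 1 <= W 0%N x] = 1%E ->
  asymp_equiv (fun t => fine (P [set x | t < W 0%N x])) (fun t => C * t `^ (- alpha)) ->
  0 < a -> 0 < eps -> \forall n \near \oo,
  fine (P [set x | n%:R `^ (3 - 3 / 2 * alpha) * (C ^+ 3 * Hconst (weight_mean W) alpha + a)
                   < (triangles (@G n x))%:R])
  <= expR (- ((Num.sqrt (2 * a) * (alpha / 4) - eps) * (n%:R `^ (1 - 3 / 4 * alpha) * ln n%:R))).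
Proof.
move=> W_iid G_graph alpha_gt1 alpha_lt C_gt0 W_ge1 W_tail a_gt0 e0.
have alpha_lt2 : alpha < 2 by clear -alpha_lt; lra.
have alpha_gt0 : 0 < alpha by exact: lt_trans alpha_gt1.
have [_ mu_ge1] := weight_mean_fin W_ge1 W_tail C_gt0 alpha_gt1.
have Hconst_gt0 := Hconst_gt0 alpha_gt1 alpha_lt2 C_gt0 W_ge1 W_tail.
set mu := weight_mean W in mu_ge1 Hconst_gt0 *.
set H := Hconst mu alpha in Hconst_gt0 *; set la := 1 - 3 / 4 * alpha.
set theta := Num.sqrt (2 * a) * (alpha / 4).
have la_gt0 : 0 < la by clear -alpha_lt; rewrite /la; lra.
have la_lt : la < 1 / 4 by clear -alpha_gt1; rewrite /la; lra.
have mu_gt0 : 0 < mu by exact: lt_le_trans mu_ge1.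
have C3 : 0 < C ^+ 3 by exact: exprn_gt0.
have sqrt_gt0 : 0 < Num.sqrt (2 * a) by rewrite sqrtr_gt0 mulr_gt0.
have theta_gt0 : 0 < theta by rewrite mulr_gt0 // divr_gt0.
(* [tau] is the share of [a] given up to the bulk, the deletion error and the
   rounding of the number of hubs. *)
have [tau /andP[tau0 tau2] taue] : exists2 tau, 0 < tau <= 1 / 2 & 4 * tau * theta <= eps / 2.
  exists (Num.min (1 / 2) (eps / (8 * theta))).
    by rewrite lt_min ge_min lexx divr_gt0 // divr_gt0 // mulr_gt0.
  have : Num.min (1 / 2) (eps / (8 * theta)) <= eps / (8 * theta) by rewrite ge_min lexx orbT.
  by rewrite ler_pdivlMr ?mulr_gt0 //; have := theta_gt0; lra.
(* With this value the exponent [alpha / 4 - 2 * alpha * de] reached for the hubs is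
   [(1 - tau) * alpha / 4]. *)
pose de := tau / 8; have de0 : 0 < de by rewrite divr_gt0.
have tau1 : 0 <= 1 - tau by lra.
pose eta := Num.min (la / 2) (de / 4).
have eta0 : 0 < eta by rewrite lt_min !divr_gt0.
have etal : eta <= la / 2 by rewrite ge_min lexx.
have etad : eta <= de / 4 by rewrite ge_min lexx orbT.
(* Up to [kap * L] hubs are tolerated, worth at most [(1 - tau) * a * X] triangles. This number is
   split into the threshold [tau * kap * L] and the length [z4], close to [(1 - tau) * kap * L]. *)
pose kap := (1 - tau) * Num.sqrt (2 * a).
have kap0 : 0 < kap by rewrite mulr_gt0 // subr_gt0; lra.
(* The bulk surplus and the deletion error take [a * tau / 3] each; together with the hubs they stay
   below [a]. *)
pose e3 := a * tau / 3; have e30 : 0 < e3 by rewrite divr_gt0 // mulr_gt0.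
have CH : 0 < C ^+ 3 * H by rewrite mulr_gt0.
(* Rounding and the limit in [s] each add [3 / 2 * e3] to [6 * (C ^+ 3 * H)]. The mean is then at
   most [(C ^ 3 H + e3 / 2) X], below the threshold [(C ^ 3 H + e3) X] by the fixed factor [rho]. *)
have [|c c1 c6] := @exists_exprn6 _ (e3 / (4 * (C ^+ 3 * H))).
  by rewrite divr_gt0 // mulr_gt0.
have [|s0 s01 Hs] := triangle_mean_asymp W_ge1 W_tail C_gt0 alpha_gt1 alpha_lt2 c1 (e := 3 / 2 * e3).
  by rewrite mulr_gt0 // divr_gt0.
have [Y0 Y00 HY] := level_mean_bound W_ge1 W_tail C_gt0 alpha_gt1 c1.
have [M M1 HM] := tail_bound W_tail C_gt0 alpha_gt1.
pose Y := Y0 + 1; have Y1 : 1 <= Y by rewrite ler_wpDl.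
have Y_gt0 : 0 < Y by apply: lt_le_trans Y1.
pose rho := (C ^+ 3 * H + e3 / 2) / (C ^+ 3 * H + e3).
(* The value 1/2 is the ratio for edges and neighbours, whose thresholds are twice the bounds on the
   means. *)
pose r := Num.max rho (1 / 2).
have r01 : 0 < r < 1.
  rewrite lt_max gt_max /rho ltr_pdivrMr ?addr_gt0 // !mul1r ltrD2l.
  by rewrite invr_gt0 ltr0n orbT /= ltr_pdivrMr // ltr_pMr // ltr1n invf_lt1 ?ltr1n.
have rho0 : 0 <= rho by apply: ltW; rewrite divr_gt0 // addr_gt0 // divr_gt0.
pose K4 := M * c `^ alpha / (tau * kap).
near=> n.
have n1 : (1 : R) <= n%:R by near: n; exact: near_natr_ge.
have n0 : (0 : R) < n%:R by exact: lt_le_trans n1.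
have nn0 : (0 < n)%N by move: n0; rewrite ltr0n.
pose N : R := n%:R; pose L := N `^ la; pose v := L * ln N; pose X := N `^ (1 + 2 * la).
pose s : R := Num.sqrt n%:R.
have ss0 : s0 <= s by rewrite /s; near: n; exact: near_sqrt_ge.
have s1 : 1 <= s by exact: le_trans ss0.
have [A /andP[A_ge A_le]] : exists A, c * (mu * s) <= c ^+ A <= c ^+ 2 * (mu * s).
  by apply: exists_grid_size => //; rewrite mulr_ege1.
rewrite !mulrA in A_ge A_le.
have /andP[_ Hs'] := Hs s A ss0 A_ge A_le.
have HY' := HY s A s1 A_ge A_le.
pose z := (Num.truncn (N `^ (la + eta))).+1.
pose z4 := Num.truncn ((1 - tau) * kap * L).
have L0 : 0 < L by exact: powR_gt0.
have X0 : 0 < X by exact: powR_gt0.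
have /andP[zl zu] := trunc_bounds (powR_ge0 N (la + eta)).
have Z1 : 1 <= N `^ (la + eta) by rewrite /N; near: n; apply: near_powR_ge; exact: addr_gt0.
have zge : N `^ (la + eta) <= z%:R by rewrite /z -natr1 ltW.
have zle : z%:R <= 2 * N `^ (la + eta).
  by rewrite /z -natr1; move: zl Z1; set q := N `^ _; clear; lra.
have t40 : 0 <= (1 - tau) * kap * L by rewrite !mulr_ge0 ?(ltW kap0) ?(ltW L0).
have /andP[z4l z4u] := trunc_bounds t40.
rewrite -/z4 in z4l z4u; clear zl zu; clearbody z z4.
pose t := N `^ (1 - de).
have t1 : 1 <= t by rewrite /t /N; near: n; apply: near_powR_ge; clear -tau2; rewrite /de; lra.
have t0 : 0 < t by exact: lt_le_trans t1.
have budget : (5 * z)%:R * (2 * Y ^+ 2 * N) + (5 * z)%:R ^+ 2 * (2 * (t * Y) + z%:R) <= a * tau / 3 * X.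
  move: zle; move: (z); rewrite /t /X /N; near: n; apply: budget_near => //; rewrite ?divr_gt0 ?mulr_gt0 //.
have XL : L ^+ 2 * N = X.
  rewrite /L /X -powR_mulrn ?powR_ge0 // -powRrM -[X in _ * X]powRr1 ?(ltW n0) // powR_mulE //.
  by congr (_ `^ _); ring.
set thr := _ * (C ^+ 3 * H + a).
have thrE : thr = X * (C ^+ 3 * H + a).
  by rewrite /thr /X; congr (_ `^ _ * _); rewrite /la; field.
have kap2 : kap ^+ 2 <= (1 - tau) * (2 * a).
  rewrite exprMn sqr_sqrtr ?mulr_ge0 ?(ltW a_gt0) // ler_wpM2r ?mulr_ge0 ?(ltW a_gt0) //.
  by rewrite expr2 ler_piMl // gerBl ltW.
have hub : (tau * kap * L + z4%:R) ^+ 2 / 2 * N <= (1 - tau) * a * X.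
  have h : (tau * kap * L + z4%:R) ^+ 2 <= kap ^+ 2 * L ^+ 2.
    rewrite -exprMn; apply: lerXn2r; rewrite ?nnegrE ?addr_ge0 ?mulr_ge0 ?(ltW kap0) ?(ltW L0) ?(ltW tau0) //.
    by move: z4l; set q := z4%:R; clear; lra.
  have h2 : kap ^+ 2 * L ^+ 2 * N <= (1 - tau) * (2 * a) * X.
    by rewrite -mulrA XL ler_wpM2r // ltW.
  have h3 : (tau * kap * L + z4%:R) ^+ 2 * N <= kap ^+ 2 * L ^+ 2 * N by rewrite ler_wpM2r // ltW.
  by move: (le_trans h3 h2); set x := (_ + z4%:R) ^+ 2; clear; lra.
have total : (C ^+ 3 * H + e3) * X + (5 * z)%:R * (2 * Y ^+ 2 * N)
   + (5 * z)%:R ^+ 2 * (2 * (t * Y) + z%:R)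
   + (tau * kap * L + z4%:R) ^+ 2 / 2 * N <= thr.
  rewrite thrE; move: budget hub.
  have : 0 < a * tau * X by rewrite !mulr_gt0.
  set b1 := _ * (2 * Y ^+ 2 * N); set b2 := _ * (2 * (t * Y) + _); set b3 := _ / 2 * N.
  by rewrite /e3; clear; lra.
have pY : \sum_b level_prob W (@lev R c s A) b * knot c s A b <= Y.
  by rewrite (le_trans HY') // lerDl.
have m10 : 0 < 2 * (t * Y) by rewrite !mulr_gt0.
have m20 : 0 < 2 * Y ^+ 2 * N by rewrite !mulr_gt0 ?exprn_gt0.
have CHe : 0 < C ^+ 3 * H + e3 by rewrite addr_gt0.
have m30 : 0 < (C ^+ 3 * H + e3) * X by rewrite mulr_gt0.
have m40 : 0 < tau * kap * L by exact: mulr_gt0 (mulr_gt0 tau0 kap0) L0.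
have pu := triangles_prob_upper W_iid W_ge1 W_tail C_gt0 alpha_gt1 c1 nn0 (G_graph n) A_ge A_le
  t1 pY m10 m20 m30 m40 total.
apply: (le_trans pu) => {pu}; rewrite -/N -/mu.
have geo : N * r ^+ z <= expR (- (theta * v)) / 4.
  move: zge; move: (z); rewrite /v /L /N; near: n; apply: near_geometric_le => //.
  by rewrite ltW.
have ln4 : ln 4 <= ln N by rewrite /N; near: n; exact: near_ln_ge.
have ln40 : 0 <= ln (4 : R) by rewrite ln_ge0 // ler1n.
(* For the hub term, half of [eps] absorbs the division by 4. *)
have v_ge : ln 4 <= eps / 2 * v.
  have h : 2 / eps <= L by rewrite /L /N; near: n; exact: near_powR_ge.
  have : 2 / eps * ln N <= v by rewrite ler_wpM2r // (le_trans ln40).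
  move/(le_trans _) => h2.
  have h3 : 2 / eps * ln 4 <= v by apply: h2; rewrite ler_wpM2l // ltW // divr_gt0.
  have : eps / 2 * (2 / eps * ln 4) <= eps / 2 * v by rewrite ler_wpM2l // ltW // divr_gt0.
  by rewrite mulrA (_ : eps / 2 * (2 / eps) = 1) ?mul1r //; field; rewrite gt_eqF.
have v0 : 0 <= v by rewrite mulr_ge0 ?(ltW L0) // (le_trans ln40).
set E := expR (- ((theta - eps) * _)).
have ET : expR (- (theta * v)) <= E.
  by rewrite ler_expR -/N -/L -/v lerN2 ler_wpM2r // gerBl ltW.
have r0 : 0 <= r by rewrite (le_trans rho0) // le_max lexx.
have rz : r ^+ z <= E / 4.
  apply: (le_trans _ (le_trans geo _)); first by rewrite ler_peMl // exprn_ge0.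
  by rewrite ler_wpM2r.
have T1 : (N ^+ 3 * triangle_mean (level_prob W (@lev R c s A)) (@qbar R c mu A)
   / (6 * ((C ^+ 3 * H + e3) * X))) ^+ z <= E / 4.
  have tm0 : 0 <= triangle_mean (level_prob W (@lev R c s A)) (@qbar R c mu A).
    apply: sumr_ge0 => i _; apply: sumr_ge0 => j _; apply: sumr_ge0 => k _.
    by rewrite !mulr_ge0 ?level_prob_ge0 ?qbar_ge0.
  have d0 : 0 < 6 * ((C ^+ 3 * H + e3) * X) by exact: mulr_gt0.
  apply: le_trans rz; apply: lerXn2r; rewrite ?nnegrE //.
    exact: divr_ge0 (mulr_ge0 (exprn_ge0 3 (ltW n0)) tm0) (ltW d0).
  apply: (@le_trans _ _ rho); last by rewrite le_max lexx.
  rewrite ler_pdivrMr //.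
  have -> : N ^+ 3 = s `^ alpha ^+ 3 * X.
    by rewrite -(sqrt_powR alpha nn0); congr (_ * _ `^ _); rewrite /la; field.
  have -> : rho * (6 * ((C ^+ 3 * H + e3) * X)) = 6 * (C ^+ 3 * H + e3 / 2) * X.
    by rewrite /rho; field; rewrite gt_eqF.
  rewrite mulrAC; apply: ler_wpM2r; first exact: ltW.
  apply: (le_trans Hs'); rewrite c6 -/mu -/H.
  have -> : C ^+ 3 * ((1 + e3 / (4 * (C ^+ 3 * H))) * (6 * H)) = 6 * (C ^+ 3 * H) + 3 / 2 * e3.
    by field; rewrite !gt_eqF.
  by clear -e30; set q := C ^+ 3 * H; lra.
have T2 : (N * Y ^+ 2 / (2 * Y ^+ 2 * N)) ^+ z <= E / 4.
  have -> : N * Y ^+ 2 / (2 * Y ^+ 2 * N) = 1 / 2 by field; rewrite !gt_eqF.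
  by apply: le_trans rz; rewrite lerXn2r // ?nnegrE // le_max lexx orbT.
have T3 : N * (t * Y / (2 * (t * Y))) ^+ z <= E / 4.
  have -> : t * Y / (2 * (t * Y)) = 1 / 2 by field; rewrite !gt_eqF.
  apply: le_trans (le_trans geo _); last by rewrite ler_wpM2r.
  by rewrite ler_wpM2l ?(ltW n0) // lerXn2r // ?nnegrE // le_max lexx orbT.
(* The decisive term. As [t = N ^ (1 - de)], the base has exponent [1 - alpha * (1 - de) - la], that
   is [- (alpha / 4 - alpha * de)]; a second [alpha * de] is given up to absorb the constant
   [K4]. *)
have T4 : (N * tail W (t / c) / (tau * kap * L)) ^+ z4 <= E / 4.
  have x0 : 0 <= N * tail W (t / c) / (tau * kap * L).
    by rewrite divr_ge0 ?mulr_ge0 ?tail_ge0 ?(ltW n0) // ltW.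
  have xK : N * tail W (t / c) / (tau * kap * L) <= K4 * N `^ (- (alpha / 4 - alpha * de)).
    rewrite ler_pdivrMr //.
    have e1 : K4 * N `^ (- (alpha / 4 - alpha * de)) * (tau * kap * L)
       = M * c `^ alpha * (N `^ (- (alpha / 4 - alpha * de)) * L).
      by rewrite /K4; field; rewrite !gt_eqF.
    have e2 : N `^ (- (alpha / 4 - alpha * de)) * L = N * t `^ (- alpha).
      rewrite /L /t -powRrM -[X in _ = X * _]powRr1 ?(ltW n0) // !powR_mulE //.
      by congr (_ `^ _); rewrite /la; field.
    rewrite e1 e2 [leRHS]mulrCA; apply: ler_wpM2l; first exact: ltW.
    have c0 : 0 < c by exact: lt_trans c1.
    apply: (le_trans (HM _ _)); first exact: divr_gt0.
    rewrite -mulrA; apply: ler_wpM2l; first by rewrite (le_trans ler01).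
    by rewrite powRM ?invr_ge0 ?(ltW t0) ?(ltW c0) // mulrC ler_wpM2r ?powR_ge0 // -powR_inv1 ?(ltW c0) // -powRrM mulN1r opprK.
  have h : (N * tail W (t / c) / (tau * kap * L)) ^+ z4
     <= expR (- ((alpha / 4 - 2 * alpha * de) * z4%:R * ln N)).
    have : 0 <= N * tail W (t / c) / (tau * kap * L) <= K4 * N `^ (- (alpha / 4 - alpha * de)).
      by rewrite x0.
    move: (_ / (tau * kap * L)) (z4); rewrite /N; near: n; apply: near_powR_exprn_le.
    by have : 0 < alpha * de; [rewrite mulr_gt0|clear; lra].
  apply: (le_trans h).
  have -> : E / 4 = expR (- ((theta - eps) * v) - ln 4).
    by rewrite expRD [expR (- ln 4)]expRN lnK ?posrE.
  rewrite ler_expR.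
  have tkL : 1 <= tau * kap * L.
    have h1 : (tau * kap)^-1 <= L by rewrite /L /N; near: n; exact: near_powR_ge.
    by rewrite -ler_pdivrMl ?mulr1 // mulr_gt0.
  have z4ge : (1 - 2 * tau) * kap * L <= z4%:R.
    by move: z4u tkL; set q := z4%:R; clear; lra.
  have h2 : (theta - eps / 2) * L <= (alpha / 4 - 2 * alpha * de) * z4%:R.
    have b0 : 0 <= alpha / 4 - 2 * alpha * de.
      by have : 0 <= alpha * (1 - tau); [rewrite mulr_ge0 // ltW|rewrite /de; clear; lra].
    apply: le_trans (ler_wpM2l b0 z4ge).
    (* One factor [1 - tau] comes from [de], one from [kap], and [1 - 2 * tau] from [z4]. Their
       product is at least [1 - 4 * tau], which explains the condition [taue]. *)
    have -> : (alpha / 4 - 2 * alpha * de) * ((1 - 2 * tau) * kap * L)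
      = (1 - tau) ^+ 2 * (1 - 2 * tau) * theta * L by rewrite /de /kap /theta; field.
    apply: ler_wpM2r; first exact: ltW.
    have : 0 <= tau ^+ 2 * (5 - 2 * tau) * theta.
      have h5 : 0 <= 5 - 2 * tau by clear -tau2; lra.
      exact: mulr_ge0 (mulr_ge0 (sqr_ge0 tau) h5) (ltW theta_gt0).
    have -> : (1 - tau) ^+ 2 * (1 - 2 * tau) * theta = theta - 4 * tau * theta + tau ^+ 2 * (5 - 2 * tau) * theta by ring.
    by clear -taue; lra.
  have h3 : (theta - eps / 2) * L * ln N <= (alpha / 4 - 2 * alpha * de) * z4%:R * ln N.
    by rewrite ler_wpM2r // (le_trans ln40).
  have e1 : (theta - eps / 2) * L * ln N = (theta - eps / 2) * v by rewrite /v mulrA.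
  by rewrite e1 in h3; clear -h3 v_ge; lra.
move: T1 T2 T3 T4; clear; lra.
Unshelve. all: by end_near. Qed.

(** * The lower bound on the tail *)

Lemma bin2_sqr_le (R : realType) (k : nat) : (k.+1%:R : R) ^+ 2 / 2 <= 'C(k.+2, 2)%:R.
Proof.
have /(congr1 (fun i : nat => i%:R : R)) := mul_bin_diag k.+1.+1 1.
rewrite bin1 /= !natrM => h; have k0 : (0 : R) <= k%:R by [].
move: h; rewrite -[k.+2%:R]natr1 -[k.+1%:R]natr1.
set q := 'C(k.+2, 2)%:R; set x := k%:R in k0 *; clear -k0 => h.
have : (x + 1) ^+ 2 <= (x + 1 + 1) * (x + 1) by rewrite expr2; lra.
by rewrite h; lra.
Qed.

Lemma bin3_cube_ge (R : realType) (k : nat) : (k%:R : R) ^+ 3 / 6 <= 'C(k.+2, 3)%:R.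
Proof.
have /(congr1 (fun i : nat => i%:R : R)) := mul_bin_diag k.+2 2.
have /(congr1 (fun i : nat => i%:R : R)) := mul_bin_diag k.+1 1.
rewrite bin1 /= !natrM -[k.+2%:R]natr1 -[k.+1%:R]natr1.
have k0 : (0 : R) <= k%:R by [].
set q := 'C(k.+2, 3)%:R; set q2 := 'C(k.+1, 2)%:R; set x := k%:R in k0 *.
clear -k0 => h1 h2.
have h3 : 6 * q = (x + 1 + 1) * (x + 1) * x by rewrite -[RHS]mulrA h1; lra.
have x2 : 0 <= x ^+ 2 by exact: sqr_ge0.
have : x ^+ 3 <= (x + 1 + 1) * (x + 1) * x by rewrite !exprS mulr1; lra.
by rewrite -h3; lra.
Qed.

(** [(1 - p) ^ l <= 1 / (1 + l p) <= 1 - l p / 2], where the second step uses [l p <= 1]. *)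
Lemma one_sub_exprn_ge (R : realType) (p : R) (l : nat) : 0 <= p <= 1 -> l%:R * p <= 1 ->
  l%:R * p / 2 <= 1 - (1 - p) ^+ l.
Proof.
move=> /andP[p0 p1] lp.
have h : (1 - p) ^+ l * (1 + l%:R * p) <= 1.
  elim: l {lp} => [|l IH]; first by rewrite expr0 mul0r addr0 mulr1.
  apply: le_trans IH; rewrite exprSr -mulrA; apply: ler_wpM2l; first by rewrite exprn_ge0 // subr_ge0.
  have l0 : (0 : R) <= l%:R by [].
  have : 0 <= (l%:R + 1) * p ^+ 2 by rewrite mulr_ge0 ?sqr_ge0 // addr_ge0.
  by rewrite -natr1; clear; lra.
have y0 : 0 <= l%:R * p by rewrite mulr_ge0.
move: h lp y0; set x := (1 - p) ^+ l; set y := l%:R * p; clear => h lp y0.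
have : x <= (1 + y)^-1 by rewrite -[leRHS]mul1r ler_pdivlMr // ltr_pwDl.
have : (1 + y)^-1 <= 1 - y / 2.
  rewrite -[leLHS]mul1r ler_pdivrMr ?ltr_pwDl //.
  have : 0 <= y * (1 - y) by rewrite mulr_ge0 // subr_ge0.
  by lra.
by lra.
Qed.

Lemma powR_antitone (R : realType) (x y q : R) : 0 < x -> x <= y -> 0 <= q ->
  y `^ (- q) <= x `^ (- q).
Proof.
move=> x0 xy q0; have y0 : 0 < y by exact: lt_le_trans xy.
by rewrite !powRN lef_pV2 ?posrE ?powR_gt0 // ge0_ler_powR ?nnegrE // ltW.
Qed.

Lemma lower_tail (R : realType) (d : measure_display) (T : measurableType d)
    (P : probability T R) (W : nat -> {RV P >-> R})
    (G : forall n : nat, T -> rel 'I_n) (alpha C a eps : R) :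
  iid W -> (forall n, random_graph W (@G n)) -> 1 < alpha -> alpha < 4 / 3 -> 0 < C ->
  P [set x | 1 <= W 0%N x] = 1%E ->
  asymp_equiv (fun t => fine (P [set x | t < W 0%N x])) (fun t => C * t `^ (- alpha)) ->
  0 < a -> 0 < eps -> \forall n \near \oo,
  expR (- ((Num.sqrt (2 * a) * (alpha / 4) + eps) * (n%:R `^ (1 - 3 / 4 * alpha) * ln n%:R)))
  <= fine (P [set x | n%:R `^ (3 - 3 / 2 * alpha) * (C ^+ 3 * Hconst (weight_mean W) alpha + a)
                   < (triangles (@G n x))%:R]).
Proof.
move=> W_iid G_graph alpha_gt1 alpha_lt C_gt0 W_ge1 W_tail a_gt0 e0.
have alpha_lt2 : alpha < 2 by clear -alpha_lt; lra.
have alpha_gt0 : 0 < alpha by exact: lt_trans alpha_gt1.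
have [_ mu_ge1] := weight_mean_fin W_ge1 W_tail C_gt0 alpha_gt1.
have Hconst_gt0 := Hconst_gt0 alpha_gt1 alpha_lt2 C_gt0 W_ge1 W_tail.
set mu := weight_mean W in mu_ge1 Hconst_gt0 *.
set H := Hconst mu alpha in Hconst_gt0 *.
have HE : Hconst mu alpha = H by [].
clearbody H; set la := 1 - 3 / 4 * alpha.
set theta := Num.sqrt (2 * a) * (alpha / 4).
have la_gt0 : 0 < la by clear -alpha_lt; rewrite /la; lra.
have la_lt : la < 1 / 4 by clear -alpha_gt1; rewrite /la; lra.
have mu_gt0 : 0 < mu by exact: lt_le_trans mu_ge1.
have C3 : 0 < C ^+ 3 by exact: exprn_gt0.
have sqrt_gt0 : 0 < Num.sqrt (2 * a) by rewrite sqrtr_gt0 mulr_gt0.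
have theta_gt0 : 0 < theta by rewrite mulr_gt0 // divr_gt0.
have CH : 0 < C ^+ 3 * H by rewrite mulr_gt0.
(* The 7 comes from [(1 + tau) ^ 3 <= 1 + 7 * tau]: a factor [1 + tau] is lost in [kap], in the
   rounding of [k] and in the exponent of a single hub. *)
have [tau /andP[tau0 tau1] taue] : exists2 tau, 0 < tau <= 1 & 7 * tau * theta <= eps / 2.
  exists (Num.min 1 (eps / (14 * theta))).
    by rewrite lt_min ge_min lexx ltr01 divr_gt0 // mulr_gt0.
  have : Num.min 1 (eps / (14 * theta)) <= eps / (14 * theta) by rewrite ge_min lexx orbT.
  by rewrite ler_pdivlMr ?mulr_gt0 //; set q := Num.min _ _; clear; lra.
(* [t1] is the share of the bulk mean that is given up, so that the mean exceeds the required [m] by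
   a positive fraction; the loss is at most a quarter of [a * tau]. *)
have [t1 [t10 t11 t1a]] : exists t1, [/\ 0 < t1, t1 <= 1 / 2 & C ^+ 3 * H * t1 <= a * tau / 4].
  exists (Num.min (1 / 2) (a * tau / (4 * (C ^+ 3 * H)))); split.
  - by rewrite lt_min !divr_gt0 // mulr_gt0.
  - by rewrite ge_min lexx.
  have : Num.min (1 / 2) (a * tau / (4 * (C ^+ 3 * H))) <= a * tau / (4 * (C ^+ 3 * H)) by rewrite ge_min lexx orbT.
  by rewrite ler_pdivlMr ?mulr_gt0 //; set q := Num.min _ _; set r := C ^+ 3 * H; clear; lra.
(* [tp] bounds the share of vertices spent on blocks, the rounding through [c ^ 6 = 1 + tp], and the
   relative error of the mean. What remains is at least [(1 - 2 tp) ^ 3 (1 - tp) ^ 2 >= 1 - 8 tp],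
   hence at least [1 - t1 / 2]. *)
pose tp := Num.min (tau / 2) (t1 / 20).
have tp0 : 0 < tp by rewrite lt_min !divr_gt0.
have tpt : tp <= tau / 2 by rewrite ge_min lexx.
have tp1 : tp <= t1 / 20 by rewrite ge_min lexx orbT.
clearbody tp.
have tp2 : tp <= 1 / 40 by clear -tp1 t11; lra.
pose kap := (1 + tau) * Num.sqrt (2 * a).
have tau1_gt0 : 0 < 1 + tau by rewrite addr_gt0.
have kap0 : 0 < kap by rewrite mulr_gt0.
have [c c1 c6] := exists_exprn6 tp0.
have c0 : 0 < c by exact: lt_trans c1.
have [|s0 s01 Hs] := triangle_mean_asymp W_ge1 W_tail C_gt0 alpha_gt1 alpha_lt2 c1 (e := 6 * (C ^+ 3 * H) * tp).
  by rewrite !mulr_gt0.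
have [M M1 HM] := tail_bound W_tail C_gt0 alpha_gt1.
have half0 : (0 : R) < 1 / 2 by rewrite divr_gt0.
have [t0 t00 Ht0] := tail_asymp W_tail C_gt0 half0.
pose K1 := C / 2 * (c * mu) `^ (- alpha).
have K10 : 0 < K1 by rewrite mulr_gt0 ?powR_gt0 ?divr_gt0 // mulr_gt0.
pose K := tp * K1 / (4 * ((1 + tau) * kap)).
have K0 : 0 < K by exact: divr_gt0 (mulr_gt0 tp0 K10) (mulr_gt0 _ (mulr_gt0 tau1_gt0 kap0)).
have F0 : 0 < C ^+ 3 * H * (t1 / 2) by rewrite mulr_gt0 // divr_gt0.
near=> n.
have n1 : (1 : R) <= n%:R by near: n; exact: near_natr_ge.
have n0 : (0 : R) < n%:R by exact: lt_le_trans n1.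
have nn0 : (0 < n)%N by move: n0; rewrite ltr0n.
pose N : R := n%:R; pose L := N `^ la; pose v := L * ln N; pose X := N `^ (1 + 2 * la).
pose s : R := Num.sqrt n%:R.
have ss0 : s0 <= s by rewrite /s; near: n; exact: near_sqrt_ge.
have s1 : 1 <= s by exact: le_trans ss0.
have [A /andP[A_ge A_le]] : exists A, c * (mu * s) <= c ^+ A <= c ^+ 2 * (mu * s).
  by apply: exists_grid_size => //; rewrite mulr_ege1.
rewrite !mulrA in A_ge A_le.
have A0 : (0 < A)%N.
  rewrite lt0n; apply/eqP => AE; move: A_ge; rewrite AE expr0 leNgt => /negP; apply.
  by rewrite -mulrA (lt_le_trans c1) // ler_peMr ?(ltW c0) // mulr_ege1.
have /andP[Hs' _] := Hs s A ss0 A_ge A_le.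
have /andP[kt1 kt2] := knot_top c1 s1 A_ge A_le.
have sN : s ^+ 2 = N by rewrite sqr_sqrtr.
rewrite sN in kt1 kt2.
have L0 : 0 < L by exact: powR_gt0.
have X0 : 0 < X by exact: powR_gt0.
have N0 : 0 < N by [].
have kL0 : 0 < kap * L by exact: mulr_gt0.
have XL : L ^+ 2 * N = X.
  rewrite /L /X -powR_mulrn ?powR_ge0 // -powRrM -[X in _ * X]powRr1 ?(ltW n0) // powR_mulE //.
  by congr (_ `^ _); ring.
have thrE : n%:R `^ (3 - 3 / 2 * alpha) * (C ^+ 3 * H + a) = X * (C ^+ 3 * H + a).
  by rewrite /X; congr (_ `^ _ * _); rewrite /la; field.
rewrite thrE; clear thrE.
pose k0 := Num.truncn (kap * L).
have /andP[k0l k0u] : k0%:R <= kap * L < k0%:R + 1 by exact: trunc_bounds (ltW kL0).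
(* The two extra hubs give ['C(k, 2) >= (k0 + 1) ^ 2 / 2], which makes up for the truncation in
   [k0]. *)
clearbody k0; pose k := k0.+2.
have kge : (kap * L) ^+ 2 / 2 <= 'C(k, 2)%:R.
  apply: le_trans (bin2_sqr_le R k0); rewrite ler_wpM2r // -natr1.
  by apply: lerXn2r; rewrite ?nnegrE ?(ltW kL0) ?ltW // addr_gt0.
have kR : k%:R = k0%:R + 2 :> R by rewrite /k -!natr1; ring.
have k_gt0 : (0 : R) < k%:R by rewrite ltr0n.
have tkL : 2 <= tau * (kap * L).
  have h1 : (tau * kap)^-1 * 2 <= L by rewrite /L /N; near: n; exact: near_powR_ge.
  by rewrite mulrA -ler_pdivrMl // mulr_gt0.
have kle : k%:R <= (1 + tau) * (kap * L).
  by rewrite kR; move: k0l tkL; set q := kap * L; clear; lra.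
clearbody k.
(* With this block length the [k] blocks use at most the share [tp] of the vertices. *)
pose l := Num.truncn (tp * N / k%:R).
have tpNk : 0 <= tp * N / k%:R by rewrite divr_ge0 ?(ltW k_gt0) // mulr_ge0 // ltW.
have /andP[ll lu] : l%:R <= tp * N / k%:R < l%:R + 1 by exact: trunc_bounds.
clearbody l.
have kl_le : (k * l)%:R <= tp * N.
  by rewrite natrM mulrC -ler_pdivlMr.
have kln : (k * l <= n)%N.
  rewrite -(ler_nat R); apply: (le_trans kl_le); rewrite -/N ler_piMl ?(ltW n0) //.
  by clear -tp2; lra.
have tpN2 : 2 * ((1 + tau) * kap) / tp * L <= N.
  rewrite -[leRHS]powRr1 ?(ltW n0) // /L /N; near: n; apply: near_powR_le.
  by clear -la_lt; lra.
have l_ge : tp * N / (2 * k%:R) <= l%:R.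
  have h : 2 <= tp * N / k%:R.
    rewrite ler_pdivlMr // (le_trans (ler_wpM2l _ kle)) //.
    move: tpN2; rewrite mulrAC ler_pdivrMr // mulrC; clear; lra.
  have -> : tp * N / (2 * k%:R) = tp * N / k%:R / 2 by field; rewrite gt_eqF.
  by move: h lu; set q := tp * N / k%:R; clear; lra.
have nkl : (n - k * l)%:R = N - (k * l)%:R :> R by rewrite natrB.
have tpN : 2 <= tp * N.
  by rewrite mulrC -ler_pdivrMr // /N; near: n; exact: near_natr_ge.
have nklge : (1 - tp) * N <= (n - k * l)%:R.
  by rewrite nkl; move: kl_le; set q := _%:R; clear; lra.
pose m := C ^+ 3 * H * (1 - t1) * X.
have m0 : 0 <= m.
  have h : 0 <= 1 - t1 by clear -t11; lra.
  exact: mulr_ge0 (mulr_ge0 (ltW CH) h) (ltW X0).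
have thrlt : X * (C ^+ 3 * H + a) < 'C(k, 2)%:R * (n - k * l)%:R + m.
  have h1 : (kap * L) ^+ 2 / 2 * ((1 - tp) * N) <= 'C(k, 2)%:R * (n - k * l)%:R.
    apply: ler_pM => //; first by rewrite divr_ge0 // sqr_ge0.
    by apply: mulr_ge0; rewrite ?(ltW n0) //; clear -tp2; lra.
  apply: lt_le_trans (lerD h1 (lexx _)).
  have -> : (kap * L) ^+ 2 / 2 * ((1 - tp) * N) = (1 + tau) ^+ 2 * (1 - tp) * a * X.
    rewrite -XL /kap !exprMn sqr_sqrtr ?mulr_ge0 ?(ltW a_gt0) //; by field.
  have h2 : (1 + tau / 2) * a <= (1 + tau) ^+ 2 * (1 - tp) * a.
    apply: ler_wpM2r; first exact: ltW.
    have h3 : (1 + tau) ^+ 2 * (1 - tau / 2) <= (1 + tau) ^+ 2 * (1 - tp).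
      by apply: ler_wpM2l; [exact: sqr_ge0|clear -tpt; lra].
    apply: le_trans h3.
    have tau2 : tau ^+ 2 <= 1 by rewrite exprn_ile1 // ltW.
    have h4 : 0 <= tau * (2 - tau ^+ 2) by apply: mulr_ge0; [exact: ltW|clear -tau2; lra].
    have -> : (1 + tau) ^+ 2 * (1 - tau / 2) = 1 + tau / 2 + tau * (2 - tau ^+ 2) / 2 by field.
    by clear -h4; lra.
  have h5 := ler_wpM2r (ltW X0) h2.
  apply: lt_le_trans (lerD h5 (lexx _)).
  have h6 : C ^+ 3 * H * t1 * X <= a * tau / 4 * X by rewrite ler_wpM2r // ltW.
  have h7 : 0 < a * tau * X by rewrite !mulr_gt0.
  rewrite /m; move: h6 h7; set q := C ^+ 3 * H; clear; lra.
have pl := triangles_prob_lower W_iid W_ge1 W_tail C_gt0 alpha_gt1 c1 nn0 (G_graph n) A_ge A_le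
  kln m0 A0 thrlt.
move: pl; rewrite -/s -/mu -/N; set prob := fine _; set pt := tail _ _.
set tm := triangle_mean _ _ => pl.
have tm_ge : C ^+ 3 * H * (6 * (1 - tp)) * X <= N ^+ 3 * tm.
  have -> : N ^+ 3 = s `^ alpha ^+ 3 * X.
    by rewrite -(sqrt_powR alpha nn0); congr (_ * _ `^ _); rewrite /la; field.
  rewrite [leRHS]mulrAC; apply: ler_wpM2r; first exact: ltW.
  apply: le_trans Hs'; rewrite -/mu HE le_eqVlt; apply/orP; left; apply/eqP; ring.
have factor : C ^+ 3 * H * (t1 / 2) * X <= 'C(n - k * l, 3)%:R * tm / c ^+ 6 - m.
  have n'2 : 2 <= (n - k * l)%:R :> R.
    apply: le_trans nklge; apply: (le_trans tpN); rewrite ler_wpM2r ?(ltW N0) //.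
    by clear -tp2; lra.
  rewrite (ler_nat R 2) in n'2; case: (n - k * l)%N n'2 nklge => [|[|p]] // _ nklge.
  have pN : (1 - 2 * tp) * N <= p%:R.
    by move: nklge tpN; rewrite -!natr1; set q := p%:R; clear; lra.
  have x0 : 0 <= 1 - 2 * tp by clear -tp2; lra.
  have y0 : 0 <= 1 - tp by clear -tp2; lra.
  have p3 : (1 - 2 * tp) ^+ 3 * N ^+ 3 / 6 <= 'C(p.+2, 3)%:R.
    apply: le_trans (bin3_cube_ge R p); rewrite ler_wpM2r // -exprMn.
    by apply: lerXn2r => //; rewrite nnegrE // mulr_ge0 // ltW.
  have tm0 : 0 <= tm.
    apply: sumr_ge0 => i _; apply: sumr_ge0 => j _; apply: sumr_ge0 => e _.
    by rewrite !mulr_ge0 ?level_prob_ge0 ?qbar_ge0.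
  have ic : 1 - tp <= (c ^+ 6)^-1.
    rewrite c6 -[leRHS]mul1r ler_pdivlMr ?addr_gt0 //.
    by have := sqr_ge0 tp; clear; lra.
  have h1 := ler_pM (mulr_ge0 (divr_ge0 (mulr_ge0 (exprn_ge0 3 x0) (exprn_ge0 3 (ltW N0))) (ler0n _ 6)) tm0)
    y0 (ler_wpM2r tm0 p3) ic.
  apply: le_trans (lerB h1 (lexx m)).
  have -> : (1 - 2 * tp) ^+ 3 * N ^+ 3 / 6 * tm * (1 - tp) = (1 - 2 * tp) ^+ 3 * (1 - tp) / 6 * (N ^+ 3 * tm).
    by field.
  have h2 : (1 - 2 * tp) ^+ 3 * (1 - tp) / 6 * (C ^+ 3 * H * (6 * (1 - tp)) * X)
      <= (1 - 2 * tp) ^+ 3 * (1 - tp) / 6 * (N ^+ 3 * tm).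
    by apply: ler_wpM2l => //; rewrite divr_ge0 // mulr_ge0 // exprn_ge0.
  apply: le_trans (lerB h2 (lexx m)).
  have -> : (1 - 2 * tp) ^+ 3 * (1 - tp) / 6 * (C ^+ 3 * H * (6 * (1 - tp)) * X) - m
    = ((1 - 2 * tp) ^+ 3 * (1 - tp) ^+ 2 - (1 - t1)) * (C ^+ 3 * H * X) by rewrite /m; field.
  have -> : C ^+ 3 * H * (t1 / 2) * X = t1 / 2 * (C ^+ 3 * H * X) by field.
  apply: ler_wpM2r.
    by rewrite mulr_ge0 ?(ltW CH) // ltW.
  have a1 : 1 - 6 * tp <= (1 - 2 * tp) ^+ 3.
    have : 0 <= tp ^+ 2 * (12 - 8 * tp) by apply: mulr_ge0; [exact: sqr_ge0|clear -tp2; lra].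
    have -> : (1 - 2 * tp) ^+ 3 = 1 - 6 * tp + tp ^+ 2 * (12 - 8 * tp) by ring.
    by clear; lra.
  have a2 : 1 - 2 * tp <= (1 - tp) ^+ 2.
    have -> : (1 - tp) ^+ 2 = 1 - 2 * tp + tp ^+ 2 by ring.
    by rewrite lerDl sqr_ge0.
  have x6 : 0 <= 1 - 6 * tp by clear -tp2; lra.
  have := ler_pM x6 x0 a1 a2.
  have : 0 <= tp ^+ 2 by exact: sqr_ge0.
  have -> : (1 - 6 * tp) * (1 - 2 * tp) = 1 - 8 * tp + 12 * tp ^+ 2 by ring.
  by set q := _ * (1 - tp) ^+ 2; set r := tp ^+ 2; clear -tp1 t10; lra.
have [pt0 pt1] : 0 <= pt /\ pt <= 1 by rewrite /pt tail_ge0 tail_le1.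
have kc1 : mu * N <= knot c s A (A + A) / c by rewrite ler_pdivlMr // mulrC.
have kc2 : knot c s A (A + A) / c <= c * mu * N.
  by rewrite ler_pdivrMr // (le_trans kt2) // le_eqVlt; apply/orP; left; apply/eqP; ring.
have muN : N <= mu * N by rewrite ler_peMl // ltW.
have pt_ge : K1 * N `^ (- alpha) <= pt.
  have h : t0 <= knot c s A (A + A) / c.
    by rewrite (le_trans _ (le_trans muN kc1)) // /N; near: n; exact: near_natr_ge.
  have /andP[h1 _] := Ht0 _ h; apply: le_trans h1.
  have -> : K1 * N `^ (- alpha) = (1 - 1 / 2) * C * (c * mu * N) `^ (- alpha).
    by rewrite [(c * mu * N) `^ _]powRM ?(ltW N0) ?mulr_ge0 ?(ltW c0) ?(ltW mu_gt0) // /K1; field.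
  apply: ler_wpM2l; first by rewrite mulr_ge0 ?(ltW C_gt0) //; clear; lra.
  by apply: powR_antitone kc2 _; [rewrite (lt_le_trans _ kc1) // mulr_gt0|exact: ltW].
have lpt1 : l%:R * pt <= 1.
  have h1 : pt <= M * N `^ (- alpha).
    apply: (le_trans (HM _ _)); first by rewrite (lt_le_trans _ kc1) // mulr_gt0.
    apply: ler_wpM2l; first by rewrite (le_trans ler01).
    by apply: powR_antitone => //; [exact: le_trans kc1|exact: ltW].
  have h2 : l%:R <= N.
    apply: (le_trans ll); rewrite ler_pdivrMr // mulrC ler_wpM2l ?(ltW N0) //.
    have : 1 <= k%:R :> R by rewrite ler1n -(ltr0n R).
    by move: tp2; clear; lra.
  have h3 : M * N `^ (1 - alpha) <= N `^ 0.
    by rewrite /N; near: n; apply: near_powR_le; rewrite subr_lt0.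
  rewrite powRr0 -powR_mulE // powRr1 ?(ltW N0) // in h3.
  apply: le_trans h3; rewrite mulrCA; exact: ler_pM.
(* A block has of the order of [N / L] vertices, each a hub with probability of order
   [N ^ (- alpha)]; the exponent [1 - la - alpha] equals [- alpha / 4]. *)
have hit : K * N `^ (- (alpha / 4)) <= 1 - (1 - pt) ^+ l.
  apply: le_trans (one_sub_exprn_ge _ lpt1); last by rewrite pt0.
  have e1 : N `^ (- (alpha / 4)) = N * N `^ (- alpha) / L.
    rewrite /L -powRN -[X in _ = X * _ * _]powRr1 ?(ltW N0) // !powR_mulE //.
    by congr (_ `^ _); rewrite /la; field.
  have -> : K * N `^ (- (alpha / 4)) = tp * N / (2 * ((1 + tau) * (kap * L))) * (K1 * N `^ (- alpha)) / 2.
    by rewrite e1 /K; field; rewrite !gt_eqF.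
  rewrite ler_wpM2r //; apply: ler_pM => //.
  - by rewrite divr_ge0 ?mulr_ge0 ?(ltW tp0) ?(ltW N0) ?(ltW tau1_gt0) // ltW.
  - by rewrite mulr_ge0 ?powR_ge0 // ltW.
  apply: le_trans l_ge; apply: ler_wpM2l; first by rewrite mulr_ge0 // ltW.
  by rewrite lef_pV2 ?posrE ?ler_wpM2l ?mulr_gt0.
have hitk : expR (- (alpha / 4 * (1 + tau) * k%:R * ln N)) <= (1 - (1 - pt) ^+ l) ^+ k.
  move: hit; move: (1 - (1 - pt) ^+ l) (k); rewrite /N; near: n; apply: near_powR_exprn_ge => //.
  by rewrite ltr_pMr ?divr_gt0 // ltrDl.
have lnN : 0 <= ln N by rewrite ln_ge0.
have FX : 1 <= C ^+ 3 * H * (t1 / 2) * X.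
  rewrite mulrC -ler_pdivrMr // mul1r /X /N; near: n; apply: near_powR_ge.
  by clear -la_gt0; lra.
(* The factor [N ^ 3] of the first-moment argument costs [3 * ln N], absorbed by half of [eps]. *)
have L6 : 3 <= eps / 2 * L.
  have h : (eps / 2)^-1 * 3 <= L by rewrite /L /N; near: n; exact: near_powR_ge.
  by rewrite -ler_pdivrMl // divr_gt0.
have h1 : expR (- (alpha / 4 * (1 + tau) * k%:R * ln N)) <= N ^+ 3 * prob.
  apply: (le_trans hitk); apply: le_trans pl.
  have e1 : 1 <= 'C(n - k * l, 3)%:R * tm / c ^+ 6 - m by exact: le_trans factor.
  by apply: ler_peMl e1; exact: le_trans (expR_ge0 _) hitk.
rewrite -(@ler_pM2l _ (N ^+ 3)) ?exprn_gt0 //; apply: le_trans h1.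
have -> : N ^+ 3 = expR (3%:R * ln N) by rewrite expRM_natl lnK ?posrE.
rewrite -expRD ler_expR -/L -/N -/v.
have h2 : alpha / 4 * (1 + tau) * k%:R <= (theta + eps / 2) * L.
  have q0 : 0 <= alpha / 4 * (1 + tau) by rewrite mulr_ge0 ?divr_ge0 ?(ltW tau1_gt0) // ltW.
  apply: (le_trans (ler_wpM2l q0 kle)).
  have -> : alpha / 4 * (1 + tau) * ((1 + tau) * (kap * L)) = (1 + tau) ^+ 3 * theta * L.
    by rewrite /kap /theta; field.
  apply: ler_wpM2r; first exact: ltW.
  have h3 : (1 + tau) ^+ 3 <= 1 + 7 * tau.
    have : 0 <= tau * (1 - tau) * (tau + 4).
      by apply: mulr_ge0; [apply: mulr_ge0; [exact: ltW|clear -tau1; lra]|clear -tau0; lra].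
    have -> : (1 + tau) ^+ 3 = 1 + 7 * tau - tau * (1 - tau) * (tau + 4) by ring.
    by set q := tau * _ * _; clear; lra.
  apply: (le_trans (ler_wpM2r (ltW theta_gt0) h3)).
  by clear -taue; lra.
have h4 := ler_wpM2r lnN h2.
have h5 := ler_wpM2r lnN L6.
have e1 : (theta + eps / 2) * L * ln N = (theta + eps / 2) * v by rewrite /v mulrA.
have e2 : eps / 2 * L * ln N = eps / 2 * v by rewrite /v mulrA.
rewrite e1 in h4; rewrite e2 in h5.
by move: h4 h5; set q := _ * k%:R * _; clear; lra.
Unshelve. all: by end_near. Qed.

Theorem theorem1p4 (R : realType) (d : measure_display) (T : measurableType d)
    (P : probability T R) (W : nat -> {RV P >-> R})
    (G : forall n : nat, T -> rel 'I_n) (alpha C : R)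
    (W_iid : iid W)
    (F_continuous : continuous (cdf (W 0%N)))
    (G_graph : forall n, random_graph W (@G n))
    (alpha_gt1 : 1 < alpha) (alpha_lt : alpha < 4 / 3) (C_gt0 : 0 < C)
    (W_ge1 : P [set x | 1 <= W 0%N x] = 1%E)
    (W_tail : asymp_equiv (fun t => fine (P [set x | t < W 0%N x]))
                (fun t => C * t `^ (- alpha)))
    (a : R) (a_gt0 : 0 < a) :
  let H := Hconst (weight_mean W) alpha in
  (lne (P [set x | (n%:R `^ (3 - 3 / 2 * alpha) * (C ^+ 3 * H + a)
                     < (triangles (G n x))%:R)%R])
    * ((n%:R `^ (1 - 3 / 4 * alpha) * ln n%:R)^-1)%:E)%E @[n --> \oo]
  --> (- (Num.sqrt (2 * a) * (alpha / 4)))%:E.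
Proof.
move=> H; pose v n : R := n%:R `^ (1 - 3 / 4 * alpha) * ln n%:R.
pose p n : R := fine (P [set x | n%:R `^ (3 - 3 / 2 * alpha) * (C ^+ 3 * H + a)
                     < (triangles (G n x))%:R]).
set theta := Num.sqrt (2 * a) * (alpha / 4).
have upper eps : 0 < eps -> \forall n \near \oo, p n <= expR (- ((theta - eps) * v n)).
  exact: upper_tail.
have lower eps : 0 < eps -> \forall n \near \oo, expR (- ((theta + eps) * v n)) <= p n.
  exact: lower_tail.
(* The lower bound also gives positivity for large [n], where [lne] is then the real logarithm and
   not [-oo]. *)
have p_gt0 : \forall n \near \oo, 0 < p n.
  by apply: filterS (lower 1 ltr01) => n; exact: lt_le_trans (expR_gt0 _).
have v_gt0 : \forall n \near \oo, 0 < v n.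
  near=> n; rewrite mulr_gt0 ?powR_gt0 ?ln_gt0 ?ltr0n ?ltr1n //; first by near: n; exists 1%N.
  by near: n; exists 2%N.
have E n : (0 < n)%N -> 0 < p n ->
   (lne (P [set x | (n%:R `^ (3 - 3 / 2 * alpha) * (C ^+ 3 * H + a)
                     < (triangles (G n x))%:R)%R])
    * ((n%:R `^ (1 - 3 / 4 * alpha) * ln n%:R)^-1)%:E)%E = (ln (p n) / v n)%:E.
  move=> n0 pn0.
  have -> : P [set x | (n%:R `^ (3 - 3 / 2 * alpha) * (C ^+ 3 * H + a)
                     < (triangles (G n x))%:R)%R] = (p n)%:E.
    have c1 : (1 : R) < 2 by rewrite ltr1n.
    by rewrite /p (triangles_law c1 n0 (G_graph n) 0).
  by rewrite lne_EFin.
have lim : ln (p n) / v n @[n --> \oo] --> - theta.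
  apply/cvgrPdist_le => eps e0; near=> n.
  have v0 : 0 < v n by near: n.
  have p0 : 0 < p n by near: n.
  have h1 : ln (p n) <= - ((theta - eps) * v n).
    by rewrite -[leRHS]expRK ler_ln ?posrE ?expR_gt0 //; near: n; exact: upper.
  have h2 : - ((theta + eps) * v n) <= ln (p n).
    by rewrite -[leLHS]expRK ler_ln ?posrE ?expR_gt0 //; near: n; exact: lower.
  have h3 : ln (p n) / v n <= - (theta - eps) by rewrite ler_pdivrMr // mulNr.
  have h4 : - (theta + eps) <= ln (p n) / v n by rewrite ler_pdivlMr // mulNr.
  rewrite ler_norml; move: h3 h4; set q := _ / _; set t := theta; clear; lra.
have limE : (ln (p n) / v n)%:E @[n --> \oo] --> (- theta)%:E.
  by apply: cvg_EFin lim; exact: nearW.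
apply: cvg_trans limE; apply: near_eq_cvg; near=> n.
by rewrite E //; [near: n; exists 1%N|near: n].
Unshelve. all: by end_near. Qed.
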